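(* Let $\Gamma$ be a discrete subgroup of $\mathrm{Sp}_4(\mathbb R)$, $H$ a connected domain in the upper half-plane, $t:H\to\mathbb C$ meromorphic, and $\tau_1=\tau$, $\tau_2=-\int_{c_1}^{\tau}t(\tau)\,\mathrm d\tau$, $\tau_3=\int_{c_2}^{\tau}t(\tau)^2\,\mathrm d\tau$, $\mathrm T(\tau)=\begin{pmatrix}\tau_1&\tau_2\\ \tau_2&\tau_3\end{pmatrix}$, subject to the standing assumptions in the context. If $z,w:\mathscr C\to\mathbb C$ are non-constant meromorphic functions satisfying $$z(\gamma\mathrm T)=z(\mathrm T),\qquad w(\gamma\mathrm T)=\chi(\gamma)\det(C\mathrm T+D)\,w(\mathrm T)\quad\text{for all }\gamma=\begin{pmatrix}A&B\\ C&D\end{pmatrix}\in\Gamma,$$ where $\chi$ is a character of $\Gamma$, then $w,\ \tau_1w,\ \tau_2w,\ \tau_3w,\ (\tau_1\tau_3-\tau_2^2)w$, viewed as functions of $z$, are solutions of a fifth order linear differential equation whose coefficients are invariant under the substitution of $\mathrm T$ by $\gamma\mathrm T$ for all $\gamma\in\Gamma$.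
   Context: Standing assumptions: $\tau_2,\tau_3$ are multivalued depending on the integration paths; for each residue $r$ of $t(\tau)$ the matrix $\begin{pmatrix}1&0&0&2\pi ir\\0&1&2\pi ir&0\\0&0&1&0\\0&0&0&1\end{pmatrix}$ lies in $\Gamma$, and for each residue $s$ of $t(\tau)^2$ the matrix $\begin{pmatrix}1&0&0&0\\0&1&0&2\pi is\\0&0&1&0\\0&0&0&1\end{pmatrix}$ lies in $\Gamma$. $\mathscr C=\{\mathrm T(\tau):\tau\in H\}\subset M_2(\mathbb C)$ (all branches included), and it is assumed that $\begin{pmatrix}A&B\\ C&D\end{pmatrix}\cdot\mathrm T=(A\mathrm T+B)(C\mathrm T+D)^{-1}$ (with $2\times2$ blocks) defines a group action of $\Gamma$ on $\mathscr C$; $\gamma\mathrm T$ denotes this action. *)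

(* Defs.v *)
From HB Require Import structures.
From mathcomp Require Import all_boot all_order all_algebra.
From mathcomp Require Import complex.
From mathcomp Require Import all_classical all_reals all_analysis.

Set Implicit Arguments.
Unset Strict Implicit.
Unset Printing Implicit Defensive.

Import Order.TTheory GRing.Theory Num.Theory numFieldNormedType.Exports.

Local Open Scope ring_scope.
Local Open Scope complex_scope.
Local Open Scope classical_set_scope.

(* The alias gives R[i] the topology that MathComp-Analysis attaches to a
   numClosedFieldType; the bare type R[i] is not recognized as a topological
   space. *)
Definition Cx (R : realType) : numClosedFieldType := R[i].

Section ComplexFunctions.
Variable R : realType.
Local Notation C := (Cx R).

Definition power_series (c : nat -> C) (a x : C) : C^nat :=
  series (fun k => c k * (x - a) ^+ k).

Definition holomorphic_at (f : C -> C) (a : C) : Prop :=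
  exists c : nat -> C, \forall x \near a, power_series c a x @ \oo --> f x.

Definition holomorphic_on (V : set C) (f : C -> C) : Prop :=
  forall a, V a -> holomorphic_at f a.

(* A pole of order m + 1. As x / 0 = 0, the equation at x = a says f a = 0:
   a meromorphic function is encoded by the total function that takes the
   value 0 at its poles and its true value elsewhere. Removable singularities
   are thereby excluded, so the encoding is unique. *)
Definition pole_at (f : C -> C) (a : C) : Prop :=
  exists (m : nat) (g : C -> C),
    [/\ holomorphic_at g a, g a != 0 &
        \forall x \near a, f x = g x / (x - a) ^+ m.+1].

Definition meromorphic_at (f : C -> C) (a : C) : Prop :=
  holomorphic_at f a \/ pole_at f a.

Definition meromorphic_on (V : set C) (f : C -> C) : Prop :=
  forall a, V a -> meromorphic_at f a.

(* The Laurent expansion of f at a is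
   \sum_k c k * (x - a) ^ (k - (N + 1)), with residue c N. *)
Definition is_residue (f : C -> C) (a r : C) : Prop :=
  exists (N : nat) (c : nat -> C), r = c N /\
    \forall x \near a^',
      power_series c a x @ \oo --> (x - a) ^+ N.+1 * f x.

(* An arc is parametrized by [0, 1]; p is C^1 on all of R, which loses no arc
   that is C^1 up to the end points. *)
Definition C1_arc (D : set C) (p : R -> C) (a b : C) : Prop :=
  let x := fun s => complex.Re (p s) in
  let y := fun s => complex.Im (p s) in
  [/\ (forall s, derivable x s 1) /\ (forall s, derivable y s 1),
      continuous (x^`()) /\ continuous (y^`()),
      p 0 = a, p 1 = b & forall s, 0 <= s <= 1 -> D (p s)].

Definition arc_integral (f : C -> C) (p : R -> C) : C :=
  let dp : R -> C := fun s =>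
    (fun u => complex.Re (p u))^`() s +i* (fun u => complex.Im (p u))^`() s in
  let g : R -> C := fun s => f (p s) * dp s in
  (\int[lebesgue_measure]_(s in `[0%R, 1%R]) complex.Re (g s)) +i*
  (\int[lebesgue_measure]_(s in `[0%R, 1%R]) complex.Im (g s)).

(* path_integral D f a b v: v is the integral of f along some piecewise C^1
   path from a to b inside D. *)
Inductive path_integral (D : set C) (f : C -> C) (a : C) : C -> C -> Prop :=
| path_integral_nil : D a -> path_integral D f a a 0
| path_integral_rcons (b c v : C) (p : R -> C) :
    path_integral D f a b v -> C1_arc D p b c ->
    path_integral D f a c (v + arc_integral f p).

Definition domain_in_upper_half_plane (H : set C) : Prop :=
  [/\ open H, connected H, H !=set0 & forall x, H x -> 0 < complex.Im x].

End ComplexFunctions.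

Section Symplectic.
Variable R : realType.
Local Notation C := (Cx R).

Definition sympl_form : 'M[R]_(2 + 2) := block_mx 0 1%:M (- 1%:M) 0.

Definition Sp4 : set 'M[R]_(2 + 2) :=
  [set g | g^T *m sympl_form *m g = sympl_form].

Definition discrete_subgroup_Sp4 (G : set 'M[R]_(2 + 2)) : Prop :=
  [/\ G `<=` Sp4, G 1%:M, (forall g h, G g -> G h -> G (g *m h)),
      (forall g, G g -> G (invmx g)) & G `<=` isolated G].

Definition is_character (G : set 'M[R]_(2 + 2)) (chi : 'M[R]_(2 + 2) -> C) :
    Prop :=
  (forall g, G g -> chi g != 0) /\
  (forall g h, G g -> G h -> chi (g *m h) = chi g * chi h).

Definition complexify (g : 'M[R]_(2 + 2)) : 'M[C]_(2 + 2) :=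
  map_mx (fun x : R => x%:C : C) g.

Definition denom (g : 'M[R]_(2 + 2)) (T : 'M[C]_2) : 'M[C]_2 :=
  dlsubmx (complexify g) *m T + drsubmx (complexify g).

Definition act (g : 'M[R]_(2 + 2)) (T : 'M[C]_2) : 'M[C]_2 :=
  (ulsubmx (complexify g) *m T + ursubmx (complexify g)) *m invmx (denom g T).

Definition acts_on (G : set 'M[R]_(2 + 2)) (X : set 'M[C]_2) : Prop :=
  [/\ forall g T, G g -> X T -> denom g T \in unitmx,
      forall g T, G g -> X T -> X (act g T),
      forall T, X T -> act 1%:M T = T &
      forall g h T, G g -> G h -> X T -> act (g *m h) T = act g (act h T)].

Definition sym2 (a b c : C) : 'M[C]_2 :=
  \matrix_(i < 2, j < 2) [:: a; b; c]`_(i + j).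

(* The matrix is complex a priori: membership in G includes its being real. *)
Definition contains_translation (G : set 'M[R]_(2 + 2)) (S : 'M[C]_2) : Prop :=
  exists2 g, G g & complexify g = block_mx 1%:M S 0 1%:M.

Definition two_pi_i : C := 0 +i* (2 * pi).

Definition contains_residue_translations (H : set C) (t : C -> C)
    (G : set 'M[R]_(2 + 2)) : Prop :=
  forall a r, H a ->
    (is_residue t a r -> contains_translation G (sym2 0 (two_pi_i * r) 0)) /\
    (is_residue (fun x => t x ^+ 2) a r ->
       contains_translation G (sym2 0 0 (two_pi_i * r))).

End Symplectic.

Section Curve.
Variables (R : realType) (H : set (Cx R)) (t : Cx R -> Cx R) (c1 c2 : Cx R).
Local Notation C := (Cx R).

Definition regular_part : set C := [set x | H x /\ holomorphic_at t x].

(* The integration paths for the two integrals are independent. *)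
Definition curve : set 'M[C]_2 :=
  [set T | exists x v2 v3,
    [/\ path_integral regular_part t c1 x v2,
        path_integral regular_part (fun y => t y ^+ 2) c2 x v3 &
        T = sym2 x (- v2) v3]].

(* A local single-valued determination of the matrix function, with values in
   the curve. *)
Definition branch (U : set C) (B : C -> 'M[C]_2) : Prop :=
  [/\ open U, U `<=` regular_part, (forall x, U x -> curve (B x)) &
      exists b2 b3 : C -> C, forall x, U x ->
        [/\ B x = sym2 x (b2 x) (b3 x), is_derive x (1 : C) b2 (- t x) &
            is_derive x (1 : C) b3 (t x ^+ 2)]].

(* The branches are the charts of the curve as a Riemann surface (in general
   not with the topology induced by 'M[C]_2). Only the values of f on the
   curve matter. *)
Definition meromorphic_on_curve (f : 'M[C]_2 -> C) : Prop :=
  forall U B, branch U B -> meromorphic_on U (fun x => f (B x)).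

Definition nonconstant_on_curve (f : 'M[C]_2 -> C) : Prop :=
  exists T1 T2, [/\ curve T1, curve T2 & f T1 != f T2].

(* phi parametrizes a piece of the curve holomorphically by the value of z;
   f \o phi is then f viewed as a function of z. *)
Definition parametrization_by (z : 'M[C]_2 -> C) (V : set C)
    (phi : C -> 'M[C]_2) : Prop :=
  open V /\
  exists U B (s : C -> C),
    [/\ branch U B, holomorphic_on V s, (forall u, V u -> U (s u)),
        (forall u, V u -> phi u = B (s u)) &
        forall u, V u -> z (phi u) = u].

(* The equation is monic; it is required where the coefficients and f are
   holomorphic in z. *)
Definition solves_ode_in (n : nat) (z : 'M[C]_2 -> C)
    (a : 'I_n -> 'M[C]_2 -> C) (f : 'M[C]_2 -> C) : Prop :=
  forall V phi, parametrization_by z V phi ->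
    (forall j, holomorphic_on V (fun u => a j (phi u))) ->
    holomorphic_on V (fun u => f (phi u)) ->
    forall u, V u ->
      derive1n n (fun v => f (phi v)) u
      + \sum_(j < n) a j (phi u) * derive1n j (fun v => f (phi v)) u = 0.

End Curve.

(* Main.v *)
(* On a branch of the curve let D = (1/z') d/dtau and let v be the vector of the
   five functions w, tau_1 w, tau_2 w, tau_3 w, (tau_1 tau_3 - tau_2^2) w. Away
   from isolated points v, D v, ..., D^(k-1) v are linearly independent and D^k v
   is a combination of them, for some k <= 5. By Cramer's rule the coefficients
   are meromorphic, so that differentiating the relation gives
   D^5 v = \sum_(j < k) b_j D^j v with meromorphic b_j, which are unique even if
   the five functions are linearly dependent. As D = d/dz, this is the equation.

   An element g of the group maps branches into the curve, hence to branches: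
   over a small disc path integrals from a given point are, up to countably many
   constants, equal to one primitive, so that a continuous map into the curve
   cannot leave a branch. The 2 x 2 minors of g (T, 1)^t are linear in 1, tau_1,
   tau_2, tau_3, det T, so g multiplies v by a constant matrix; it does not affect
   D because z is invariant. The uniqueness of the b_j yields their invariance.

   Holomorphic functions are treated as convergent power series, which makes
   Cauchy's theory dispensable: the germs of meromorphic functions form a
   differential field, and a nonzero germ has no zeros near, but off, its centre. *)

(* Two obstacles shape the proof. The relation between v, D v, D^2 v, ... breaks down at poles, at
   zeros of z' and where the rank drops, while a coefficient needs a value at every point of the
   curve. All identities are therefore established on punctured discs and reach the centre through
   [plim], which sees only the punctured germ. Invariance then holds at each point, poles included,
   because a locally invertible holomorphic map carries limits to limits and missing limits to
   missing limits. The other obstacle is that no topology is put on the curve: a point [T]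
   determines a germ of branch only because two branches through [T] agree nearby. This is the
   continuity argument of the overview with the identity in place of g, and it makes the
   coefficients, computed on an arbitrarily chosen branch, functions on the curve. As k may depend
   on the germ, [coef] extracts it from the values of the jet at the point itself; agreement with
   the germwise computation is proved off the centre. *)
Require Import Defs.
From mathcomp Require Import all_boot all_order all_algebra.
From mathcomp Require Import complex ring lra.
From mathcomp Require Import all_classical all_reals all_analysis.

Set Implicit Arguments.
Unset Strict Implicit.
Unset Printing Implicit Defensive.

Import Order.TTheory GRing.Theory Num.Theory numFieldNormedType.Exports.
Local Open Scope ring_scope.
Local Open Scope complex_scope.
Local Open Scope classical_set_scope.

(** * The complex modulus *)

Section ComplexModulus.
Variable R : realType.
Local Notation C := (Cx R).
Implicit Types (x y : C).

(** The norm of [C] takes values in [C], whose order is only partial; a real modulus gives access to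
    linear arithmetic and to limits in [R]. *)
Definition nm x : R := complex.Re `|x|.

Lemma nmE x : `|x| = (nm x)%:C :> C.
Proof. by rewrite /nm normc_def. Qed.

Lemma nm_ge0 x : 0 <= nm x.
Proof. by rewrite -lecR -nmE normr_ge0. Qed.

Lemma nm0 : nm 0 = 0. Proof. by rewrite /nm normr0. Qed.
Lemma nm1 : nm 1 = 1. Proof. by rewrite /nm normr1. Qed.

Lemma nm_eq0 x : (nm x == 0) = (x == 0).
Proof. by rewrite -(normr_eq0 x) nmE; apply/eqP/eqP => [->|/complexI]. Qed.

Lemma nm_gt0 x : (0 < nm x) = (x != 0).
Proof. by rewrite lt_neqAle nm_ge0 andbT eq_sym nm_eq0. Qed.

Lemma nmM x y : nm (x * y) = nm x * nm y.
Proof. by apply: (@complexI R); rewrite rmorphM /= -!nmE normrM. Qed.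

Lemma nmX x n : nm (x ^+ n) = nm x ^+ n.
Proof. by elim: n => [|n IH]; rewrite ?expr0 ?nm1 // !exprS nmM IH. Qed.

Lemma nmV x : nm x^-1 = (nm x)^-1.
Proof. by apply: (@complexI R); rewrite fmorphV /= -!nmE normfV. Qed.

Lemma nmN x : nm (- x) = nm x. Proof. by rewrite /nm normrN. Qed.

Lemma nmB x y : nm (x - y) = nm (y - x). Proof. by rewrite /nm distrC. Qed.

Lemma nmD x y : nm (x + y) <= nm x + nm y.
Proof. by rewrite -lecR rmorphD /= -!nmE ler_normD. Qed.

Lemma nmBD x y z : nm (x - y) <= nm (x - z) + nm (z - y).
Proof. by have := nmD (x - z) (z - y); rewrite addrA subrK. Qed.

Lemma nm_sum (I : Type) (r : seq I) (P : pred I) (F : I -> C) :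
  nm (\sum_(i <- r | P i) F i) <= \sum_(i <- r | P i) nm (F i).
Proof.
elim/big_rec2: _ => [|i y1 y2 _ IH]; first by rewrite nm0.
by apply: (le_trans (nmD _ _)); rewrite lerD2l.
Qed.

Lemma nmR (r : R) : nm (r%:C : C) = `|r|.
Proof.
rewrite /nm normc_def /= expr0n /= addr0 sqrtr_sqr.
by [].
Qed.

Lemma nm_nat (n : nat) : nm (n%:R : C) = n%:R.
Proof.
by rewrite -(rmorph_nat (real_complex R)) nmR normr_nat.
Qed.

Lemma nm_Re x : `|complex.Re x| <= nm x.
Proof. by rewrite -lecR -nmE normc_ge_Re. Qed.

Lemma nm_Im x : `|complex.Im x| <= nm x.
Proof. 
rewrite -lecR -nmE normc_def lecR -(sqrtr_sqr (complex.Im x)).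
by apply: ler_wsqrtr; rewrite lerDr sqr_ge0.
Qed.

Lemma nm_ReIm x : nm x <= `|complex.Re x| + `|complex.Im x|.
Proof.
rewrite {1}[x]complexE; apply: (le_trans (nmD _ _)).
rewrite nmM !nmR lerD2l -[leRHS]mul1r ler_wpM2r //.
by rewrite /nm normc_def /= expr0n /= add0r expr1n sqrtr1.
Qed.

Lemma Re_scale (r : R) x : complex.Re (r%:C * x) = r * complex.Re x.
Proof. by case: x => a b /=; rewrite mul0r subr0. Qed.

Lemma Im_scale (r : R) x : complex.Im (r%:C * x) = r * complex.Im x.
Proof. by case: x => a b /=; rewrite mul0r addr0. Qed.

Lemma ReB x y : complex.Re (x - y) = complex.Re x - complex.Re y.
Proof. exact: (raddfB (@complex.Re R)). Qed.

Lemma ImB x y : complex.Im (x - y) = complex.Im x - complex.Im y.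
Proof. exact: (raddfB (@complex.Im R)). Qed.

(** Radii of balls in [C] are elements of [C]; a positive one is real, so its real part serves as a
    radius. *)
Lemma nbhsCP (a : C) (P : C -> Prop) :
  (\forall x \near a, P x) <-> exists2 r : R, 0 < r & forall x, nm (x - a) < r -> P x.
Proof.
split=> [/nbhs_ballP[e /= e0 he]|[r r0 hr]].
  have eE : e = (complex.Re e)%:C by apply/esym/RRe_real; rewrite realE (ltW e0).
  exists (complex.Re e); first by rewrite -ltcR -eE.
  move=> x xe; apply: he; rewrite /ball /= distrC eE nmE.
  by rewrite ltcR.
apply/nbhs_ballP; exists (r%:C); first by rewrite /= ltcR.
by move=> x; rewrite /ball /= distrC nmE ltcR; apply: hr.
Qed.

Lemma dnbhsCP (a : C) (P : C -> Prop) :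
  (\forall x \near a^', P x) <->
  exists2 r : R, 0 < r & forall x, nm (x - a) < r -> x != a -> P x.
Proof. exact: (nbhsCP a (fun x => x != a -> P x)). Qed.

Lemma cvgCP (T : Type) (F : set_system T) (f : T -> C) (l : C) : Filter F ->
  (f @ F --> l) <-> ((fun i => nm (f i - l)) @ F --> (0 : R)).
Proof.
move=> FF; split=> [/cvgrPdist_lt h|/cvgrPdist_lt h]; apply/cvgrPdist_lt => e e0.
  have e0' : 0 < (e%:C : C) by rewrite ltcR.
  near=> x; rewrite sub0r normrN ger0_norm ?nm_ge0 //.
  by rewrite nmB -ltcR -nmE; near: x; exact: h.
have eE : e = (complex.Re e)%:C by apply/esym/RRe_real; rewrite realE (ltW e0).
have e0' : 0 < complex.Re e by rewrite -ltcR -eE.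
near=> x; rewrite distrC nmE eE ltcR.
have : `|0 - nm (f x - l)| < complex.Re e by near: x; exact: h.
by rewrite sub0r normrN ger0_norm ?nm_ge0.
Unshelve. all: by end_near. Qed.

Lemma cvg_seq_le (u : C^nat) (l : C) (v : R^nat) :
  (forall n, nm (u n - l) <= v n) -> v @ \oo --> (0 : R) -> u @ \oo --> l.
Proof.
move=> h hv; apply/cvgCP; apply: (squeeze_cvgr _ (cvg_cst _) hv).
by near=> n; rewrite nm_ge0 h.
Unshelve. all: by end_near. Qed.

Lemma cvg_nm (T : Type) (F : set_system T) (FF : Filter F) (f : T -> C) (l : C) :
  f @ F --> l -> (fun i => nm (f i)) @ F --> nm l.
Proof.
move=> /cvgCP/cvgrPdist_lt h; apply/cvgrPdist_lt => e e0; near=> x.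
apply: (@le_lt_trans _ _ (nm (f x - l))); last first.
  rewrite -[ltLHS]ger0_norm ?nm_ge0 // -normrN -sub0r; near: x; exact: h.
have := nmD (f x - l) l; have := nmD (l - f x) (f x).
rewrite !subrK nmB ler_norml => *; apply/andP; split; lra.
Unshelve. all: by end_near. Qed.

(* A complex series dominated by a geometric one converges, by completeness of
   R applied to the real and imaginary parts; R[i] has no library instance of a
   complete space. *)
Lemma cvg_geo_series (a : C^nat) (M q : R) :
  0 <= q -> q < 1 -> (forall k, nm (a k) <= M * q ^+ k) -> cvgn (series a).
Proof.
move=> q0 q1 ha.
have M0 : 0 <= M by apply: le_trans (nm_ge0 (a 0)) _; rewrite -[leRHS]mulr1 -(expr0 q).
have aux (p : C -> R) : (forall x, `|p x| <= nm x) -> cvgn (series (p \o a)).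
  move=> hp; apply: normed_cvg; apply: (@series_le_cvg _ _ (geometric M q)).
  - by move=> n /=.
  - by move=> n /=; rewrite mulr_ge0 ?exprn_ge0.
  - by move=> n /=; apply: le_trans (hp _) (ha n).
  - by apply: is_cvg_geometric_series; rewrite ger0_norm.
have [cr ci] := (aux (@complex.Re R) nm_Re, aux (@complex.Im R) nm_Im).
apply/cvg_ex; exists (limn (series (@complex.Re R \o a)) +i* limn (series (@complex.Im R \o a))).
apply: (@cvg_seq_le _ _ (fun n => `|series (@complex.Re R \o a) n - limn (series (@complex.Re R \o a))|
   + `|series (@complex.Im R \o a) n - limn (series (@complex.Im R \o a))|)).
  move=> n; apply: le_trans (nm_ReIm _) _.
  rewrite !raddfB /= /series /=.
  by rewrite !raddf_sum.
rewrite -[0 in X in _ --> X](addr0 0); apply: cvgD.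
  rewrite -[0 in X in _ --> X](normr0 R) -[0 in X in _ --> X](subrr (limn (series (@complex.Re R \o a)))).
  by apply: cvg_norm; apply: cvgB => //; exact: cvg_cst.
rewrite -[0 in X in _ --> X](normr0 R) -[0 in X in _ --> X](subrr (limn (series (@complex.Im R \o a)))).
by apply: cvg_norm; apply: cvgB => //; exact: cvg_cst.
Qed.

End ComplexModulus.

(** * Power series *)

Section PowerSeries.
Variable R : realType.
Local Notation C := (Cx R).
Implicit Types (c d : nat -> C) (x y : C).

Lemma eq_cvg_seq (u v : C^nat) (l : C) :
  (forall n, u n = v n) -> u @ \oo --> l -> v @ \oo --> l.
Proof. by move=> /funext ->. Qed.

Lemma cvg_seqD (u v : C^nat) (l m : C) : u @ \oo --> l -> v @ \oo --> m ->
  (fun n => u n + v n) @ \oo --> l + m.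
Proof. by move=> ul vm; exact: (cvgD ul vm). Qed.

Lemma cvg_seqZ (a : C) (u : C^nat) (l : C) : u @ \oo --> l ->
  (fun n => a * u n) @ \oo --> a * l.
Proof. by move=> ul; exact: (cvgM (cvg_cst a) ul). Qed.

Lemma cvg_seq_lim (u : C^nat) (l : C) : u @ \oo --> l -> limn u = l.
Proof. by move=> h; apply: cvg_lim. Qed.

Lemma lim_nm_le (u : C^nat) (l a : C) (e : R) (N : nat) :
  u @ \oo --> l -> (forall n, (N <= n)%N -> nm (u n - a) <= e) ->
  nm (l - a) <= e.
Proof.
move=> ul h; have ha : (fun n => nm (u n - a)) @ \oo --> nm (l - a).
  by apply: cvg_nm; exact: (cvgB ul (cvg_cst a)).
rewrite -(cvg_lim _ ha)//; apply: limr_le; first by apply/cvg_ex; exists (nm (l - a)).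
by exists N => // n /= Nn; apply: h.
Qed.

Lemma geo_partial_le (u : R) n m : 0 <= u -> u <= 2^-1 ->
  \sum_(n <= k < n + m) u ^+ k <= 2 * u ^+ n.
Proof.
move=> u0 u1; have un : 0 <= u ^+ n by rewrite exprn_ge0.
(* Subtracting the tail makes the induction work: its step reads u ^ (n + m) <= 2 u ^ (n + m) - 2 u
   ^ (n + m + 1), which is u <= 1/2. *)
suff h : \sum_(n <= k < n + m) u ^+ k <= 2 * u ^+ n - 2 * u ^+ (n + m).
  by apply: le_trans h _; rewrite gerBl mulr_ge0 // exprn_ge0.
elim: m => [|m IH]; first by rewrite addn0 big_geq // subrr.
rewrite addnS big_nat_recr ?leq_addr //=.
apply: (le_trans (lerD IH (lexx _))).
have := exprn_ge0 (n + m) u0; rewrite exprS => h.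
have : u * u ^+ (n + m) <= 2^-1 * u ^+ (n + m) by rewrite ler_wpM2r.
lra.
Qed.

Lemma geo_tail (a : C^nat) (K u : R) n : 0 <= u -> u <= 2^-1 ->
  (forall k, nm (a k) <= K * u ^+ k) ->
  nm (limn (series a) - series a n) <= 2 * K * u ^+ n.
Proof.
move=> u0 u1 h; have K0 : 0 <= K by apply: le_trans (nm_ge0 (a 0)) _; rewrite -[leRHS]mulr1 -(expr0 u).
have cva : series a @ \oo --> limn (series a).
  by apply: (@cvg_geo_series _ a K u) => //; lra.
apply: (@lim_nm_le _ _ _ _ n cva) => m nm_.
rewrite -(subnKC nm_) /series /= (big_cat_nat (n := n))//= ?leq_addr //.
rewrite addrAC subrr add0r; apply: le_trans (nm_sum _ _ _) _.
apply: (@le_trans _ _ (\sum_(n <= k < n + (m - n)) K * u ^+ k)).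
  by apply: ler_sum => k _; exact: h.
rewrite -mulr_sumr mulrAC [leRHS]mulrC ler_wpM2l //.
exact: geo_partial_le.
Qed.

Lemma geo_sum_norm (a : C^nat) (K u : R) : 0 <= u -> u <= 2^-1 ->
  (forall k, nm (a k) <= K * u ^+ k) -> nm (limn (series a)) <= 2 * K.
Proof.
move=> u0 u1 h; have := geo_tail 0 u0 u1 h.
by rewrite /series /= big_geq // subr0 expr0 mulr1.
Qed.

Lemma sum_triangle (V : nmodType) (F : nat -> nat -> V) n :
  \sum_(0 <= k < n) \sum_(i < k.+1) F i (k - i)%N =
  \sum_(i < n) \sum_(0 <= j < n - i) F i j.
Proof.
elim: n => [|n IH]; first by rewrite big_geq // big_ord0.
rewrite big_nat_recr //= IH !big_ord_recr /= subnn.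
rewrite subSnn big_nat1 addrA -big_split /=; congr (_ + _).
apply: eq_bigr => i _.
by rewrite subSn ?(ltnW (ltn_ord i)) // big_nat_recr.
Qed.

(** The factor n is absorbed by 2 ^ n, which leaves the ratio 1/2; this is where the bound 1/4 on
    the ratios of double series originates. *)
Lemma cvg_nat_geo (K u : R) : 0 <= u -> u <= 4^-1 ->
  (fun n => K * n%:R * u ^+ n) @ \oo --> (0 : R).
Proof.
move=> u0 u1.
have h : (geometric `|K| (2^-1 : R)) @ \oo --> (0 : R).
  by apply: cvg_geometric; rewrite ger0_norm ?invf_lt1 //; lra.
apply/cvgr0Pnorm_le => e e0.
near=> n; have H : `|geometric `|K| 2^-1 n| <= e by near: n; exact: cvgr0_norm_le.
apply: (le_trans _ H).
rewrite /geometric /= !normrM normr_id -mulrA ler_wpM2l //.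
rewrite normr_nat [`|u ^+ n|]ger0_norm ?exprn_ge0 // ger0_norm ?exprn_ge0 ?invr_ge0 //.
apply: (@le_trans _ _ (2 ^+ n * (4^-1) ^+ n)).
  apply: ler_pM => //; rewrite ?exprn_ge0 //.
    by rewrite -natrX ler_nat ltnW // ltn_expl.
  by apply: lerXn2r; rewrite ?nnegrE //; lra.
by rewrite -exprMn lerXn2r // ?nnegrE; lra.
Unshelve. all: by end_near. Qed.

(** Rearrangement from diagonals to rows. Products and changes of centre of power series are both
    instances of it. *)
Lemma double_series (G : nat -> nat -> C) (K u : R) : 0 <= u -> u <= 4^-1 ->
  (forall i j, nm (G i j) <= K * u ^+ (i + j)) ->
  let rows := fun i => limn (series (G i)) in
  (series (fun k => \sum_(i < k.+1) G i (k - i)%N) @ \oo --> limn (series rows))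
  /\ series rows @ \oo --> limn (series rows).
Proof.
move=> u0 u1 hG rows.
have u2 : u <= 2^-1 by lra.
have hrow i k : nm (G i k) <= (K * u ^+ i) * u ^+ k by rewrite -mulrA -exprD.
have hrows i : nm (rows i) <= (2 * K) * u ^+ i.
  by apply: le_trans (geo_sum_norm u0 u2 (hrow i)) _; rewrite mulrA.
have crows : series rows @ \oo --> limn (series rows).
  by apply: (@cvg_geo_series _ rows (2 * K) u u0 _ hrows); lra.
split=> //.
set D := series _.
(* The n-th partial sums differ by the tails of the rows i < n from the index n - i on. Each tail is
   at most 2 K u ^ n, and there are n of them. *)
have cdiff : (fun n => D n - series rows n) @ \oo --> (0 : C).
  apply: (@cvg_seq_le _ _ _ (fun n => (2 * K) * n%:R * u ^+ n)); last exact: cvg_nat_geo.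
  move=> n; rewrite subr0 /D /series /= sum_triangle big_mkord -sumrB.
  apply: le_trans (nm_sum _ _ _) _.
  apply: (@le_trans _ _ (\sum_(i < n) 2 * K * u ^+ n)); last first.
    by rewrite sumr_const card_ord -[_ *+ n]mulr_natr mulrAC.
  apply: ler_sum => i _; rewrite nmB.
  apply: le_trans (geo_tail _ u0 u2 (hrow i)) _.
  by rewrite mulrA -mulrA -exprD subnKC ?(ltnW (ltn_ord i)).
have := cvg_seqD cdiff crows; rewrite add0r.
by move=> h; apply: eq_cvg_seq h => n /=; rewrite subrK.
Qed.

(** A radius of convergence of at least 1/q, in a quantitative form whose constants can be followed
    through every operation on series. *)
Definition geo c (M q : R) := 0 < q /\ forall k, nm (c k) <= M * q ^+ k.

Definition ps c x : C := limn (series (fun k => c k * x ^+ k)).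

Lemma geo_M c M q : geo c M q -> 0 <= M.
Proof. by case=> _ /(_ 0)/(le_trans (nm_ge0 _)); rewrite expr0 mulr1. Qed.

Lemma geo_le c M q M' q' : geo c M q -> M <= M' -> q <= q' -> geo c M' q'.
Proof.
move=> h MM qq; case: (h) => q0 hc; split; first exact: lt_le_trans qq.
move=> k; apply: le_trans (hc k) _; apply: ler_pM => //.
- exact: geo_M h.
- by rewrite exprn_ge0 // ltW.
- by apply: lerXn2r; rewrite ?nnegrE // ltW // (lt_le_trans q0).
Qed.

Lemma geo_term c M q x : geo c M q ->
  forall k, nm (c k * x ^+ k) <= M * (q * nm x) ^+ k.
Proof.
case=> q0 h k; rewrite nmM nmX exprMn mulrA ler_wpM2r ?exprn_ge0 ?nm_ge0 //.
Qed.

Lemma ps_cvg c M q x : geo c M q -> q * nm x < 1 ->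
  series (fun k => c k * x ^+ k) @ \oo --> ps c x.
Proof.
move=> h hx; apply: (@cvg_geo_series _ _ M (q * nm x)) => //; last exact: geo_term.
by case: h => q0 _; rewrite mulr_ge0 ?nm_ge0 // ltW.
Qed.

Lemma ps_tail c M q x n : geo c M q -> q * nm x <= 2^-1 ->
  nm (ps c x - \sum_(0 <= k < n) c k * x ^+ k) <= 2 * M * (q * nm x) ^+ n.
Proof.
move=> h hx; apply: geo_tail => //; last exact: geo_term.
by case: h => q0 _; rewrite mulr_ge0 ?nm_ge0 // ltW.
Qed.

Lemma ps_eq c x l : series (fun k => c k * x ^+ k) @ \oo --> l -> ps c x = l.
Proof. by move=> h; apply: cvg_lim. Qed.

Lemma ps0 c : ps c 0 = c 0.
Proof.
apply: ps_eq; apply: (cvg_near_cst); exists 1%N => // -[//|n] _.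
rewrite /series /= big_nat_recl //= expr0 mulr1 big1 ?addr0 // => i _.
by rewrite exprS mul0r mulr0.
Qed.

(** * Cauchy products and changes of centre *)

Definition cauchy_prod c d k : C := \sum_(i < k.+1) c i * d (k - i)%N.

(** The k + 1 summands of a coefficient are paid for by k < 2 ^ k, hence the doubled ratio. *)
Lemma geo_cauchy_prod c d M N q : geo c M q -> geo d N q ->
  geo (cauchy_prod c d) (M * N) (2 * q).
Proof.
move=> hc hd; have [[q0 c1] [_ d1]] := (hc, hd); split; first by rewrite mulr_gt0.
move=> k; apply: le_trans (nm_sum _ _ _) _.
apply: (@le_trans _ _ (\sum_(i < k.+1) M * N * q ^+ k)).
  apply: ler_sum => i _; rewrite nmM.
  have -> : q ^+ k = q ^+ i * q ^+ (k - i) by rewrite -exprD subnKC // -ltnS.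
  by rewrite mulrACA; apply: ler_pM; rewrite ?nm_ge0.
rewrite sumr_const card_ord -[_ *+ k.+1]mulr_natr -mulrA ler_wpM2l //.
  by rewrite mulr_ge0 ?(geo_M hc) ?(geo_M hd).
rewrite exprMn mulrC ler_wpM2r ?exprn_ge0 ?(ltW q0) //.
by rewrite -natrX ler_nat ltn_expl.
Qed.

Lemma ps_cauchy_prod c d M N q x : geo c M q -> geo d N q -> q * nm x <= 4^-1 ->
  ps (cauchy_prod c d) x = ps c x * ps d x.
Proof.
move=> hc hd hx; have q0 : 0 <= q by case: hc => /ltW.
have u0 : 0 <= q * nm x by rewrite mulr_ge0 ?nm_ge0.
pose G i j := (c i * x ^+ i) * (d j * x ^+ j).
have hG i j : nm (G i j) <= (M * N) * (q * nm x) ^+ (i + j).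
  rewrite /G nmM exprD [leRHS]mulrACA; apply: ler_pM; rewrite ?nm_ge0 //.
    exact: geo_term.
  exact: geo_term.
have [diag rows] := double_series u0 hx hG.
have cd := ps_cvg hd (le_lt_trans hx _).
have cc := ps_cvg hc (le_lt_trans hx _).
have lt1 : 4^-1 < 1 :> R by lra.
have rowE i : limn (series (G i)) = c i * x ^+ i * ps d x.
  apply: cvg_seq_lim; have := cvg_seqZ (a := c i * x ^+ i) (cd lt1).
  move=> h'; apply: (eq_cvg_seq _ h') => n.
  by rewrite /series /= mulr_sumr.
have rowsE : limn (series (fun i => limn (series (G i)))) = ps d x * ps c x.
  apply: cvg_seq_lim; have := cvg_seqZ (a := ps d x) (cc lt1).
  move=> h'; apply: (eq_cvg_seq _ h') => n.
  by rewrite /series /= mulr_sumr; apply: eq_bigr => i _; rewrite rowE mulrC.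
rewrite [RHS]mulrC -rowsE; apply: ps_eq; apply: eq_cvg_seq diag => n; rewrite /series /=; apply: eq_bigr => k _.
rewrite /cauchy_prod mulr_suml; apply: eq_bigr => i _; rewrite /G mulrACA -exprD subnKC //.
by rewrite -ltnS.
Qed.

(** The Taylor coefficients at [x] of the sum of the series, that is, the derivatives of order j
    divided by j!, read off from the binomial expansion of (x + y) ^ n. *)
Definition recenter c x j : C := ps (fun k => 'C(k + j, j)%:R * c (k + j)%N) x.

Lemma bin_le_exp2 n m : ('C(n, m) <= 2 ^ n)%N.
Proof.
case: (leqP m n) => [mn|nm_]; last by rewrite bin_small.
rewrite -[2%N]/(1 + 1)%N expnDn (bigD1 (Ordinal (mn : (m < n.+1)%N)))//=.
by rewrite !exp1n !muln1 leq_addr.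
Qed.

Lemma geo_shift_bin c M q j : geo c M q ->
  geo (fun k => 'C(k + j, j)%:R * c (k + j)%N) (M * (2 * q) ^+ j) (2 * q).
Proof.
case=> q0 h; split; first by rewrite mulr_gt0.
move=> k; rewrite nmM nm_nat -mulrA -exprD [(j + k)%N]addnC exprMn mulrCA.
apply: ler_pM; rewrite ?nm_ge0 //.
by rewrite -natrX ler_nat bin_le_exp2.
Qed.

Lemma geo_recenter c M q x : geo c M q -> 2 * q * nm x <= 2^-1 ->
  geo (recenter c x) (2 * M) (2 * q).
Proof.
move=> h hx; have q0 : 0 < 2 * q by case: h => *; rewrite mulr_gt0.
split=> // j; rewrite -mulrA.
apply: (@geo_sum_norm _ _ (2 * q * nm x)) => //.
  by rewrite mulr_ge0 ?nm_ge0 // ltW.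
by move=> k; exact: (geo_term x (geo_shift_bin j h)).
Qed.

(** In the double series [G] the rows collect the powers of [y], while the diagonals are the
    binomial expansions of c n (x + y) ^ n. *)
Lemma ps_recenter c M q x y : geo c M q ->
  2 * q * nm x <= 4^-1 -> 2 * q * nm y <= 4^-1 ->
  ps (recenter c x) y = ps c (x + y).
Proof.
move=> h hx hy; have q0 : 0 < 2 * q by case: h => *; rewrite mulr_gt0.
(* A single ratio that dominates both 2 q |x| and 2 q |y|, the largest one that [double_series]
   admits. *)
pose u : R := 4^-1; have u0 : 0 <= u by rewrite invr_ge0.
have u4 : u <= 4^-1 by [].
pose G j k := 'C(k + j, j)%:R * c (k + j)%N * x ^+ k * y ^+ j.
have hG j k : nm (G j k) <= M * u ^+ (j + k).
  rewrite /G nmM.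
  apply: le_trans (ler_wpM2r (nm_ge0 _) (geo_term x (geo_shift_bin j h) k)) _.
  have -> : M * (2 * q) ^+ j * (2 * q * nm x) ^+ k * nm (y ^+ j) =
      M * ((2 * q * nm y) ^+ j * (2 * q * nm x) ^+ k).
    by rewrite nmX [(2 * q * nm y) ^+ j]exprMn; ring.
  rewrite exprD ler_wpM2l ?(geo_M h) //.
  have p0 w : 0 <= 2 * q * nm w by rewrite mulr_ge0 ?nm_ge0 // ltW.
  by apply: ler_pM; rewrite ?exprn_ge0 // lerXn2r // nnegrE.
have [diag rows] := double_series u0 u4 hG.
have rowE j : limn (series (G j)) = y ^+ j * recenter c x j.
  have cx : series (fun k => 'C(k + j, j)%:R * c (k + j)%N * x ^+ k) @ \oo --> recenter c x j.
    apply: ps_cvg; first exact: (geo_shift_bin j h).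
    lra.
  apply: cvg_seq_lim; have := cvg_seqZ (a := y ^+ j) cx.
  move=> h'; apply: (eq_cvg_seq _ h') => n.
  by rewrite /series /= mulr_sumr; apply: eq_bigr => k _; rewrite mulrC.
have -> : ps (recenter c x) y = limn (series (fun i => limn (series (G i)))).
  by rewrite /ps; congr (limn (series _)); apply/funext => j; rewrite rowE mulrC.
apply/esym; apply: ps_eq; apply: eq_cvg_seq diag => n; rewrite /series /=; apply: eq_bigr => k _.
rewrite exprDn mulr_sumr; apply: eq_bigr => i _; rewrite /G subnK -1?ltnS //.
by rewrite -mulr_natl; ring.
Qed.

Lemma recenter1 c x : recenter c x 1%N = ps (fun k => k.+1%:R * c k.+1) x.
Proof.
by rewrite /recenter; congr (ps _ x); apply/funext => k; rewrite addn1 bin1.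
Qed.

End PowerSeries.

(** * Holomorphic functions *)

Section Holomorphic.
Variable R : realType.
Local Notation C := (Cx R).
Implicit Types (f g : C -> C) (a b x y : C).

Lemma near_nm_small a (q e : R) : 0 < e -> \forall x \near a, q * nm (x - a) <= e.
Proof.
move=> e0; apply/nbhsCP; exists (e / (`|q| + 1)).
  by rewrite divr_gt0 // ltr_wpDl.
move=> x; rewrite ltr_pdivlMr ?ltr_wpDl // => h.
apply: le_trans (ltW h); rewrite mulrC ler_wpM2l ?nm_ge0 //.
by have := ler_norm q; lra.
Qed.

(** The first-order expansion holds trivially at [x = a], so that, unlike the difference quotient,
    it needs no punctured neighbourhood. The field is left general because the criterion serves for
    functions on [C] as well as for real components of curves. *)
Lemma is_derive_normP (K : numFieldType) (f : K -> K) (a l : K) :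
  is_derive a (1 : K) f l <-> forall e : K, 0 < e ->
  \forall x \near a, `|f x - f a - l * (x - a)| <= e * `|x - a|.
Proof.
have E : forall e : K, 0 < e ->
  (\forall x \near a, `|f x - f a - l * (x - a)| <= e * `|x - a|) <->
  (\forall h \near (0 : K)^', `|h^-1 *: (f (h *: 1 + a) - f a) - l| <= e).
  move=> e e0; split=> [|]/nbhs_ballP[r /= r0 hr].
    apply/nbhs_ballP; exists r => // h; rewrite /ball /= sub0r normrN => hh h0.
    have := hr (h + a); rewrite /ball /= opprD addrC subrK normrN addrK => /(_ hh).
    have -> : f (h + a) - f a - l * h = h * (h^-1 *: (f (h *: 1 + a) - f a) - l).
      by rewrite /GRing.scale /= mulr1; field.
    by rewrite normrM mulrC ler_pM2r // normr_gt0.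
  apply/nbhs_ballP; exists r => // x; rewrite /ball /= distrC => xa.
  have [->|xa0] := eqVneq x a.
    by rewrite !subrr mulr0 subr0 normr0 mulr0.
  have h0 : x - a != 0 by rewrite subr_eq0.
  have := hr (x - a); rewrite /ball /= sub0r normrN => /(_ xa h0).
  rewrite /GRing.scale /= mulr1 subrK => H.
  have -> : f x - f a - l * (x - a) = (x - a) * ((x - a)^-1 * (f x - f a) - l).
    by field.
  by rewrite normrM mulrC ler_wpM2r.
split=> [[df dl] e e0|h].
  have H : h^-1 *: (f (h *: 1 + a) - f a) @[h --> 0^'] --> l by rewrite -dl; exact: df.
  apply/E => //; near=> h; rewrite distrC; near: h.
  by move/cvgrPdist_le: H; apply.
have H : h^-1 *: (f (h *: 1 + a) - f a) @[h --> 0^'] --> l.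
  apply/cvgrPdist_le => e e0; have /E := h e e0 => /(_ e0) H.
  by near=> k; rewrite distrC; near: k.
apply: DeriveDef; first by apply/cvg_ex; exists l.
exact: cvg_lim H.
Unshelve. all: by end_near. Qed.

Lemma cderP f a l : is_derive a (1 : C) f l <->
  forall e : R, 0 < e -> \forall x \near a, nm (f x - f a - l * (x - a)) <= e * nm (x - a).
Proof.
split=> [/is_derive_normP h e e0|h].
  have e0' : 0 < (e%:C : C) by rewrite ltcR.
  by near=> x; rewrite -lecR rmorphM /= -!nmE; near: x; exact: h.
apply/is_derive_normP => e e0.
have eE : e = (complex.Re e)%:C by apply/esym/RRe_real; rewrite realE (ltW e0).
have e0' : 0 < complex.Re e by rewrite -ltcR -eE.
by near=> x; rewrite !nmE eE -rmorphM lecR; near: x; exact: h.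
Unshelve. all: by end_near. Qed.

Lemma cder_unique f a l l' : is_derive a (1 : C) f l -> is_derive a (1 : C) f l' -> l = l'.
Proof. by move=> [_ <-] [_ <-]. Qed.

Lemma cder1 f a l : is_derive a (1 : C) f l -> f^`() a = l.
Proof. by move=> [_ <-]; rewrite derive1E. Qed.

Lemma cder_derive1 f a : derivable f a (1 : C) -> is_derive a (1 : C) f (f^`() a).
Proof. by move=> h; rewrite derive1E; apply: DeriveDef. Qed.

Lemma cder_near f g a l : (\forall x \near a, f x = g x) ->
  is_derive a (1 : C) f l -> is_derive a (1 : C) g l.
Proof.
move=> fg /cderP h; apply/cderP => e e0; have ga := nbhs_singleton fg.
by near=> x; rewrite -ga -(near fg x) //; near: x; exact: h.
Unshelve. all: by end_near. Qed.

Lemma derive1_near f g a : (\forall x \near a, f x = g x) -> f^`() a = g^`() a.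
Proof.
move=> fg; rewrite !derive1E.
exact: near_eq_derive.
Qed.

Lemma cder_cont f a l : is_derive a (1 : C) f l -> f @ a --> f a.
Proof.
by move=> [h _]; apply: differentiable_continuous; apply/derivable1_diffP.
Qed.

Lemma cderD f g a l m : is_derive a (1 : C) f l -> is_derive a (1 : C) g m ->
  is_derive a (1 : C) (fun x => f x + g x) (l + m).
Proof. by move=> hf hg; exact: is_deriveD. Qed.

Lemma cderN f a l : is_derive a (1 : C) f l -> is_derive a (1 : C) (fun x => - f x) (- l).
Proof. by move=> hf; exact: is_deriveN. Qed.

Lemma cderB f g a l m : is_derive a (1 : C) f l -> is_derive a (1 : C) g m ->
  is_derive a (1 : C) (fun x => f x - g x) (l - m).
Proof. by move=> hf hg; exact: is_deriveB. Qed.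

Lemma cderM f g a l m : is_derive a (1 : C) f l -> is_derive a (1 : C) g m ->
  is_derive a (1 : C) (fun x => f x * g x) (f a * m + l * g a).
Proof.
move=> hf hg; have := is_deriveM hf hg.
by rewrite /GRing.scale /= [g a * l]mulrC.
Qed.

Lemma cder_cst (c : C) a : is_derive a (1 : C) (fun=> c) 0.
Proof. exact: is_derive_cst. Qed.

Lemma cder_id a : is_derive a (1 : C) (fun x => x) 1.
Proof. exact: is_derive_id. Qed.

Lemma cder_comp f g a l m : is_derive a (1 : C) g m -> is_derive (g a) (1 : C) f l ->
  is_derive a (1 : C) (fun x => f (g x)) (l * m).
Proof.
move=> hg hf; have gc := cder_cont hg.
move/cderP: hg => hg; move/cderP: hf => hf; apply/cderP => e e0.
(* The error is split into two halves. K bounds the growth of [g] near [a] and L bounds |l|; the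
   added 1 makes both positive, so that they can be divided by. *)
pose K := nm m + 1; have K0 : 0 < K by rewrite ltr_wpDl ?nm_ge0.
pose L := nm l + 1; have L0 : 0 < L by rewrite ltr_wpDl ?nm_ge0.
have e1 : 0 < e / 2 / K by rewrite !divr_gt0.
have e2 : 0 < e / 2 / L by rewrite !divr_gt0.
near=> x.
have h1 : nm (g x - g a - m * (x - a)) <= 1 * nm (x - a) by near: x; exact: hg.
have h2 : nm (g x - g a - m * (x - a)) <= e / 2 / L * nm (x - a) by near: x; exact: hg.
have h3 : nm (f (g x) - f (g a) - l * (g x - g a)) <= e / 2 / K * nm (g x - g a).
  by near: x; exact: (gc _ (hf _ e1)).
have h4 : nm (g x - g a) <= K * nm (x - a).
  have := nmD (g x - g a - m * (x - a)) (m * (x - a)); rewrite subrK nmM /K; lra.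
have -> : f (g x) - f (g a) - l * m * (x - a) =
  (f (g x) - f (g a) - l * (g x - g a)) + l * (g x - g a - m * (x - a)) by ring.
apply: le_trans (nmD _ _) _; rewrite nmM.
have h5 : e / 2 / K * nm (g x - g a) <= e / 2 * nm (x - a).
  rewrite -[leRHS]mulrA -[leLHS]mulrA -[leLHS]mulrA ler_pM2l // ler_pM2l ?invr_gt0 //.
  by rewrite mulrC ler_pdivrMr // mulrC.
have h6 : nm l * nm (g x - g a - m * (x - a)) <= e / 2 * nm (x - a).
  apply: (@le_trans _ _ (L * (e / 2 / L * nm (x - a)))).
    by apply: ler_pM; rewrite ?nm_ge0 // /L lerDl.
  by rewrite mulrA [L * _]mulrC divfK // gt_eqF.
lra.
Unshelve. all: by end_near. Qed.

Lemma cder_inv b : b != 0 -> is_derive b (1 : C) (fun x => x^-1) (- b ^- 2).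
Proof.
move=> b0; apply/cderP => e e0; have nb : 0 < nm b by rewrite nm_gt0.
near=> x.
(* Within |b| / 2 of [b] one has |x| >= |b| / 2, so the exact remainder (x - b)^2 / (x b^2) is at
   most 2 / |b|^3 times |x - b|^2. *)
have h1 : 1 * nm (x - b) <= nm b / 2 by near: x; apply: near_nm_small; rewrite divr_gt0.
have h2 : 2 / nm b ^+ 3 * nm (x - b) <= e by near: x; exact: near_nm_small.
have xb : nm b / 2 <= nm x.
  by have := nmBD b 0 x; rewrite !subr0 nmB; lra.
have x0 : x != 0 by rewrite -nm_gt0; lra.
have -> : x^-1 - b^-1 - - b ^- 2 * (x - b) = (x - b) ^+ 2 * (x^-1 * b ^- 2).
  by field; rewrite x0 b0.
have -> : nm ((x - b) ^+ 2 * (x^-1 * b ^- 2)) = nm (x - b) * ((nm x)^-1 / nm b ^+ 2) * nm (x - b).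
  by rewrite nmM nmX nmM !nmV nmX; ring.
rewrite ler_wpM2r ?nm_ge0 //.
apply: le_trans h2; rewrite mulrC ler_wpM2r ?nm_ge0 //.
have -> : 2 / nm b ^+ 3 = (nm b / 2)^-1 / nm b ^+ 2 by field; rewrite gt_eqF //.
by rewrite ler_wpM2r ?invr_ge0 ?exprn_ge0 ?nm_ge0 // lef_pV2 // posrE ?nm_gt0 // divr_gt0.
Unshelve. all: by end_near. Qed.

Lemma cderV f a l : f a != 0 -> is_derive a (1 : C) f l ->
  is_derive a (1 : C) (fun x => (f x)^-1) (- l / f a ^+ 2).
Proof.
move=> fa h; have := cder_comp h (cder_inv fa).
by rewrite mulNr mulNr [l / _]mulrC.
Qed.

Lemma cder_exp a n (c : C) : is_derive a (1 : C) (fun x => (x - c) ^+ n) (n%:R * (a - c) ^+ n.-1).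
Proof.
elim: n => [|n IH].
  by rewrite mul0r; exact: (cder_cst 1).
have h1 : is_derive a (1 : C) (fun x => x - c) 1.
  by have := cderD (cder_id a) (cder_cst (- c) a); rewrite addr0.
have := cderM h1 IH.
have -> : (a - c) * (n%:R * (a - c) ^+ n.-1) + 1 * (a - c) ^+ n = n.+1%:R * (a - c) ^+ n.+1.-1.
  case: n {IH} => [|n] /=; first by rewrite !mul0r mulr0 add0r !mul1r.
  by rewrite mulrCA -exprS -[n.+2%:R]natr1 mulrDl.
by under eq_fun do rewrite -exprS.
Qed.

(** Abel's argument: convergence at a single point at distance s from [a] bounds the terms c k s ^
    k, which gives the ratio 1/s. Here s is half the radius of the disc on which the series is known
    to converge. *)
Lemma hol_power_seriesP f a : holomorphic_at f a <->
  exists c M q, geo c M q /\ \forall x \near a, f x = ps c (x - a).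
Proof.
split=> [[c /nbhsCP[r r0 hr]]|[c [M [q [h fE]]]]]; last first.
  exists c; near=> x; rewrite (near fE x)//.
  apply: ps_cvg h _; apply: (@le_lt_trans _ _ 2^-1); last by lra.
  by near: x; apply: near_nm_small; lra.
pose s : R := r / 2; have s0 : 0 < s by rewrite divr_gt0.
have sr : nm (a + s%:C - a) < r.
  by rewrite addrAC subrr add0r nmR gtr0_norm //= /s; lra.
have cs := hr _ sr; have cv : cvgn (power_series c a (a + s%:C)).
  by apply/cvg_ex; exists (f (a + s%:C)).
have /cvgCP t0 := cvg_series_cvg_0 cv.
have /cvg_seq_bounded[B [_ hB]] : cvgn (fun n => nm (c n * (a + s%:C - a) ^+ n - 0)).
  by apply/cvg_ex; exists 0.
have {}hB n : nm (c n) * s ^+ n <= B + 1.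
  have := hB (B + 1); rewrite ltrDl ltr01 => /(_ isT n I) /=.
  rewrite subr0 ger0_norm ?nm_ge0 // nmM nmX addrAC subrr add0r nmR.
  by rewrite gtr0_norm.
exists c, (B + 1), s^-1; split.
  split; first by rewrite invr_gt0.
  by move=> k; rewrite exprVn ler_pdivlMr ?exprn_gt0.
apply/nbhsCP; exists r => // x xr; apply/esym; apply: cvg_seq_lim.
exact: hr.
Unshelve. all: by end_near. Qed.

Lemma ps_derive0 (c : nat -> C) M q : geo c M q -> is_derive (0 : C) (1 : C) (ps c) (c 1%N).
Proof.
move=> h; apply/cderP => e e0.
have M0 := geo_M h; have q0 : 0 < q by case: h.
near=> x.
have := ps_tail 2 h; move=> /(_ x); rewrite ps0 subr0.
rewrite !big_nat_recl // big_geq // expr0 expr1 mulr1 addr0.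
have -> : ps c x - (c 0%N + c 1%N * x) = ps c x - c 0%N - c 1%N * x by ring.
move=> H; apply: le_trans (H _) _.
  by rewrite -[x]subr0; near: x; apply: near_nm_small; lra.
have -> : 2 * M * (q * nm x) ^+ 2 = (2 * M * q ^+ 2 * nm x) * nm x by ring.
rewrite ler_wpM2r ?nm_ge0 //.
by rewrite -[x]subr0; near: x; apply: near_nm_small.
Unshelve. all: by end_near. Qed.

(** Termwise differentiation reduces to the centre of the series: after recentring at [x], the
    derivative is the coefficient of index 1, which is the differentiated series at [x]. *)
Lemma ps_cder (c : nat -> C) M q x : geo c M q -> 2 * q * nm x <= 4^-1 ->
  is_derive x (1 : C) (ps c) (ps (fun k => k.+1%:R * c k.+1) x).
Proof.
move=> h hx; have hx2 : 2 * q * nm x <= 2^-1 by lra.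
have d0 : is_derive (0 : C) (1 : C) (ps (recenter c x)) (ps (fun k => k.+1%:R * c k.+1) x).
  by rewrite -recenter1; exact: ps_derive0 (geo_recenter h hx2).
have d1 : is_derive x (1 : C) (fun y => y - x) 1.
  by have := cderD (cder_id x) (cder_cst (- x) x); rewrite addr0.
rewrite -(subrr x) in d0; have := cder_comp d1 d0; rewrite mulr1.
apply: cder_near; near=> y; rewrite (ps_recenter h hx).
  by rewrite [x + _]addrC subrK.
by near: y; apply: near_nm_small; lra.
Unshelve. all: by end_near. Qed.

Lemma hol_near_eq f g a : (\forall x \near a, f x = g x) ->
  holomorphic_at f a -> holomorphic_at g a.
Proof.
move=> fg [c h]; exists c; near=> x; rewrite -(near fg x)//.
by near: x.
Unshelve. all: by end_near. Qed.

Lemma hol_nbhs f a : holomorphic_at f a -> \forall x \near a, holomorphic_at f x.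
Proof.
move=> /hol_power_seriesP[c [M [q [h fE]]]].
near=> b; apply/hol_power_seriesP.
have hb : 2 * q * nm (b - a) <= 4^-1 by near: b; apply: near_nm_small; lra.
exists (recenter c (b - a)), (2 * M), (2 * q); split; first by apply: geo_recenter => //; lra.
have nE : \forall x \near b, f x = ps c (x - a) by near: b; exact: nbhs_interior.
near=> x.
have hx : 2 * q * nm (x - b) <= 4^-1 by near: x; apply: near_nm_small; lra.
rewrite (ps_recenter h hb hx).
have -> : b - a + (x - b) = x - a by ring.
by near: x; exact: nE.
Unshelve. all: by end_near. Qed.

Lemma hol_derivable f a : holomorphic_at f a -> derivable f a (1 : C).
Proof.
move=> /hol_power_seriesP[c [M [q [h fE]]]].
have [df _] : is_derive a (1 : C) f (c 1%N); last exact: df.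
have d1 : is_derive a (1 : C) (fun x => x - a) 1.
  by have := cderD (cder_id a) (cder_cst (- a) a); rewrite addr0.
have d0 := ps_derive0 h; rewrite -(subrr a) in d0.
have := cder_comp d1 d0; rewrite mulr1.
by apply: cder_near; near=> x; rewrite (near fE x).
Unshelve. all: by end_near. Qed.

Lemma hol_cder f a : holomorphic_at f a -> is_derive a (1 : C) f (f^`() a).
Proof. by move=> /hol_derivable; exact: cder_derive1. Qed.

Lemma hol_cont f a : holomorphic_at f a -> f @ a --> f a.
Proof. by move=> /hol_cder; exact: cder_cont. Qed.

Lemma geo_deriv (c : nat -> C) M q : geo c M q ->
  geo (fun k => k.+1%:R * c k.+1) (M * (2 * q) ^+ 1) (2 * q).
Proof.
move=> /(geo_shift_bin 1); congr (geo _ _ _).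
by apply/funext => k; rewrite addn1 bin1.
Qed.

Lemma hol_derive1 f a : holomorphic_at f a -> holomorphic_at f^`() a.
Proof.
move=> /hol_power_seriesP[c [M [q [h fE]]]]; apply/hol_power_seriesP.
exists (fun k => k.+1%:R * c k.+1), (M * (2 * q) ^+ 1), (2 * q).
split; first exact: geo_deriv.
near=> b.
have nE : \forall x \near b, f x = ps c (x - a) by near: b; exact: nbhs_interior.
have d1 : is_derive b (1 : C) (fun x => x - a) 1.
  by have := cderD (cder_id b) (cder_cst (- a) b); rewrite addr0.
have hb : 2 * q * nm (b - a) <= 4^-1 by near: b; apply: near_nm_small; lra.
have := cder_comp d1 (ps_cder h hb); rewrite mulr1 => d.
apply: cder1; move: d; by apply: cder_near; near=> x; rewrite (near nE x).
Unshelve. all: by end_near. Qed.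

Lemma hol_cst (k : C) a : holomorphic_at (fun=> k) a.
Proof.
apply/hol_power_seriesP; exists (fun n => if n is 0%N then k else 0), (nm k), 1.
split.
  split=> // -[|n]; first by rewrite expr0 mulr1.
  by rewrite nm0 mulr_ge0 ?nm_ge0 ?exprn_ge0.
near=> x; apply/esym; apply: ps_eq; apply: (cvg_near_cst); exists 1%N => // -[//|n] _.
rewrite /series /= big_nat_recl //= expr0 mulr1 big1 ?addr0 // => i _.
by rewrite mul0r.
Unshelve. all: by end_near. Qed.

(** Termwise integration. The division by k + 1 only improves the bounds, and the constant M / q
    makes up for the shift of the index. *)
Lemma hol_primitive f a : holomorphic_at f a ->
  exists2 F, holomorphic_at F a & \forall x \near a, is_derive x (1 : C) F (f x).
Proof.
move=> /hol_power_seriesP[c [M [q [h fE]]]].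
pose d (k : nat) : C := if k is j.+1 then c j / j.+1%:R else 0.
have q0 : 0 < q by case: h.
have hd : geo d (M / q) q.
  split=> // -[|k] /=; first by rewrite nm0 mulr1 divr_ge0 ?(geo_M h) ?ltW.
  rewrite nmM nmV nm_nat exprS mulrA divfK ?gt_eqF //.
  apply: le_trans (h.2 k); rewrite ler_pdivrMr ?ltr0n //.
  by rewrite ler_peMr ?nm_ge0 // ler1n.
exists (fun x => ps d (x - a)).
  by apply/hol_power_seriesP; exists d, (M / q), q; split=> //; near=> x.
near=> b.
have d1 : is_derive b (1 : C) (fun x => x - a) 1.
  by have := cderD (cder_id b) (cder_cst (- a) b); rewrite addr0.
have hb : 2 * q * nm (b - a) <= 4^-1 by near: b; apply: near_nm_small; lra.
have := cder_comp d1 (ps_cder hd hb); rewrite mulr1.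
have -> : (fun k => k.+1%:R * d k.+1) = c.
  by apply/funext => k /=; rewrite mulrC divfK // pnatr_eq0.
by have -> : ps c (b - a) = f b by rewrite (near fE b).
Unshelve. all: by end_near. Qed.

Lemma hol_id a : holomorphic_at (fun x => x) a.
Proof.
apply/hol_power_seriesP; exists (fun n => if n is 0%N then a else if n is 1%N then 1 else 0), (nm a + 1), 1.
split.
  split=> // -[|[|n]]; rewrite expr1n mulr1 ?nm1 ?nm0 ?lerDl ?lerDr ?addr_ge0 ?nm_ge0 //.
near=> x; apply/esym; apply: ps_eq; apply: (cvg_near_cst); exists 2%N => // -[//|[//|n]] _.
rewrite /series /= !big_nat_recl //= expr0 expr1 mulr1 mul1r big1 ?addr0.
  by rewrite addrC subrK.
by move=> i _; rewrite mul0r.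
Unshelve. all: by end_near. Qed.

Lemma holM f g a : holomorphic_at f a -> holomorphic_at g a ->
  holomorphic_at (fun x => f x * g x) a.
Proof.
move=> /hol_power_seriesP[c [M [q [h fE]]]] /hol_power_seriesP[d [N [q' [h' gE]]]].
apply/hol_power_seriesP.
have [Q hc hd] : exists2 Q, geo c M Q & geo d N Q.
  exists (Num.max q q').
    by apply: (geo_le h); rewrite // le_max lexx.
  by apply: (geo_le h'); rewrite // le_max lexx orbT.
exists (cauchy_prod c d), (M * N), (2 * Q); split; first exact: geo_cauchy_prod.
near=> x; rewrite (near fE x)// (near gE x)// (ps_cauchy_prod hc hd) //.
by near: x; apply: near_nm_small; lra.
Unshelve. all: by end_near. Qed.

Lemma holD f g a : holomorphic_at f a -> holomorphic_at g a ->
  holomorphic_at (fun x => f x + g x) a.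
Proof.
move=> /hol_power_seriesP[c [M [q [h fE]]]] /hol_power_seriesP[d [N [q' [h' gE]]]].
exists (fun k => c k + d k); near=> x; rewrite (near fE x)// (near gE x)//.
have cc : q * nm (x - a) < 1.
  by apply: (@le_lt_trans _ _ 2^-1); [near: x; apply: near_nm_small; lra|lra].
have cd : q' * nm (x - a) < 1.
  by apply: (@le_lt_trans _ _ 2^-1); [near: x; apply: near_nm_small; lra|lra].
apply: (eq_cvg_seq _ (cvg_seqD (ps_cvg h cc) (ps_cvg h' cd))) => n.
by rewrite /power_series /series /= -big_split; apply: eq_bigr => i _; rewrite mulrDl.
Unshelve. all: by end_near. Qed.

Lemma holN f a : holomorphic_at f a -> holomorphic_at (fun x => - f x) a.
Proof.
move=> /(holM (hol_cst (-1) a)); apply: hol_near_eq.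
by near=> x; rewrite mulN1r.
Unshelve. all: by end_near. Qed.

Lemma holB f g a : holomorphic_at f a -> holomorphic_at g a ->
  holomorphic_at (fun x => f x - g x) a.
Proof. by move=> hf /holN; exact: holD. Qed.

Lemma holX f a n : holomorphic_at f a -> holomorphic_at (fun x => f x ^+ n) a.
Proof.
move=> hf; elim: n => [|n IH]; first exact: hol_cst.
by have := holM hf IH; apply: hol_near_eq; near=> x; rewrite exprS.
Unshelve. all: by end_near. Qed.

(* The coefficients b of the inverse series satisfy cauchy_prod c b = 1; the recursion
   needs all previous values, hence the list. *)
Fixpoint inv_coefs (c : nat -> C) n : seq C :=
  if n is m.+1 then
    let s := inv_coefs c m in
    rcons s (if m is 0%N then (c 0%N)^-1 else - (c 0%N)^-1 * \sum_(i < m) c (m - i)%N * s`_i)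
  else [::].

Definition inv_coef c n : C := (inv_coefs c n.+1)`_n.

Lemma size_inv_coefs c n : size (inv_coefs c n) = n.
Proof. by elim: n => //= n IH; rewrite size_rcons IH. Qed.

Lemma nth_inv_coefs c n i : (i < n)%N -> (inv_coefs c n)`_i = inv_coef c i.
Proof.
elim: n => // n IH; rewrite ltnS leq_eqVlt => /orP[/eqP ->//|lin].
by rewrite /= nth_rcons size_inv_coefs lin IH.
Qed.

Lemma inv_coef0 c : inv_coef c 0 = (c 0%N)^-1. Proof. by []. Qed.

Lemma inv_coefS c n : inv_coef c n.+1 =
  - (c 0%N)^-1 * \sum_(i < n.+1) c (n.+1 - i)%N * inv_coef c i.
Proof.
rewrite /inv_coef -[inv_coefs c n.+2]/(rcons (inv_coefs c n.+1) _) nth_rcons size_inv_coefs ltnn eqxx.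
congr (_ * _); apply: eq_bigr => i _; congr (_ * _).
exact: (nth_inv_coefs c (ltn_ord i)).
Qed.

Lemma cauchy_prod_inv c k : c 0%N != 0 -> cauchy_prod (inv_coef c) c k = (k == 0%N)%:R.
Proof.
move=> c0; rewrite /cauchy_prod; case: k => [|k].
  by rewrite big_ord_recr big_ord0 /= add0r inv_coef0 mulVf.
rewrite big_ord_recr /= subnn inv_coefS mulrAC mulNr mulVf // mulN1r.
by apply/eqP; rewrite subr_eq0; apply/eqP; apply: eq_bigr => i _; rewrite mulrC.
Qed.

(** Put k = M / |c 0|, let b be the inverse series and T n the sum of q ^ (n - i) |b i| over i < n.
    The recursion gives |b (n + 1)| <= k T (n + 1), while T (n + 1) = q (T n + |b n|). Hence T (n +
    2) <= q (k + 1) T (n + 1), so T grows geometrically and b with it. *)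
Lemma geo_inv c M q : c 0%N != 0 -> geo c M q ->
  geo (inv_coef c) ((M / nm (c 0%N) + 1) * (nm (c 0%N))^-1) (q * (M / nm (c 0%N) + 1)).
Proof.
move=> c0 h; have q0 : 0 < q by case: h.
have n0 : 0 < nm (c 0%N) by rewrite nm_gt0.
pose k := M / nm (c 0%N); have k0 : 0 <= k by rewrite divr_ge0 ?(geo_M h) ?ltW.
rewrite -/k; pose T n := \sum_(i < n) q ^+ (n - i) * nm (inv_coef c i).
have bT n : nm (inv_coef c n.+1) <= k * T n.+1.
  rewrite inv_coefS nmM nmN nmV /k [M / _]mulrC -mulrA ler_pM2l ?invr_gt0 //.
  apply: le_trans (nm_sum _ _ _) _; rewrite mulr_sumr; apply: ler_sum => i _.
  by rewrite nmM mulrA ler_wpM2r ?nm_ge0 //; exact: h.2.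
have TS n : T n.+1 = q * (T n + nm (inv_coef c n)).
  rewrite /T big_ord_recr /= subSnn expr1 mulrDr mulr_sumr; congr (_ + _).
  apply: eq_bigr => i _; rewrite mulrA -exprS subSn //.
  exact: ltnW.
have T0 n : 0 <= T n by apply: sumr_ge0 => i _; rewrite mulr_ge0 ?nm_ge0 ?exprn_ge0 // ltW.
have TQ n : T n.+1 <= (nm (c 0%N))^-1 * (q * (k + 1)) ^+ n * q.
  elim: n => [|n IH]; first by rewrite TS /T big_ord0 add0r inv_coef0 nmV expr0 mulr1 mulrC.
  rewrite TS; apply: (@le_trans _ _ (q * ((k + 1) * T n.+1))).
    rewrite ler_pM2l // mulrDl mul1r addrC lerD2r; exact: bT.
  have Q0 : 0 <= q * (k + 1) by rewrite mulr_ge0 ?addr_ge0 // ltW.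
  have -> : q * ((k + 1) * T n.+1) = q * (k + 1) * T n.+1 by ring.
  have -> : (nm (c 0%N))^-1 * (q * (k + 1)) ^+ n.+1 * q =
     q * (k + 1) * ((nm (c 0%N))^-1 * (q * (k + 1)) ^+ n * q) by rewrite exprS; ring.
  exact: ler_wpM2l.
split; first by rewrite mulr_gt0 // ltr_wpDl.
case=> [|n].
  rewrite inv_coef0 nmV expr0 mulr1 ler_peMl ?invr_ge0 ?(ltW n0) //; lra.
apply: (le_trans (bT n)); apply: (le_trans (ler_wpM2l k0 (TQ n))).
have X0 : 0 <= (nm (c 0%N))^-1 * (q * (k + 1)) ^+ n * q.
  by rewrite mulr_ge0 ?mulr_ge0 ?invr_ge0 ?exprn_ge0 ?mulr_ge0 ?addr_ge0 // ltW.
have -> : (k + 1) / nm (c 0%N) * (q * (k + 1)) ^+ n.+1 =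
   ((k + 1) ^+ 2) * ((nm (c 0%N))^-1 * (q * (k + 1)) ^+ n * q) by rewrite exprS; ring.
apply: ler_wpM2r => //; have -> : (k + 1) ^+ 2 = k + (k ^+ 2 + k + 1) by ring.
by rewrite lerDl !addr_ge0 // sqr_ge0.
Qed.

Lemma holV f a : f a != 0 -> holomorphic_at f a -> holomorphic_at (fun x => (f x)^-1) a.
Proof.
move=> fa /hol_power_seriesP[c [M [q [h fE]]]]; apply/hol_power_seriesP.
have c0 : c 0%N != 0.
  by have := nbhs_singleton fE; rewrite subrr ps0 => <-.
have hi := geo_inv c0 h; set M' := (_ * _) in hi; set q' := _ * _ in hi.
exists (inv_coef c), M', q'; split => //.
have qq : q <= q'.
  have q0 : 0 < q by case: h.
  by rewrite /q' ler_pMr // lerDr divr_ge0 ?(geo_M h) ?nm_ge0.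
have hc := geo_le h (lexx M) qq.
near=> x; rewrite (near fE x)//.
have : ps (inv_coef c) (x - a) * ps c (x - a) = 1.
  rewrite -(ps_cauchy_prod hi hc); last by near: x; apply: near_nm_small; lra.
  apply: ps_eq; apply: cvg_near_cst; exists 1%N => // -[//|n] _.
  rewrite /series /= big_nat_recl // cauchy_prod_inv // mul1r big1 ?addr0 // => i _.
  by rewrite cauchy_prod_inv // mul0r.
move=> H; have n0 : ps c (x - a) != 0.
  by apply/eqP => E; move: H; rewrite E mulr0 => /eqP; rewrite eq_sym oner_eq0.
by apply: (mulIf n0); rewrite H mulVf.
Unshelve. all: by end_near. Qed.

Lemma ps_shift (c : nat -> C) M q m x : geo c M q -> q * nm x < 1 ->
  (forall k, (k < m)%N -> c k = 0) ->
  ps c x = x ^+ m * ps (fun k => c (m + k)%N) x.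
Proof.
move=> h hx c0; apply: ps_eq.
have h' : geo (fun k => c (m + k)%N) (M * q ^+ m) q.
  by split; [case: h|move=> k; rewrite -mulrA -exprD; exact: h.2].
have H := cvg_seqZ (a := x ^+ m) (ps_cvg h' hx).
rewrite -(cvg_shiftn m); apply: eq_cvg_seq H => n /=.
rewrite /series /= [(n + m)%N]addnC [RHS](@big_cat_nat _ _ _ m) //= ?leq_addr //.
rewrite [X in _ = X + _]big_nat [X in _ = X + _]big1 ?add0r; last first.
  by move=> i /= im; rewrite c0 // mul0r.
have -> : \sum_(m <= k < m + n) c k * x ^+ k = \sum_(0 <= k < n) c (m + k)%N * x ^+ (m + k).
  rewrite -{1}[m]add0n big_addn addKn; apply: eq_bigr => i _.
  by rewrite [(i + m)%N]addnC.
by rewrite mulr_sumr; apply: eq_bigr => i _; rewrite exprD mulrCA.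
Qed.

(** The index of the first nonzero coefficient is the order m. This is the source of the isolation
    of zeros, of the inversion of germs and of the order of poles. *)
Lemma hol_order f a : holomorphic_at f a ->
  (\forall x \near a, f x = 0) \/
  exists m g, [/\ holomorphic_at g a, g a != 0 &
                  \forall x \near a, f x = (x - a) ^+ m * g x].
Proof.
move=> /hol_power_seriesP[c [M [q [h fE]]]].
have [c0|/existsNP/cid] := pselect (forall k, c k = 0).
  left; near=> x; rewrite (near fE x)//; apply: ps_eq.
  rewrite (_ : series _ = cst 0); first exact: cvg_cst.
  by apply/funext => n; rewrite /series /= big1 // => i _; rewrite c0 mul0r.
move=> [k0 /eqP ck0]; right.
have ex : exists k, c k != 0 by exists k0.
pose m := ex_minn ex; have [cm mmin] : c m != 0 /\ forall k, (k < m)%N -> c k = 0.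
  rewrite /m; case: ex_minnP => j cj jmin; split => // k kj; apply/eqP/negPn/negP => ck.
  by have := jmin _ ck; rewrite leqNgt kj.
have h' : geo (fun k => c (m + k)%N) (M * q ^+ m) q.
  by split; [case: h|move=> k; rewrite -mulrA -exprD; exact: h.2].
exists m, (fun x => ps (fun k => c (m + k)%N) (x - a)); split.
- apply/hol_power_seriesP; exists (fun k => c (m + k)%N), (M * q ^+ m), q.
  by split => //; near=> x.
- by rewrite subrr ps0 addn0.
- near=> x; rewrite (near fE x)//; apply: (ps_shift h) => //.
  by apply: (@le_lt_trans _ _ 2^-1); [near: x; apply: near_nm_small; lra|lra].
Unshelve. all: by end_near. Qed.

End Holomorphic.

(** * Germs of meromorphic functions *)

Section MeromorphicGerms.
Variable R : realType.
Local Notation C := (Cx R).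
Implicit Types (f g : C -> C) (a b x y : C).

#[local] Opaque holomorphic_at.

Lemma near_dnbhs a (P : C -> Prop) : (\forall x \near a, P x) -> \forall x \near a^', P x.
Proof. by move=> /nbhsCP[r r0 h]; apply/dnbhsCP; exists r => // x xr _; exact: h. Qed.

Lemma near_neq a b : a != b -> \forall x \near a, x != b.
Proof.
move=> ab; apply/nbhsCP; exists (nm (a - b)); first by rewrite nm_gt0 subr_eq0.
by move=> x; apply: contraTneq => ->; rewrite nmB ltxx.
Qed.

Lemma dnbhs_neq a : \forall x \near a^', x != a.
Proof. by apply/dnbhsCP; exists 1. Qed.

(** A punctured disc is open, so an identity on it may be differentiated at each of its points. *)
Lemma dnbhs_interior a (P : C -> Prop) :
  (\forall x \near a^', P x) -> \forall x \near a^', \forall y \near x, P y.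
Proof.
move=> /(@nbhs_interior _ a) h; near=> x.
have xa : x != a by near: x; exact: dnbhs_neq.
have hx : \forall y \near x, y != a -> P y by near: x; exact: near_dnbhs.
near=> y; have ya : y != a by near: y; exact: near_neq.
by move: ya; near: y.
Unshelve. all: by end_near. Qed.

(** Meromorphy of the punctured germ: the value at [a] is ignored and the fraction need not be
    reduced. The class [meromorphic_at] is not closed under sums, because it prescribes the value:
    1/x and 1 - 1/x are both encoded by 0 at the origin, and their encodings add up to 0 there
    instead of 1. *)
Definition pmero f a := exists (N : nat) (g : C -> C), holomorphic_at g a /\
  \forall x \near a^', f x = g x / (x - a) ^+ N.

Lemma pmero_eq f g a : (\forall x \near a^', f x = g x) -> pmero f a -> pmero g a.
Proof.
move=> fg [N [h [hh fh]]]; exists N, h; split=> //.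
by near=> x; rewrite -(near fg x)// (near fh x).
Unshelve. all: by end_near. Qed.

Lemma hol_pmero f a : holomorphic_at f a -> pmero f a.
Proof. by move=> h; exists 0%N, f; split=> //; near=> x; rewrite divr1. Unshelve. all: by end_near. Qed.

Lemma meromorphic_pmero f a : meromorphic_at f a -> pmero f a.
Proof.
case=> [|[m [g [hg _ fg]]]]; first exact: hol_pmero.
by exists m.+1, g; split=> //; exact: near_dnbhs.
Qed.

Lemma pmero_cst (c : C) a : pmero (fun=> c) a.
Proof. exact/hol_pmero/hol_cst. Qed.

Lemma hol_shift_exp a b n : holomorphic_at (fun x => (x - b) ^+ n) a.
Proof. by apply: holX; apply: holB; [exact: hol_id|exact: hol_cst]. Qed.

Lemma subr_exp_neq0 a x n : x != a -> (x - a) ^+ n != 0.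
Proof. by move=> xa; rewrite expf_neq0 // subr_eq0. Qed.

Lemma pmeroD f g a : pmero f a -> pmero g a -> pmero (fun x => f x + g x) a.
Proof.
move=> [N [F [hF fF]]] [M [G [hG gG]]].
exists (N + M)%N, (fun x => F x * (x - a) ^+ M + G x * (x - a) ^+ N); split.
  by apply: holD; apply: holM; [exact: hF|exact: hol_shift_exp|exact: hG|exact: hol_shift_exp].
near=> x; rewrite (near fF x)// (near gG x)// exprD.
have xa : x != a by near: x; exact: dnbhs_neq.
have [h1 h2] := (subr_exp_neq0 N xa, subr_exp_neq0 M xa).
set u := (x - a) ^+ N in h1 *; set v := (x - a) ^+ M in h2 *.
by field; rewrite h1 h2.
Unshelve. all: by end_near. Qed.

Lemma pmeroM f g a : pmero f a -> pmero g a -> pmero (fun x => f x * g x) a.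
Proof.
move=> [N [F [hF fF]]] [M [G [hG gG]]].
exists (N + M)%N, (fun x => F x * G x); split; first exact: holM.
near=> x; rewrite (near fF x)// (near gG x)// exprD.
have xa : x != a by near: x; exact: dnbhs_neq.
have [h1 h2] := (subr_exp_neq0 N xa, subr_exp_neq0 M xa).
set u := (x - a) ^+ N in h1 *; set v := (x - a) ^+ M in h2 *.
by field; rewrite h1 h2.
Unshelve. all: by end_near. Qed.

Lemma pmeroN f a : pmero f a -> pmero (fun x => - f x) a.
Proof.
move=> /(pmeroM (pmero_cst (-1) a)); apply: pmero_eq.
by near=> x; rewrite mulN1r.
Unshelve. all: by end_near. Qed.

Lemma pmero_sum (I : Type) (r : seq I) (P : pred I) (F : I -> C -> C) a :
  (forall i, P i -> pmero (F i) a) -> pmero (fun x => \sum_(i <- r | P i) F i x) a.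
Proof.
move=> h; elim: r => [|i r IH].
  by apply: pmero_eq (pmero_cst 0 a); near=> x; rewrite big_nil.
case Pi : (P i).
  by apply: pmero_eq (pmeroD (h i Pi) IH); near=> x; rewrite big_cons Pi.
by apply: pmero_eq IH; near=> x; rewrite big_cons Pi.
Unshelve. all: by end_near. Qed.

Lemma pmero_prod (I : Type) (r : seq I) (P : pred I) (F : I -> C -> C) a :
  (forall i, P i -> pmero (F i) a) -> pmero (fun x => \prod_(i <- r | P i) F i x) a.
Proof.
move=> h; elim: r => [|i r IH].
  by apply: pmero_eq (pmero_cst 1 a); near=> x; rewrite big_nil.
case Pi : (P i).
  by apply: pmero_eq (pmeroM (h i Pi) IH); near=> x; rewrite big_cons Pi.
by apply: pmero_eq IH; near=> x; rewrite big_cons Pi.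
Unshelve. all: by end_near. Qed.

Lemma pmero_unit f a : pmero f a -> (\forall x \near a^', f x = 0) \/
  exists (m N : nat) (h : C -> C), [/\ holomorphic_at h a, h a != 0,
     \forall x \near a, h x != 0 &
     \forall x \near a^', f x = (x - a) ^+ m * h x / (x - a) ^+ N].
Proof.
move=> [N [g [hg fg]]]; case: (hol_order hg) => [g0|[m [h [hh h0 gh]]]].
  left; have {}g0 := near_dnbhs g0.
  by near=> x; rewrite (near fg x)// (near g0 x)// mul0r.
right; exists m, N, h; split=> //.
  exact: (hol_cont hh (near_neq h0)).
have {}gh := near_dnbhs gh.
by near=> x; rewrite (near fg x)// (near gh x).
Unshelve. all: by end_near. Qed.

(** A germ is zero or invertible. Applied to minors, this makes the rank constant on a punctured
    disc. *)
Lemma pmero_dichotomy f a : pmero f a ->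
  (\forall x \near a^', f x = 0) \/ (\forall x \near a^', f x != 0).
Proof.
move=> /pmero_unit[|[m [N [h [hh _ h0 fh]]]]]; [by left|right].
have {}h0 := near_dnbhs h0; near=> x; rewrite (near fh x)//.
have xa : x != a by near: x; exact: dnbhs_neq.
by rewrite !mulf_neq0 ?invr_neq0 ?subr_exp_neq0 // (near h0 x).
Unshelve. all: by end_near. Qed.

Lemma pmeroV f a : pmero f a -> pmero (fun x => (f x)^-1) a.
Proof.
move=> /pmero_unit[f0|[m [N [h [hh ha h0 fh]]]]].
  by apply: pmero_eq (pmero_cst 0 a); near=> x; rewrite (near f0 x)// invr0.
exists m, (fun x => (x - a) ^+ N * (h x)^-1); split.
  by apply: holM; [exact: hol_shift_exp|exact: holV].
by near=> x; rewrite (near fh x)// !invfM invrK; ring.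
Unshelve. all: by end_near. Qed.

Lemma pmero_hol_near f a : pmero f a -> \forall x \near a^', holomorphic_at f x.
Proof.
move=> [N [g [hg fg]]]; have hn := near_dnbhs (hol_nbhs hg); have fn := dnbhs_interior fg.
near=> x; have xa : x != a by near: x; exact: dnbhs_neq.
have hx : holomorphic_at (fun y => g y / (y - a) ^+ N) x.
  apply: holM; first by near: x.
  by apply: holV; [exact: subr_exp_neq0|exact: hol_shift_exp].
apply: hol_near_eq hx; have nx : \forall y \near x, f y = g y / (y - a) ^+ N by near: x.
by near=> y; rewrite (near nx y).
Unshelve. all: by end_near. Qed.

Lemma derive1_dnear f g a : (\forall x \near a^', f x = g x) ->
  \forall x \near a^', f^`() x = g^`() x.
Proof.
by move=> /dnbhs_interior; apply: filterS => x; exact: derive1_near.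
Qed.

Lemma pmero_derive1 f a : pmero f a -> pmero f^`() a.
Proof.
move=> [N [g [hg fg]]]; have hn := near_dnbhs (hol_nbhs hg).
refine (@pmero_eq (fun x => g x * (- (N%:R * (x - a) ^+ N.-1) / ((x - a) ^+ N) ^+ 2) +
    derive1 g x * ((x - a) ^+ N)^-1) (derive1 f) a _ _).
  have fd := derive1_dnear fg; near=> x; rewrite (near fd x)//.
  have xa : x != a by near: x; exact: dnbhs_neq.
  apply/esym; apply: cder1; apply: cderM; first by apply: hol_cder; near: x.
  by apply: cderV; [exact: subr_exp_neq0|exact: cder_exp].
have hX n : pmero (fun x => (x - a) ^+ n) a by exact/hol_pmero/hol_shift_exp.
apply: pmeroD; apply: pmeroM.
- exact: hol_pmero.
- apply: pmeroM; first by apply: pmeroN; apply: pmeroM => //; exact: pmero_cst.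
  by apply: pmeroV; apply: (@pmero_eq (fun x => (x - a) ^+ N * (x - a) ^+ N)); [near=> x|exact: pmeroM].
- exact/hol_pmero/hol_derive1.
- exact: pmeroV.
Unshelve. all: by end_near. Qed.

Lemma pmero_normal f a : pmero f a -> exists (N : nat) (g : C -> C),
  [/\ holomorphic_at g a, N = 0%N \/ g a != 0 &
      \forall x \near a^', f x = g x / (x - a) ^+ N].
Proof.
move=> /pmero_unit[f0|[m [N [h [hh ha h0 fh]]]]].
  exists 0%N, (fun=> 0); split; [exact: hol_cst|by left|].
  by near=> x; rewrite (near f0 x)// mul0r.
case: (leqP N m) => Nm.
  exists 0%N, (fun x => (x - a) ^+ (m - N) * h x); split; [|by left|].
    by apply: holM; [exact: hol_shift_exp|exact: hh].
  near=> x; rewrite (near fh x)//; have xa : x != a by near: x; exact: dnbhs_neq.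
  rewrite -{1}(subnK Nm) exprD expr0; have h2 := subr_exp_neq0 N xa.
  set u := (x - a) ^+ (m - N); set v := (x - a) ^+ N in h2 *.
  by field.
exists (N - m)%N, h; split; [by []|by right|].
near=> x; rewrite (near fh x)//; have xa : x != a by near: x; exact: dnbhs_neq.
rewrite -{1}(subnK (ltnW Nm)) exprD.
have [h1 h2] := (subr_exp_neq0 (N - m) xa, subr_exp_neq0 m xa).
set u := (x - a) ^+ (N - m) in h1 *; set v := (x - a) ^+ m in h2 *.
by field; rewrite h1 h2.
Unshelve. all: by end_near. Qed.

(* The value at a of the meromorphic function with germ f, with the convention
   of pole_at: 0 at a pole. *)
Definition plim f a : C := if `[< cvg (f @ a^') >] then lim (f @ a^') else 0.

Lemma near_dnbhs_sym f g a : (\forall x \near a^', f x = g x) ->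
  \forall x \near a^', g x = f x.
Proof. by move=> fg; near=> x; rewrite (near fg x). Unshelve. all: by end_near. Qed.

Lemma plim_cvg f a l : f @ a^' --> l -> plim f a = l.
Proof.
move=> h; rewrite /plim asboolT; first exact: cvg_lim h.
by apply/cvg_ex; exists l.
Qed.

Lemma dnear_cvg f g a (l : C) : (\forall x \near a^', f x = g x) -> f @ a^' --> l -> g @ a^' --> l.
Proof. by move=> fg; apply: cvg_trans; apply: near_eq_cvg. Qed.

Lemma plim_eq f g a : (\forall x \near a^', f x = g x) -> plim f a = plim g a.
Proof.
move=> fg; have gf := near_dnbhs_sym fg; rewrite [RHS]/plim; case: asboolP => [/cvg_ex[l gl]|ncv].
  by rewrite (plim_cvg (dnear_cvg gf gl)); apply/esym; exact: cvg_lim gl.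
rewrite /plim; case: asboolP => [/cvg_ex[l fl]|_]; last reflexivity.
exfalso; apply: ncv.
by apply/cvg_ex; exists l; exact: dnear_cvg fg fl.
Qed.

Lemma cvg_dnbhs f a (l : C) : f @ a --> l -> f @ a^' --> l.
Proof. by move=> h P /h; exact: near_dnbhs. Qed.

Lemma plim_hol f a : holomorphic_at f a -> plim f a = f a.
Proof. by move=> /hol_cont h; apply: plim_cvg; exact: cvg_dnbhs. Qed.

Lemma pmero_plim f a : pmero f a -> \forall x \near a^', plim f x = f x.
Proof. by move=> /pmero_hol_near; apply: filterS => x; exact: plim_hol. Qed.

(** Filling in the centre by [plim] turns a punctured germ into a function that is meromorphic with
    the values that [pole_at] prescribes. *)
Lemma meromorphic_plim f a : pmero f a -> meromorphic_at (plim f) a.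
Proof.
move=> hf; have pf := pmero_plim hf.
have [[|N] [g [hg gN fg]]] := pmero_normal hf.
  left; apply: (@hol_near_eq _ g) => //.
  have ga : plim f a = g a.
    rewrite -(plim_hol hg); apply: plim_eq.
    by near=> x; rewrite (near fg x)// divr1.
  have : \forall x \near a^', g x = plim f x.
    by near=> x; rewrite (near pf x)// (near fg x)// divr1.
  move=> /dnbhsCP[r r0 h]; apply/nbhsCP; exists r => // x xr.
  by have [->//|xa] := eqVneq x a; exact: h.
case: gN => // ga; right; exists N, g; split => //.
(* No finite limit exists at a pole: it would force (x - a) ^ (N + 1) f x to tend to 0, whereas this
   product tends to g a, which is nonzero. *)
have pa : plim f a = 0.
  rewrite /plim; case: asboolP => [/cvg_ex[l fl]|_]; last reflexivity.
  exfalso.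
  move/negP: ga; apply; apply/eqP.
  have h1 : (fun x => (x - a) ^+ N.+1 * f x) @ a^' --> (a - a) ^+ N.+1 * l.
    apply: cvgM fl; apply: cvg_dnbhs; exact: (hol_cont (hol_shift_exp a a N.+1)).
  have h2 : (fun x => (x - a) ^+ N.+1 * f x) @ a^' --> g a.
    apply: dnear_cvg (cvg_dnbhs (hol_cont hg)).
    near=> x; rewrite (near fg x)// mulrCA mulfV ?mulr1 //.
    by apply: subr_exp_neq0; near: x; exact: dnbhs_neq.
  by rewrite -(plim_cvg h2) (plim_cvg h1) subrr expr0n mul0r.
have : \forall x \near a^', plim f x = g x / (x - a) ^+ N.+1.
  by near=> x; rewrite (near pf x)// (near fg x).
move=> /dnbhsCP[r r0 h]; apply/nbhsCP; exists r => // x xr.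
have [->|xa] := eqVneq x a; last exact: h.
by rewrite pa subrr expr0n invr0 mulr0.
Unshelve. all: by end_near. Qed.

End MeromorphicGerms.

(** * Integration along arcs *)

Section RealCurves.
Variable R : realType.
Local Notation C := (Cx R).
Implicit Types (q p : R -> C) (d l : C) (s : R).

(** The derivative of a curve with real parameter and complex values, written as an expansion so
    that it composes directly with [cderP]. *)
Definition rcder q s d := forall e : R, 0 < e ->
  \forall s' \near s, nm (q s' - q s - (s' - s)%:C * d) <= e * `|s' - s|.

Lemma rcder_comp F q s d l : rcder q s d -> is_derive (q s) (1 : C) F l ->
  rcder (fun s => F (q s)) s (l * d).
Proof.
move=> hq /cderP hF e e0.
pose K := nm d + 1; have K0 : 0 < K by rewrite ltr_wpDl ?nm_ge0.
pose L := nm l + 1; have L0 : 0 < L by rewrite ltr_wpDl ?nm_ge0.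
have e1 : 0 < e / 2 / K by rewrite !divr_gt0.
have e2 : 0 < e / 2 / L by rewrite !divr_gt0.
have bq : \forall s' \near s, nm (q s' - q s) <= K * `|s' - s|.
  near=> s'; have : nm (q s' - q s - (s' - s)%:C * d) <= 1 * `|s' - s| by near: s'; exact: hq.
  have := nmD (q s' - q s - (s' - s)%:C * d) ((s' - s)%:C * d).
  by rewrite subrK nmM nmR /K; lra.
have /nbhsCP[r r0 hr] := hF _ e1.
near=> s'.
have h2 : nm (q s' - q s - (s' - s)%:C * d) <= e / 2 / L * `|s' - s| by near: s'; exact: hq.
have h4 : nm (q s' - q s) <= K * `|s' - s| by near: s'.
have h3 : nm (F (q s') - F (q s) - l * (q s' - q s)) <= e / 2 / K * nm (q s' - q s).
  apply: hr; apply: (le_lt_trans h4); rewrite mulrC -ltr_pdivlMr // distrC.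
  by near: s'; apply: (nbhsx_ballx s); rewrite divr_gt0.
have -> : F (q s') - F (q s) - (s' - s)%:C * (l * d) =
  (F (q s') - F (q s) - l * (q s' - q s)) + l * (q s' - q s - (s' - s)%:C * d) by ring.
apply: le_trans (nmD _ _) _; rewrite nmM.
have h5 : e / 2 / K * nm (q s' - q s) <= e / 2 * `|s' - s|.
  rewrite -[leRHS]mulrA -[leLHS]mulrA -[leLHS]mulrA ler_pM2l // ler_pM2l ?invr_gt0 //.
  by rewrite mulrC ler_pdivrMr // mulrC.
have h6 : nm l * nm (q s' - q s - (s' - s)%:C * d) <= e / 2 * `|s' - s|.
  apply: (@le_trans _ _ (L * (e / 2 / L * `|s' - s|))).
    by apply: ler_pM; rewrite ?nm_ge0 // /L lerDl.
  by rewrite mulrA [L * _]mulrC divfK // gt_eqF.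
lra.
Unshelve. all: by end_near. Qed.

Lemma rcder_ReIm q s (x' y' : R) :
  is_derive s (1 : R) (fun s => complex.Re (q s)) x' ->
  is_derive s (1 : R) (fun s => complex.Im (q s)) y' -> rcder q s (x' +i* y').
Proof.
move=> /is_derive_normP hx /is_derive_normP hy e e0.
have e2 : 0 < e / 2 by rewrite divr_gt0.
near=> s'; apply: le_trans (nm_ReIm _) _.
have h1 : `|complex.Re (q s') - complex.Re (q s) - x' * (s' - s)| <= e / 2 * `|s' - s|.
  by near: s'; exact: hx.
have h2 : `|complex.Im (q s') - complex.Im (q s) - y' * (s' - s)| <= e / 2 * `|s' - s|.
  by near: s'; exact: hy.
rewrite !ReB !ImB Re_scale Im_scale [(s' - s) * _]mulrC [(s' - s) * complex.Im _]mulrC /=.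
lra.
Unshelve. all: by end_near. Qed.

Lemma rcder_cont q s d : rcder q s d -> q @ s --> q s.
Proof.
move=> h; apply/cvgCP/cvgrPdist_le => e e0.
pose K := nm d + 1; have K0 : 0 < K by rewrite ltr_wpDl ?nm_ge0.
near=> s'; rewrite sub0r normrN ger0_norm ?nm_ge0 //.
have h1 : nm (q s' - q s - (s' - s)%:C * d) <= 1 * `|s' - s| by near: s'; exact: h.
have := nmD (q s' - q s - (s' - s)%:C * d) ((s' - s)%:C * d).
rewrite subrK nmM nmR => h2.
have : `|s' - s| < e / K.
  by rewrite distrC; near: s'; apply: (nbhsx_ballx s); rewrite divr_gt0.
rewrite ltr_pdivlMr // /K => h3; lra.
Unshelve. all: by end_near. Qed.

(* Applied to the real and the imaginary part. *)
Section RealLinear.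
Variable L : C -> R.
Hypothesis LB : forall x y, L (x - y) = L x - L y.
Hypothesis LM : forall (r : R) x, L (r%:C * x) = r * L x.
Hypothesis L_le : forall x, `|L x| <= nm x.

Lemma rcder_lin q s d : rcder q s d -> is_derive s (1 : R) (fun s => L (q s)) (L d).
Proof.
move=> h; apply/is_derive_normP => e e0; near=> s'.
rewrite mulrC -LM -!LB; apply: le_trans (L_le _) _; near: s'; exact: h.
Unshelve. all: by end_near. Qed.

Lemma lin_cont (T : Type) (G : set_system T) (FG : Filter G) (f : T -> C) (l : C) :
  f @ G --> l -> (fun x => L (f x)) @ G --> L l.
Proof.
move=> /cvgCP/cvgrPdist_le h; apply/cvgrPdist_le => e e0; near=> x.
rewrite distrC -LB; apply: le_trans (L_le _) _.
by rewrite -[leLHS]ger0_norm ?nm_ge0 // -normrN -sub0r; near: x; exact: h.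
Unshelve. all: by end_near. Qed.

Lemma arc_cont p (dp : R -> C) (f : C -> C) (a b : R) :
  (forall s, p @ s --> p s) -> (forall s, dp @ s --> dp s) ->
  (forall s, a <= s <= b -> f @ p s --> f (p s)) ->
  {within `[a, b], continuous (fun s => L (f (p s) * dp s))}.
Proof.
move=> hp hdp hf; apply: continuous_in_subspaceT => s; rewrite inE /= in_itv /= => sab.
apply: lin_cont; apply: cvgM; last exact: hdp.
exact: cvg_comp (hp s) (hf s sab).
Qed.

Lemma arc_ftc p (dp : R -> C) (f F : C -> C) (a b : R) : a < b ->
  (forall s, rcder p s (dp s)) -> (forall s, dp @ s --> dp s) ->
  (forall s, a <= s <= b -> f @ p s --> f (p s)) ->
  (forall s, a <= s <= b -> is_derive (p s) (1 : C) F (f (p s))) ->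
  \int[lebesgue_measure]_(s in `[a, b]) L (f (p s) * dp s) = L (F (p b)) - L (F (p a)).
Proof.
move=> ab hp hdp hf hF; have cg := arc_cont (fun s => rcder_cont (hp s)) hdp hf.
have dF s : a <= s <= b -> is_derive s (1 : R) (fun s => L (F (p s))) (L (f (p s) * dp s)).
  by move=> /hF h; apply: rcder_lin; exact: rcder_comp.
have cF s : a <= s <= b -> (fun s => L (F (p s))) @ s --> L (F (p s)).
  by move=> /dF[h _]; apply: differentiable_continuous; apply/derivable1_diffP.
rewrite /Rintegral.
rewrite (@continuous_FTC2 _ _ (fun s => L (F (p s))) a b ab cg) //.
- split.
  + by move=> s; rewrite in_itv /= => /andP[h1 h2]; have sab : a <= s <= b; [by rewrite !ltW|have [] := dF s sab].
  + by apply: cvg_at_right_filter; apply: cF; rewrite lexx ltW.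
  + by apply: cvg_at_left_filter; apply: cF; rewrite lexx ltW.
- move=> s; rewrite in_itv /= => /andP[h1 h2]; rewrite derive1E.
  have sab : a <= s <= b by rewrite !ltW.
  by have [_ ->] := dF s sab.
Qed.

(** A primitive of [f] is available only locally, so the integral up to s2 is compared with the one
    up to s1 on a piece of the arc along which [F] is a primitive. *)
Lemma arc_integral_step p (dp : R -> C) (f F : C -> C) (s1 s2 : R) :
  0 <= s1 -> s1 <= s2 ->
  (forall s, rcder p s (dp s)) -> (forall s, dp @ s --> dp s) ->
  (forall s, 0 <= s <= s2 -> f @ p s --> f (p s)) ->
  (forall s, s1 <= s <= s2 -> is_derive (p s) (1 : C) F (f (p s))) ->
  \int[lebesgue_measure]_(s in `[0%R, s2]) L (f (p s) * dp s) =
  \int[lebesgue_measure]_(s in `[0%R, s1]) L (f (p s) * dp s) +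
    (L (F (p s2)) - L (F (p s1))).
Proof.
move=> s10; rewrite le_eqVlt => /predU1P[-> _ _ _ _|s12 hp hdp hf hF].
  by rewrite subrr addr0.
have hf' s : s1 <= s <= s2 -> f @ p s --> f (p s).
  by move=> /andP[h1 h2]; apply: hf; rewrite h2 (le_trans s10).
rewrite -(arc_ftc s12 hp hdp hf' hF).
have hc := fun s => rcder_cont (hp s).
have int0 : lebesgue_measure.-integrable `[0%R, s2] (EFin \o (fun s => L (f (p s) * dp s))).
  by apply: continuous_compact_integrable; [exact: segment_compact|exact: arc_cont].
have int1 : lebesgue_measure.-integrable `]s1, s2] (EFin \o (fun s => L (f (p s) * dp s))).
  apply: integrableS int0 => //; apply: subset_itvr.
  by rewrite bnd_simp.
have E := Rintegral_itvB int0 (_ : (BLeft 0 <= BRight s1)%O) (_ : (BRight s1 <= BRight s2)%O).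
rewrite -(Rintegral_itv_obnd_cbnd int1) -E ?bnd_simp ?(ltW s12) //.
by rewrite addrC subrK.
Qed.

Lemma segment_point (x y : C) s :
  rcder (fun s : R => x + s%:C * (y - x)) s (y - x).
Proof.
move=> e e0; near=> s'.
have -> : x + s'%:C * (y - x) - (x + s%:C * (y - x)) - (s' - s)%:C * (y - x) = 0.
  by rewrite rmorphB /=; ring.
by rewrite nm0 mulr_ge0 // ltW.
Unshelve. all: by end_near. Qed.

(** The mean value theorem applies to real functions, hence to the real and the imaginary part along
    the segment. *)
Lemma zero_cder_lin F (x y : C) :
  (forall s : R, 0 <= s <= 1 -> is_derive (x + s%:C * (y - x)) (1 : C) F 0) ->
  L (F y) = L (F x).
Proof.
move=> h; pose u := fun s : R => L (F (x + s%:C * (y - x))).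
have du s : 0 <= s <= 1 -> is_derive s (1 : R) u 0.
  move=> /h hs; have := rcder_lin (rcder_comp (segment_point x y s) hs).
  by rewrite mul0r -(subrr (0 : C)) LB subrr.
have h1 s : s \in `]0, 1[%R -> is_derive s (1 : R) u 0.
  by rewrite in_itv /= => /andP[s0 s1]; apply: du; rewrite !ltW.
have h2 : {within `[0, 1], continuous u}.
  apply: continuous_in_subspaceT => s; rewrite inE /= in_itv /= => /du[hs _].
  by apply: differentiable_continuous; apply/derivable1_diffP.
have [c _] := MVT ltr01 h1 h2.
rewrite mul0r => /eqP; rewrite subr_eq0 /u => /eqP; rewrite !mul0r addr0 mul1r.
by rewrite addrC subrK.
Qed.

End RealLinear.

End RealCurves.

(** * Path integrals *)

Section PathIntegrals.
Variable R : realType.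
Local Notation C := (Cx R).
Implicit Types (x y : C).

Lemma complex_eqP x y : complex.Re x = complex.Re y -> complex.Im x = complex.Im y -> x = y.
Proof. by case: x => a b; case: y => c d /= -> ->. Qed.

Lemma zero_cder_const (F : C -> C) x y :
  (forall s : R, 0 <= s <= 1 -> is_derive (x + s%:C * (y - x)) (1 : C) F 0) ->
  F y = F x.
Proof.
move=> h; apply: complex_eqP.
  exact: (zero_cder_lin (@ReB R) (@Re_scale R) (@nm_Re R)).
exact: (zero_cder_lin (@ImB R) (@Im_scale R) (@nm_Im R)).
Qed.

Lemma segment_ball (c x y : C) (r s : R) : 0 <= s <= 1 ->
  nm (x - c) < r -> nm (y - c) < r -> nm (x + s%:C * (y - x) - c) < r.
Proof.
move=> /andP[s0 s1] hx hy.
have -> : x + s%:C * (y - x) - c = (1 - s)%:C * (x - c) + s%:C * (y - c).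
  by rewrite rmorphB rmorph1 /=; ring.
apply: (le_lt_trans (nmD _ _)); rewrite !nmM !nmR !ger0_norm ?subr_ge0 //.
have [->|s0'] := eqVneq s 0; first by rewrite mul0r addr0 subr0 mul1r.
have sp : 0 < s by rewrite lt_neqAle eq_sym s0'.
have h1 : s * nm (y - c) < s * r by rewrite ltr_pM2l.
have h2 : (1 - s) * nm (x - c) <= (1 - s) * r by rewrite ler_wpM2l ?subr_ge0 // ltW.
lra.
Qed.

Lemma zero_cder_ball (F : C -> C) (c : C) (r : R) x y :
  (forall u, nm (u - c) < r -> is_derive u (1 : C) F 0) ->
  nm (x - c) < r -> nm (y - c) < r -> F x = F y.
Proof.
move=> h hx hy; apply: zero_cder_const => s hs; apply: h; exact: segment_ball.
Qed.

Definition velocity (p : R -> C) (s : R) : C :=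
  (fun u => complex.Re (p u))^`() s +i* (fun u => complex.Im (p u))^`() s.

Lemma cvg_ReIm (T : Type) (G : set_system T) (FG : Filter G) (f g : T -> R) (a b : R) :
  f @ G --> a -> g @ G --> b -> (fun i => f i +i* g i : C) @ G --> (a +i* b : C).
Proof.
move=> /cvgrPdist_le hf /cvgrPdist_le hg; apply/cvgCP/cvgrPdist_le => e e0.
have e2 : 0 < e / 2 by rewrite divr_gt0.
near=> i; rewrite sub0r normrN ger0_norm ?nm_ge0 //; apply: le_trans (nm_ReIm _) _.
have h1 : `|a - f i| <= e / 2 by near: i; exact: hf.
have h2 : `|b - g i| <= e / 2 by near: i; exact: hg.
rewrite ReB ImB /= distrC [`|g i - b|]distrC; lra.
Unshelve. all: by end_near. Qed.

Lemma C1_arc_velocity D p b c : @C1_arc R D p b c ->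
  (forall s, rcder p s (velocity p s)) /\ (forall s, velocity p @ s --> velocity p s).
Proof.
move=> [[dx dy] [cx cy] _ _ _]; split=> s.
  by apply: rcder_ReIm; rewrite derive1E; apply: DeriveDef.
by apply: cvg_ReIm; [exact: cx|exact: cy].
Qed.

Definition partial_arc_integral (f : C -> C) (p : R -> C) (u : R) : C :=
  (\int[lebesgue_measure]_(s in `[0%R, u]) complex.Re (f (p s) * velocity p s)) +i*
  (\int[lebesgue_measure]_(s in `[0%R, u]) complex.Im (f (p s) * velocity p s)).

Lemma partial_arc_integral0 f p : partial_arc_integral f p 0 = 0.
Proof. by rewrite /partial_arc_integral set_itv1 !Rintegral_set1. Qed.

Lemma partial_arc_integral1 f p : partial_arc_integral f p 1 = arc_integral f p.
Proof. by []. Qed.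

Lemma partial_arc_integral_step (f F : C -> C) D p b c (s1 s2 : R) :
  C1_arc D p b c -> 0 <= s1 -> s1 <= s2 -> s2 <= 1 ->
  (forall x, D x -> f @ x --> f x) ->
  (forall s, s1 <= s <= s2 -> is_derive (p s) (1 : C) F (f (p s))) ->
  partial_arc_integral f p s2 = partial_arc_integral f p s1 + (F (p s2) - F (p s1)).
Proof.
move=> hp s10 s12 s21 hf hF; have [dp cp] := C1_arc_velocity hp.
have hf' s : 0 <= s <= s2 -> f @ p s --> f (p s).
  move=> /andP[h1 h2]; apply: hf; case: hp => _ _ _ _; apply.
  by rewrite h1 (le_trans h2).
apply: complex_eqP; rewrite /partial_arc_integral.
  rewrite raddfD /= ReB.
  exact: (arc_integral_step (@ReB R) (@Re_scale R) (@nm_Re R) s10 s12 dp cp hf' hF).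
rewrite raddfD /= ImB.
exact: (arc_integral_step (@ImB R) (@Im_scale R) (@nm_Im R) s10 s12 dp cp hf' hF).
Qed.

(** Induction along the interval: the indicator of the failure of [P] is locally constant, hence
    continuous, and cannot pass from 0 to 1 without taking the value 1/2. *)
Lemma interval_connected (P : R -> Prop) : P 0 ->
  (forall s, 0 <= s <= 1 -> exists2 e, 0 < e & forall s1 s2, 0 <= s1 <= 1 -> 0 <= s2 <= 1 ->
     `|s1 - s| < e -> `|s2 - s| < e -> P s1 -> P s2) -> P 1.
Proof.
move=> P0 loc; apply: contrapT => P1.
pose h s : R := if `[< P s >] then 0 else 1.
have hT s : P s -> h s = 0 by move=> Ps; rewrite /h asboolT.
have hF s : ~ P s -> h s = 1 by move=> Ps; rewrite /h asboolF.
have hc : {within `[0, 1], continuous h}.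
  apply/subspace_continuousP => s /=; rewrite in_itv /= => s01.
  have [e e0 he] := loc s s01.
  apply: cvg_near_cst; rewrite near_withinE.
  near=> u => /=; rewrite in_itv /= => u01.
  have us : `|u - s| < e by rewrite distrC; near: u; exact: nbhsx_ballx.
  have ss : `|s - s| < e by rewrite subrr normr0.
  change (h u = h s); have [Ps|Ps] := pselect (P s).
    by rewrite !hT //; exact: he s01 u01 ss us Ps.
  by rewrite !hF // => Pu; apply: Ps; exact: he u01 s01 us ss Pu.
have h0 : h 0 = 0 by exact: hT.
have h1 : h 1 = 1 by exact: hF.
have [|c _ hc2] := @IVT _ h 0 1 2^-1 ler01 hc.
  by rewrite h0 h1 min_l ?ler01 // max_r ?ler01 //; apply/andP; split; lra.
by move: hc2; rewrite /h; case: ifP => _; lra.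
Unshelve. all: by end_near. Qed.

(** * Continuation of primitives along countably many chains of discs *)

Section Chains.
Variables (D : set C) (f : C -> C).
Hypothesis D_open : forall x, D x -> \forall y \near x, D y.
Hypothesis D_hol : forall x, D x -> holomorphic_at f x.

(* Discs with rational centre q.1.1 + i q.1.2 and radius 1 / (q.2 + 1). *)
Definition rpoint (q : rat * rat) : C := (ratr q.1 : R) +i* ratr q.2.
Definition rdisc (i : (rat * rat) * nat) : set C :=
  [set x | nm (x - rpoint i.1) < (i.2.+1%:R)^-1].
Definition is_primitive i (F : C -> C) : Prop :=
  forall x, rdisc i x -> D x /\ is_derive x (1 : C) F (f x).
Definition has_primitive i : Prop := exists F, is_primitive i F.
Definition prim i : C -> C := xget (fun=> 0) (is_primitive i).

Lemma primP i : has_primitive i -> is_primitive i (prim i).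
Proof. by move=> h; apply: xgetPex. Qed.

Lemma rpoint_dense x (e : R) : 0 < e -> exists q, nm (x - rpoint q) < e.
Proof.
move=> e0; have e2 : 0 < e / 2 by rewrite divr_gt0.
have aux (a : R) : exists q : rat, `|a - ratr q| < e / 2.
  have [q] : exists q : rat, ratr q \in `]a - e / 2, a + e / 2[%R.
    by apply: rat_in_itvoo; lra.
  rewrite in_itv /= => /andP[h1 h2]; exists q; rewrite ltr_norml; apply/andP; split; lra.
have [q1 h1] := aux (complex.Re x); have [q2 h2] := aux (complex.Im x).
exists (q1, q2); apply: le_lt_trans (nm_ReIm _) _.
rewrite ReB ImB /=; lra.
Qed.

Lemma exists_rdisc x : D x -> exists2 i, has_primitive i & rdisc i x.
Proof.
move=> Dx; have [F _ hF] := hol_primitive (D_hol Dx).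
have : \forall y \near x, D y /\ is_derive y (1 : C) F (f y).
  by near=> y; split; near: y => //; exact: D_open.
move=> /nbhsCP[r r0 hr].
have r2 : 0 < r / 2 by rewrite divr_gt0.
have [n hn] : exists n : nat, (n.+1%:R)^-1 < r / 2.
  exists (Num.truncn (r / 2)^-1).
  rewrite invf_plt ?posrE //; exact: truncnS_gt.
have n0 : 0 < (n.+1%:R : R)^-1 by rewrite invr_gt0.
have [q hq] := rpoint_dense x n0.
exists (q, n); last exact: hq.
exists F => y hy; apply: hr; apply: le_lt_trans (nmBD _ _ (rpoint q)) _.
rewrite [nm (rpoint q - x)]nmB.
have h1 : nm (y - rpoint q) < r / 2 by exact: lt_trans hy hn.
have h2 : nm (x - rpoint q) < r / 2 by exact: lt_trans hq hn.
lra.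
Unshelve. all: by end_near. Qed.

Lemma rdisc_nbhs i x : rdisc i x -> \forall y \near x, rdisc i y.
Proof.
move=> hx; apply/nbhsCP; exists ((i.2.+1%:R)^-1 - nm (x - rpoint i.1)).
  by rewrite subr_gt0.
move=> y hy; rewrite /rdisc /=; apply: le_lt_trans (nmBD _ _ x) _.
by rewrite -ltrBrDr.
Qed.

(** The intersection of two discs is convex, so the segment from [x] to [y] stays in both, and the
    difference of the primitives has derivative 0 along it. *)
Lemma prim_diff i j x y : has_primitive i -> has_primitive j ->
  rdisc i x -> rdisc j x -> rdisc i y -> rdisc j y ->
  prim i x - prim j x = prim i y - prim j y.
Proof.
move=> /primP hi /primP hj ix jx iy jy.
apply/esym; apply: (@zero_cder_const (fun u => prim i u - prim j u)) => s hs.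
have [_ d1] := hi _ (segment_ball hs ix iy).
have [_ d2] := hj _ (segment_ball hs jx jy).
by have := cderB d1 d2; rewrite subrr.
Qed.

Section Base.
Variables (a : C) (i0 : (rat * rat) * nat).
Hypotheses (i0P : has_primitive i0) (i0a : rdisc i0 a).

(* A chain of discs, consecutive ones meeting at a rational point, records a
   primitive of f on its last disc, namely prim plus the second component.
   There are only countably many chains. *)
Definition chain (l : seq (((rat * rat) * nat) * (rat * rat))) :
    ((rat * rat) * nat) * C :=
  foldl (fun ic jq => (jq.1, ic.2 + prim ic.1 (rpoint jq.2) - prim jq.1 (rpoint jq.2)))
    (i0, - prim i0 a) l.

Definition reach x v : Prop := exists l,
  [/\ has_primitive (chain l).1, rdisc (chain l).1 x & v = prim (chain l).1 x + (chain l).2].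

(** The disc [j] is appended to the chain, with a rational point near [x] as the meeting point. By
    [prim_diff] the transition constant is the same there as at [x]. *)
Lemma reach_at j x v : reach x v -> has_primitive j -> rdisc j x ->
  exists2 l, (chain l).1 = j & v = prim j x + (chain l).2.
Proof.
move=> [l [hi ix ->]] hj jx.
have : \forall y \near x, rdisc (chain l).1 y /\ rdisc j y.
  by near=> y; split; near: y; exact: rdisc_nbhs.
move=> /nbhsCP[r r0 hr]; have [q hq] := rpoint_dense x r0.
rewrite nmB in hq; have [iq jq] := hr (rpoint q) hq.
exists (rcons l (j, q)); rewrite /chain foldl_rcons -/(chain l) //=.
set i := (chain l).1 in hi ix iq *.
have -> : prim i x = prim j x + (prim i (rpoint q) - prim j (rpoint q)).
  by rewrite -(prim_diff hi hj ix jx iq jq); ring.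
by ring.
Unshelve. all: by end_near. Qed.

Lemma reach_move j x y v : has_primitive j -> rdisc j x -> rdisc j y ->
  reach x v -> reach y (v + (prim j y - prim j x)).
Proof.
move=> hj jx jy /reach_at/(_ hj jx)[l lj ->]; exists l; rewrite lj; split=> //.
by ring.
Qed.

Lemma reach_path x v : path_integral D f a x v -> reach x v.
Proof.
elim=> [_|b c {}v p hab IH hp].
  by exists [::]; split => //=; rewrite subrr.
have [_ _ p0 p1 pD] := hp.
(* Induction along the arc: near a parameter the arc stays in one disc, where the partial integral
   changes by the increment of the primitive. *)
pose P s := reach (p s) (v + partial_arc_integral f p s).
have : P 0 by rewrite /P p0 partial_arc_integral0 addr0.
rewrite -p1 -partial_arc_integral1; move/(@interval_connected P); apply => s s01.
have [j hj jx] := exists_rdisc (pD _ s01).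
have [dp _] := C1_arc_velocity hp.
have := rcder_cont (dp s) (rdisc_nbhs jx) => /nbhs_ballP[e /= e0 he].
exists e => // s1 s2 s101 s201 h1 h2 Ps1.
(* Both orders of s1 and s2 occur, since [interval_connected] asks for propagation in both
   directions. *)
have inj_ u : s1 <= u <= s2 \/ s2 <= u <= s1 -> rdisc j (p u).
  move=> hu; apply: he; rewrite /ball /= distrC.
  move: h1 h2; rewrite !ltr_norml => /andP[? ?] /andP[? ?].
  by apply/andP; split; case: hu => /andP[? ?]; lra.
have dF u : s1 <= u <= s2 \/ s2 <= u <= s1 -> is_derive (p u) (1 : C) (prim j) (f (p u)).
  by move=> /inj_ h; have [] := primP hj h.
have Dc x' : D x' -> f @ x' --> f x' by move=> /D_hol; exact: hol_cont.
have js1 : rdisc j (p s1) by apply: inj_; case: (lerP s1 s2) => h; [left|right]; rewrite lexx ?h ?(ltW h).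
have js2 : rdisc j (p s2) by apply: inj_; case: (lerP s1 s2) => h; [left|right]; rewrite lexx ?h ?(ltW h).
have E : partial_arc_integral f p s2 = partial_arc_integral f p s1 + (prim j (p s2) - prim j (p s1)).
  move: s101 s201 => /andP[s10 s11] /andP[s20 s21].
  case: (lerP s1 s2) => h.
    by apply: (partial_arc_integral_step hp s10 h s21 Dc) => u hu; apply: dF; left.
  have E' := partial_arc_integral_step hp s20 (ltW h) s11 Dc (fun u hu => dF u (or_intror hu)).
  by rewrite E'; ring.
by rewrite /P E addrA; exact: reach_move Ps1.
Qed.

End Base.

(** The difference is the constant recorded by some chain. Chains are finite sequences of rational
    data over a fixed initial disc, and the set does not depend on the point of the disc [j]. *)
Lemma path_integral_values_countable a j : D a -> has_primitive j ->
  exists2 S : set C, countable S &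
    forall x v, rdisc j x -> path_integral D f a x v -> S (v - prim j x).
Proof.
move=> Da hj; have [i0 hi0 i0a] := exists_rdisc Da.
exists ((fun l => (chain a i0 l).2) @` setT).
  exact: sub_countable (card_image_le _ _) (countableP _).
move=> x v jx /(reach_path hi0 i0a)/(reach_at) /(_ hj jx)[l _ ->].
by exists l => //; ring.
Qed.

End Chains.

(** If the real or the imaginary part differed at the two points, then along the segment it would
    cover an interval by the intermediate value theorem; but a countable set has measure 0. *)
Lemma countable_continuous_const (h : C -> C) (S : set C) (c : C) (r : R) x y :
  countable S -> (forall u, nm (u - c) < r -> S (h u) /\ h @ u --> h u) ->
  nm (x - c) < r -> nm (y - c) < r -> h x = h y.
Proof.
move=> cS hh hx hy.
pose q (s : R) : C := x + s%:C * (y - x).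
have hq s : 0 <= s <= 1 -> nm (q s - c) < r by move=> hs; exact: segment_ball.
have aux (L : C -> R) : (forall u v, L (u - v) = L u - L v) -> (forall u, `|L u| <= nm u) ->
    L (h x) = L (h y).
  move=> LB L_le; apply/eqP/negPn/negP => neq.
  pose g s := L (h (q s)).
  have cg : {within `[0, 1], continuous g}.
    apply: continuous_in_subspaceT => s; rewrite inE /= in_itv /= => s01.
    apply: (lin_cont LB L_le).
    apply: cvg_comp (hh _ (hq s s01)).2.
    exact: (rcder_cont (segment_point x y s)).
  have g0 : g 0 = L (h x) by rewrite /g /q mul0r addr0.
  have g1 : g 1 = L (h y) by rewrite /g /q mul1r addrC subrK.
  pose lo := Num.min (g 0) (g 1); pose hi := Num.max (g 0) (g 1).
  have lohi : lo < hi.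
    move: neq; rewrite -g0 -g1 neq_lt /lo /hi => /orP[] k.
      by rewrite min_l ?max_r // ltW.
    by rewrite min_r ?max_l // ltW.
  have sub : `[lo, hi] `<=` L @` S.
    move=> v /=; rewrite in_itv /= => hv.
    have [s] := IVT ler01 cg hv; rewrite in_itv /= => s01 <-.
    by exists (h (q s)) => //; exact: (hh _ (hq s s01)).1.
  have cI : countable (`[lo, hi] : set R).
    apply: sub_countable (subset_card_le sub) _.
    exact: sub_countable (card_image_le _ _) cS.
  have := countable_lebesgue_measure0 cI; rewrite lebesgue_measure_itv /= lte_fin lohi.
  by move=> /eqP; rewrite -EFinB eqe subr_eq0 gt_eqF.
by apply: complex_eqP; apply: aux; [exact: ReB|exact: nm_Re|exact: ImB|exact: nm_Im].
Qed.

End PathIntegrals.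

(** * Branches of the curve *)

Section CurveBranches.
Variables (R : realType) (H : set (Cx R)) (t : Cx R -> Cx R) (c1 c2 : Cx R).
Local Notation C := (Cx R).
Local Notation D := (regular_part H t).
Local Notation curve := (curve H t c1 c2).
Local Notation branch := (branch H t c1 c2).
Hypothesis oH : open H.
Hypotheses (hc1 : D c1) (hc2 : D c2).
Implicit Types (x y : C) (T : 'M[C]_2).

Lemma sym2E (a b c : C) : ((sym2 a b c 0 0 = a) * (sym2 a b c 0 1 = b) *
  (sym2 a b c 1 0 = b) * (sym2 a b c 1 1 = c))%type.
Proof. by rewrite /sym2 !mxE. Qed.

Lemma regular_nbhs x : D x -> \forall y \near x, D y.
Proof.
move=> [Hx tx]; near=> y; split; near: y; last exact: hol_nbhs.
exact: open_nbhs_nbhs.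
Unshelve. all: by end_near. Qed.

Lemma regular_hol x : D x -> holomorphic_at t x.
Proof. by case. Qed.

Lemma regular_hol_sq x : D x -> holomorphic_at (fun y => t y ^+ 2) x.
Proof. by case=> _; exact: holX. Qed.

Lemma path_integral_mem (f : C -> C) (a x v : C) : path_integral D f a x v -> D x.
Proof.
case=> [Da|b c v' p _ [_ _ _ <- h]]; [exact: Da|apply: h].
by rewrite ler01 lexx.
Qed.

Lemma curveP T : curve T -> D (T 0 0) /\ T = sym2 (T 0 0) (T 0 1) (T 1 1).
Proof. by move=> [x [v2 [v3 [/path_integral_mem Dx _ ->]]]]; rewrite !sym2E. Qed.

(** The path is prolonged by the straight segment from [x] to [y]. *)
Lemma path_integral_extend (f F : C -> C) (a x y v : C) :
  (forall u, D u -> f @ u --> f u) ->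
  (forall s : R, 0 <= s <= 1 -> D (x + s%:C * (y - x)) /\
     is_derive (x + s%:C * (y - x)) (1 : C) F (f (x + s%:C * (y - x)))) ->
  path_integral D f a x v -> path_integral D f a y (v + (F y - F x)).
Proof.
move=> hf hF hv; pose p (s : R) : C := x + s%:C * (y - x).
have p0 : p 0 = x by rewrite /p mul0r addr0.
have p1 : p 1 = y by rewrite /p mul1r addrC subrK.
have dRe s : is_derive s (1 : R) (fun u => complex.Re (p u)) (complex.Re (y - x)).
  exact: (rcder_lin (@ReB R) (@Re_scale R) (@nm_Re R) (segment_point x y s)).
have dIm s : is_derive s (1 : R) (fun u => complex.Im (p u)) (complex.Im (y - x)).
  exact: (rcder_lin (@ImB R) (@Im_scale R) (@nm_Im R) (segment_point x y s)).
have hp : C1_arc D p x y.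
  split; [|idtac|exact: p0|exact: p1|by move=> s /hF[]].
    by split=> s; [have [] := dRe s|have [] := dIm s].
  have ERe : (fun u => complex.Re (p u))^`() = cst (complex.Re (y - x)).
    by apply/funext => s; rewrite derive1E; have [_ ->] := dRe s.
  have EIm : (fun u => complex.Im (p u))^`() = cst (complex.Im (y - x)).
    by apply/funext => s; rewrite derive1E; have [_ ->] := dIm s.
  by rewrite ERe EIm; split=> s; exact: cvg_cst.
have := path_integral_rcons hv hp; congr (path_integral _ _ _ _ (_ + _)).
rewrite -partial_arc_integral1.
rewrite (partial_arc_integral_step hp (lexx 0) ler01 (lexx 1) hf (fun s hs => (hF s hs).2)).
by rewrite partial_arc_integral0 add0r -/(p 0) -/(p 1) p0 p1.
Qed.

(** The two paths that define [T] are prolonged by segments inside a disc on which [t] and its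
    square have primitives. *)
Lemma curve_branch T : curve T -> exists U B, [/\ branch U B, U (T 0 0) & B (T 0 0) = T].
Proof.
move=> [x [v2 [v3 [h2 h3 ->]]]]; rewrite sym2E.
have Dx := path_integral_mem h2.
have [F2 _ hF2] := hol_primitive (regular_hol Dx).
have [F3 _ hF3] := hol_primitive (regular_hol_sq Dx).
have : \forall y \near x, D y /\ is_derive y (1 : C) F2 (t y) /\ is_derive y (1 : C) F3 (t y ^+ 2).
  have DD := regular_nbhs Dx.
  by near=> y; split; [near: y|split; near: y].
move=> /nbhsCP[r r0 hr].
pose U : set C := [set y | nm (y - x) < r].
have Ux : U x by rewrite /U /= subrr nm0.
have tc u : D u -> t @ u --> t u by move=> /regular_hol; exact: hol_cont.
have t2c u : D u -> (fun y => t y ^+ 2) @ u --> t u ^+ 2.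
  by move=> /regular_hol_sq /hol_cont.
exists U, (fun y => sym2 y (- (v2 + (F2 y - F2 x))) (v3 + (F3 y - F3 x))); split; [|exact: Ux|].
- split.
  + rewrite openE => y Uy; apply/nbhsCP; exists (r - nm (y - x)); first by rewrite subr_gt0.
    by move=> u hu; rewrite /U /=; apply: le_lt_trans (nmBD _ _ y) _; rewrite -ltrBrDr.
  + by move=> y /hr[].
  + move=> y Uy; exists y, (v2 + (F2 y - F2 x)), (v3 + (F3 y - F3 x)).
    have seg s : 0 <= s <= 1 -> U (x + s%:C * (y - x)).
      by move=> hs; apply: (segment_ball hs).
    split; last reflexivity.
      by apply: (path_integral_extend tc) h2 => s /seg/hr[? []].
    by apply: (path_integral_extend t2c) h3 => s /seg/hr[? []].
  + exists (fun y => - (v2 + (F2 y - F2 x))), (fun y => v3 + (F3 y - F3 x)) => y Uy.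
    have [_ [d2 d3]] := hr _ Uy; split; [reflexivity| |].
      have := cderD (cder_cst (- v2 + F2 x) y) (cderN d2); rewrite add0r.
      by apply: cder_near; near=> u; rewrite /=; ring.
    have := cderD (cder_cst (v3 - F3 x) y) d3; rewrite add0r.
    by apply: cder_near; near=> u; ring.
- by rewrite !subrr !addr0.
Unshelve. all: by end_near. Qed.

Section Branch.
Variables (U : set C) (B : C -> 'M[C]_2).
Hypothesis hB : branch U B.

Lemma branch_nbhs x : U x -> \forall y \near x, U y.
Proof. by case: hB => oU _ _ _ Ux; exact: (open_nbhs_nbhs (conj oU Ux)). Qed.

Lemma branch00 x : U x -> B x 0 0 = x.
Proof. by case: hB => _ _ _ [b2 [b3 h]] /h[-> _ _]; rewrite sym2E. Qed.

Lemma branch_curve x : U x -> curve (B x).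
Proof. by case: hB => _ _ h _; exact: h. Qed.

Lemma branch_regular x : U x -> D x.
Proof. by case: hB => _ h _ _ /h. Qed.

Lemma branch_cder01 x : U x -> is_derive x (1 : C) (fun y => B y 0 1) (- t x).
Proof.
case: hB => _ _ _ [b2 [b3 h]] Ux; have Un := branch_nbhs Ux; have [_ d2 _] := h _ Ux.
apply: cder_near d2; near=> y; have Uy : U y by near: y.
have [-> _ _] := h y Uy.
by rewrite sym2E.
Unshelve. all: by end_near. Qed.

Lemma branch_cder11 x : U x -> is_derive x (1 : C) (fun y => B y 1 1) (t x ^+ 2).
Proof.
case: hB => _ _ _ [b2 [b3 h]] Ux; have Un := branch_nbhs Ux; have [_ _ d2] := h _ Ux.
apply: cder_near d2; near=> y; have Uy : U y by near: y.
have [-> _ _] := h y Uy.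
by rewrite sym2E.
Unshelve. all: by end_near. Qed.

(** A [branch] provides complex derivatives only. Its entries are power series because their
    derivatives are: on a disc, [f] differs by a constant from the primitive obtained by termwise
    integration. *)
Lemma hol_of_cder (f g : C -> C) x : holomorphic_at g x ->
  (\forall y \near x, is_derive y (1 : C) f (g y)) -> holomorphic_at f x.
Proof.
move=> hg df; have [F hF dF] := hol_primitive hg.
have : \forall y \near x, is_derive y (1 : C) (fun u => f u - F u) 0.
  by near=> y; rewrite -(subrr (g y)); apply: cderB; near: y.
move=> /nbhsCP[r r0 hr].
apply: (@hol_near_eq _ (fun u => F u + (f x - F x))); last first.
  by apply: holD; [exact: hF|exact: hol_cst].
apply/nbhsCP; exists r => // y yr.
have xr : nm (x - x) < r by rewrite subrr nm0.
rewrite (zero_cder_ball hr xr yr); ring.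
Unshelve. all: by end_near. Qed.

Lemma branch_hol01 x : U x -> holomorphic_at (fun y => B y 0 1) x.
Proof.
move=> Ux; have Un := branch_nbhs Ux.
apply: (@hol_of_cder _ (fun y => - t y)); first by apply: holN; exact: (branch_regular Ux).2.
near=> y; apply: branch_cder01; near: y; exact: Un.
Unshelve. all: by end_near. Qed.

Lemma branch_hol11 x : U x -> holomorphic_at (fun y => B y 1 1) x.
Proof.
move=> Ux; have Un := branch_nbhs Ux.
apply: (@hol_of_cder _ (fun y => t y ^+ 2)); first by apply: holX; exact: (branch_regular Ux).2.
near=> y; apply: branch_cder11; near: y; exact: Un.
Unshelve. all: by end_near. Qed.

(* Since path integrals with given end points take countably many values, a
   continuous map into the curve stays on one branch. *)
Lemma branch_lift x0 x1 (q : C -> 'M[C]_2) : U x0 ->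
  (\forall x \near x1, curve (q x)) ->
  (\forall x \near x1, forall i j, (fun y => q y i j) @ x --> q x i j) ->
  q x1 = B x0 -> \forall x \near x1, U (q x 0 0) /\ q x = B (q x 0 0).
Proof.
move=> Ux0 qc qcont q1; have Dx0 := branch_regular Ux0.
have [j2 hj2 jx2] := exists_rdisc regular_nbhs regular_hol Dx0.
have [j3 hj3 jx3] := exists_rdisc regular_nbhs regular_hol_sq Dx0.
have [S2 cS2 hS2] := path_integral_values_countable regular_nbhs regular_hol hc1 hj2.
have [S3 cS3 hS3] := path_integral_values_countable regular_nbhs regular_hol_sq hc2 hj3.
have : \forall y \near x0, [/\ U y, rdisc j2 y & rdisc j3 y].
  have Un := branch_nbhs Ux0.
  by near=> y; split; near: y; [exact: Un|exact: rdisc_nbhs|exact: rdisc_nbhs].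
move=> near0; have /nbhsCP[r0 r00 hr0] := near0.
have q00 : q x1 0 0 = x0 by rewrite q1 branch00.
have c00 : (fun y => q y 0 0) @ x1 --> x0 by rewrite -q00; exact: (nbhs_singleton qcont 0 0).
have near1 : \forall x \near x1, [/\ U (q x 0 0), rdisc j2 (q x 0 0) & rdisc j3 (q x 0 0)].
  exact: (c00 _ near0).
have near2 : \forall x \near x1, nm (q x 0 0 - x0) < r0.
  have b0 : \forall y \near x0, nm (y - x0) < r0 by apply/nbhsCP; exists r0.
  exact: (c00 _ b0).
have : \forall x \near x1, [/\ curve (q x), forall i j, (fun y => q y i j) @ x --> q x i j,
   rdisc j2 (q x 0 0) /\ rdisc j3 (q x 0 0) & nm (q x 0 0 - x0) < r0 ].
  near=> x; have [_ h2 h3] : [/\ U (q x 0 0), rdisc j2 (q x 0 0) & rdisc j3 (q x 0 0)] by near: x.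
  by split; [near: x|near: x|split|near: x].
move=> /nbhsCP[r r_0 hr].
have x1r : nm (x1 - x1) < r by rewrite subrr nm0.
have x0r : nm (x0 - x0) < r0 by rewrite subrr nm0.
pose P2 := prim D t j2; pose P3 := prim D (fun y => t y ^+ 2) j3.
have hP2 y : rdisc j2 y -> is_derive y (1 : C) P2 (t y) by move=> /(primP hj2)[].
have hP3 y : rdisc j3 y -> is_derive y (1 : C) P3 (t y ^+ 2) by move=> /(primP hj3)[].
(* On the curve the entry (0, 1) is minus the integral of [t]. The integral minus its local
   primitive takes countably many values and is continuous in [x], hence constant; [E3] does the
   same for the entry (1, 1). *)
have E2 x : nm (x - x1) < r -> - q x 0 1 - P2 (q x 0 0) = - q x1 0 1 - P2 (q x1 0 0).
  move=> xr; apply: (countable_continuous_const (h := fun x => - q x 0 1 - P2 (q x 0 0)) cS2 _ xr x1r).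
  move=> u /hr[[y [v2 [v3 [p2 p3 qE]]]] cq [d2 d3] _]; split.
    by have := hS2 _ _ d2; rewrite qE !sym2E opprK; apply.
  exact: (cvgB (cvgN (cq 0 1)) (cvg_comp _ _ (cq 0 0) (cder_cont (hP2 _ d2)))).
have E3 x : nm (x - x1) < r -> q x 1 1 - P3 (q x 0 0) = q x1 1 1 - P3 (q x1 0 0).
  move=> xr; apply: (countable_continuous_const (h := fun x => q x 1 1 - P3 (q x 0 0)) cS3 _ xr x1r).
  move=> u /hr[[y [v2 [v3 [p2 p3 qE]]]] cq [d2 d3] _]; split.
    by have := hS3 _ _ d3; rewrite qE !sym2E; apply.
  exact: (cvgB (cq 1 1) (cvg_comp _ _ (cq 0 0) (cder_cont (hP3 _ d3)))).
(* Along the branch the corresponding differences are constant because their derivatives vanish. The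
   two constants are compared at [x1], where [q x1 = B x0]. *)
have F2 y : nm (y - x0) < r0 -> B y 0 1 + P2 y = B x0 0 1 + P2 x0.
  have d0 u : nm (u - x0) < r0 -> is_derive u (1 : C) (fun y => B y 0 1 + P2 y) 0.
    by move=> /hr0[Uu d2 _]; have := cderD (branch_cder01 Uu) (hP2 _ d2); rewrite addNr.
  by move=> yr; exact: (zero_cder_ball d0 yr x0r).
have F3 y : nm (y - x0) < r0 -> B y 1 1 - P3 y = B x0 1 1 - P3 x0.
  have d0 u : nm (u - x0) < r0 -> is_derive u (1 : C) (fun y => B y 1 1 - P3 y) 0.
    by move=> /hr0[Uu _ d3]; have := cderB (branch_cder11 Uu) (hP3 _ d3); rewrite subrr.
  by move=> yr; exact: (zero_cder_ball d0 yr x0r).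
apply/nbhsCP; exists r => // x xr; have [cq _ _ qr] := hr _ xr.
have [Uq _ _] := hr0 _ qr; split=> //.
have [_ Eq] := curveP cq; have [_ Eb] := curveP (branch_curve Uq).
have e2 := E2 _ xr; have e3 := E3 _ xr; have f2 := F2 _ qr; have f3 := F3 _ qr.
rewrite q1 branch00 // in e2; rewrite q1 branch00 // in e3.
rewrite [LHS]Eq [RHS]Eb branch00 //; congr sym2.
  have -> : q x 0 1 = - (- q x 0 1 - P2 (q x 0 0)) - P2 (q x 0 0) by ring.
  have -> : B (q x 0 0) 0 1 = (B (q x 0 0) 0 1 + P2 (q x 0 0)) - P2 (q x 0 0) by ring.
  by rewrite e2 f2; ring.
have -> : q x 1 1 = (q x 1 1 - P3 (q x 0 0)) + P3 (q x 0 0) by ring.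
have -> : B (q x 0 0) 1 1 = (B (q x 0 0) 1 1 - P3 (q x 0 0)) + P3 (q x 0 0) by ring.
by rewrite e3 f3.
Unshelve. all: by end_near. Qed.

Lemma ord2P (k : 'I_2) : k = 0 \/ k = 1.
Proof. by case: k => [[|[|//]] ?]; [left|right]; apply/val_inj. Qed.

Lemma branch_sym x : U x -> B x 1 0 = B x 0 1.
Proof. by move=> /branch_curve/curveP[_ ->]; rewrite !sym2E. Qed.

Lemma branch_hol x : U x -> forall i j, holomorphic_at (fun y => B y i j) x.
Proof.
move=> Ux i j; have Un := branch_nbhs Ux; have h01 := branch_hol01 Ux.
have [-> | ->] := ord2P i; have [-> | ->] := ord2P j.
- by apply: hol_near_eq (hol_id x); near=> y; apply/esym/branch00; near: y.
- exact: h01.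
- by apply: hol_near_eq h01; near=> y; apply/esym/branch_sym; near: y.
- exact: branch_hol11.
Unshelve. all: by end_near. Qed.

Lemma branch_cont x : U x -> forall i j, (fun y => B y i j) @ x --> B x i j.
Proof. by move=> Ux i j; exact: (hol_cont (branch_hol Ux i j)). Qed.

End Branch.

(** The second branch is itself a continuous map into the curve that starts on the first one, and
    its entry (0, 0) is the coordinate, so both are taken at the same point. *)
Lemma branch_unique U B U' B' x : branch U B -> branch U' B' -> U x -> U' x ->
  B x = B' x -> \forall y \near x, B y = B' y.
Proof.
move=> hB hB' Ux Ux' E; have Un := branch_nbhs hB' Ux'.
have h : \forall y \near x, U (B' y 0 0) /\ B' y = B (B' y 0 0).
  apply: (branch_lift hB Ux).
  - by near=> y; apply: (branch_curve hB'); near: y.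
  - by near=> y; apply: (branch_cont hB'); near: y.
  - by rewrite E.
near=> y; have U'y : U' y by near: y.
have [_ ->] : U (B' y 0 0) /\ B' y = B (B' y 0 0) by near: y.
by rewrite (branch00 hB' U'y).
Unshelve. all: by end_near. Qed.

End CurveBranches.

(** * Linear recurrences *)

Section PrefixRank.
Variables (F : fieldType) (n : nat).
Implicit Types (V W : nat -> 'rV[F]_n) (a b : nat -> F).

Definition indep k V := forall b, \sum_(j < k) b j *: V j = 0 -> forall j, (j < k)%N -> b j = 0.

Definition prefix_mx k V : 'M[F]_(k, n) := \matrix_(i < k) V i.

Lemma comb_mulmx k V b : \sum_(j < k) b j *: V j = (\row_(j < k) b j) *m prefix_mx k V.
Proof. by rewrite mulmx_sum_row; apply: eq_bigr => j _; rewrite mxE rowK. Qed.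

Lemma indep_row_free k V : indep k V <-> row_free (prefix_mx k V).
Proof.
split=> [h|h b].
  rewrite -kermx_eq0; apply/rowV0P => u /sub_kermxP u0; apply/rowP => j.
  pose b i := if insub i is Some i' then u 0 i' else 0.
  have bE (i : 'I_k) : b i = u 0 i by rewrite /b valK.
  rewrite -bE mxE; apply: h (ltn_ord j); rewrite comb_mulmx -u0; congr (_ *m _).
  by apply/rowP => i; rewrite mxE bE.
rewrite comb_mulmx => /eqP; rewrite mulmx_free_eq0 // => /eqP/rowP b0 j jk.
by have := b0 (Ordinal jk); rewrite !mxE.
Qed.

Lemma indep_le k k' V : (k <= k')%N -> indep k' V -> indep k V.
Proof.
move=> kk h b hb j jk.
have := h (fun i => if (i < k)%N then b i else 0) _ j (leq_trans jk kk); rewrite jk; apply.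
rewrite -[RHS]hb (big_ord_widen _ (fun j => b j *: V j) kk) [RHS]big_mkcond.
by apply: eq_bigr => i _; case: ifP => // _; rewrite scale0r.
Qed.

Lemma indep_bound V : ~ indep n.+1 V.
Proof. by move/indep_row_free; rewrite /row_free => /eqP E; have := rank_leq_col (prefix_mx n.+1 V); rewrite E ltnn. Qed.

Lemma indep_span k V : indep k V -> ~ indep k.+1 V ->
  exists b, V k = \sum_(j < k) b j *: V j.
Proof.
move=> hk /existsNP[b /not_implyP[hb /existsNP[j /not_implyP[jk /eqP bj]]]].
rewrite big_ord_recr /= in hb.
have [bk0|bk] := eqVneq (b k) 0.
  exfalso; rewrite bk0 scale0r addr0 in hb; have b0 := hk _ hb.
  move: jk; rewrite ltnS leq_eqVlt => /predU1P[jk|/b0 bj0]; last by rewrite bj0 eqxx in bj.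
  by rewrite jk bk0 eqxx in bj.
exists (fun j => - (b k)^-1 * b j).
have -> : \sum_(j0 < k) (- (b k)^-1 * b j0) *: V j0 = (- (b k)^-1) *: \sum_(j < k) b j *: V j.
  by rewrite scaler_sumr; apply: eq_bigr => i _; rewrite scalerA.
have -> : \sum_(j < k) b j *: V j = - (b k *: V k) by apply/eqP; rewrite -addr_eq0 hb.
by rewrite scaleNr scalerN opprK scalerA mulVf // scale1r.
Qed.

(* If V 0, ..., V (n - 1) are dependent, then V n = \sum_(j < n) a j V j does not
   determine a; using only the maximal independent initial segment of V does. *)
Definition coef_spec V a := exists2 k, (k <= n)%N & [/\ indep k V, ~ indep k.+1 V,
  (forall j, (k <= j)%N -> a j = 0) & V n = \sum_(j < k) a j *: V j].

(** The number k is forced, being the length of the longest independent initial segment; the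
    coefficients are then unique by independence. *)
Lemma coef_spec_unique V a b : coef_spec V a -> coef_spec V b -> a = b.
Proof.
move=> [k kn [ik nk ak aV]] [l ln [il nl bl bV]].
have kl : k = l.
  apply/eqP; rewrite eqn_leq; apply/andP; split; rewrite leqNgt; apply/negP => h.
    by apply: nl; exact: indep_le h ik.
  by apply: nk; exact: indep_le h il.
subst l; apply/funext => j; case: (ltnP j k) => jk; last by rewrite ak // bl.
apply/eqP; rewrite -subr_eq0; apply/eqP; apply: (ik (fun j => a j - b j)) => //.
under eq_bigr do rewrite scalerBl.
by rewrite sumrB -aV -bV subrr.
Qed.

Definition coef V : nat -> F := xget (fun=> 0) (coef_spec V).

Lemma coef_eq V a : coef_spec V a -> coef V = a.
Proof.
move=> h; apply: (coef_spec_unique _ h); apply: (@xgetPex _ (fun=> 0) (coef_spec V)).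
by exists a.
Qed.

Lemma coef_spec_sum V a : coef_spec V a -> V n = \sum_(j < n) a j *: V j.
Proof.
move=> [k kn [_ _ a0 ->]].
rewrite (big_ord_widen _ (fun j => a j *: V j) kn) big_mkcond.
apply: eq_bigr => i _; case: ltnP => // ki; by rewrite a0 // scale0r.
Qed.

Lemma indep_mulmx k V W (P : 'M[F]_n) : (forall m, (m < k)%N -> W m = V m *m P) ->
  indep k W -> indep k V.
Proof.
move=> WV h b hb; apply: h.
under eq_bigr => j _ do rewrite WV // scalemxAl.
by rewrite -mulmx_suml hb mul0mx.
Qed.

(** Right multiplication preserves linear relations. With a matrix in each direction it also
    preserves independence, so [V] and [W] have the same k and the same coefficients. *)
Lemma coef_mulmx V W (P Q : 'M[F]_n) : (forall m, (m <= n)%N -> W m = V m *m P) ->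
  (forall m, (m <= n)%N -> V m = W m *m Q) -> coef V = coef W.
Proof.
move=> WV VW; have E : coef_spec V = coef_spec W.
  (* Equality of the two specifications also settles the case in which neither is satisfiable and
     [coef] takes its default value. *)
  suff h V' W' (P' Q' : 'M[F]_n) a : (forall m, (m <= n)%N -> W' m = V' m *m P') ->
      (forall m, (m <= n)%N -> V' m = W' m *m Q') -> coef_spec V' a -> coef_spec W' a.
    by apply/funext => a; apply/propext; split; [exact: h WV VW|exact: h VW WV].
  move=> WV' VW' [k kn [ik nk ak aV]]; exists k => //; split=> //.
  - apply: indep_mulmx ik => m mk; apply: VW'; exact: ltnW (leq_trans mk kn).
  - move=> iw; apply: nk; apply: indep_mulmx iw => m mk; apply: WV'.
    by rewrite -ltnS (leq_trans mk).
  - rewrite WV' // aV mulmx_suml; apply: eq_bigr => j _.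
    by rewrite -scalemxAl WV' // ltnW // (leq_trans (ltn_ord j)).
by rewrite /coef E.
Qed.

(** The columns are chosen by a finite function, so that there are finitely many minors and a
    statement about all of them can be moved through a filter. *)
Lemma unit_minor k (M : 'M[F]_(k, n)) : row_free M <->
  exists f : {ffun 'I_k -> 'I_n}, \det (colsub f M) != 0.
Proof.
split=> [|[f hf]].
  rewrite -row_leq_rank -mxrank_tr => h.
  have hfull : row_full M^T by rewrite /row_full eqn_leq rank_leq_col.
  exists [ffun i => fullrankfun hfull i].
  have := fullrowsub_unit hfull; rewrite unitmxE unitfE -det_tr; congr (\det _ != 0).
  by apply/matrixP => i j; rewrite !mxE [in RHS]ffunE.
apply/row_freeP; exists (colsub f 1%:M *m invmx (colsub f M)).
by rewrite mulmxA mulmx_colsub mulmx1 mulmxV // unitmxE unitfE.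
Qed.

Lemma cramer_minor k V b (f : 'I_k -> 'I_n) : V k = \sum_(j < k) b j *: V j ->
  \det (colsub f (prefix_mx k V)) != 0 -> forall j : 'I_k,
  b j = \sum_i V k 0 (f i) * ((\det (colsub f (prefix_mx k V)))^-1 * \adj (colsub f (prefix_mx k V)) i j).
Proof.
move=> Vk d j; set N := colsub f (prefix_mx k V) in d *.
have uN : N \in unitmx by rewrite unitmxE unitfE.
have E : colsub f (V k) = (\row_(j < k) b j) *m N by rewrite Vk comb_mulmx mulmx_colsub.
have : (\row_(j < k) b j) = colsub f (V k) *m invmx N by rewrite E mulmxK.
move=> /rowP/(_ j); rewrite !mxE => ->; apply: eq_bigr => i _.
by rewrite /invmx uN !mxE.
Qed.

End PrefixRank.

(** * Linear recurrences with meromorphic coefficients *)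

Section RecurrenceGerms.
Variable R : realType.
Local Notation C := (Cx R).
Variable x0 : C.
Implicit Types (f g : C -> C).

#[local] Opaque holomorphic_at.

Lemma pmero_det k (M : C -> 'M[C]_k) : (forall i j, pmero (fun x => M x i j) x0) ->
  pmero (fun x => \det (M x)) x0.
Proof.
move=> h; rewrite /determinant.
apply: pmero_sum => s _; apply: pmeroM; first exact: pmero_cst.
by apply: pmero_prod => i _.
Qed.

Lemma pmero_adj k (M : C -> 'M[C]_k) i j : (forall i j, pmero (fun x => M x i j) x0) ->
  pmero (fun x => \adj (M x) i j) x0.
Proof.
move=> h.
refine (@pmero_eq _ (fun x => (-1) ^+ (j + i) * \det (row' j (col' i (M x)))) _ _ _ _).
  by near=> x; rewrite mxE.
apply: pmeroM; first exact: pmero_cst.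
apply: pmero_det => k' l.
by refine (@pmero_eq _ _ _ _ _ (h (lift j k') (lift i l))); near=> x; rewrite !mxE.
Unshelve. all: by end_near. Qed.

Variable n : nat.
Variable v : nat -> C -> 'rV[C]_n.
Hypothesis v_pmero : forall m i, pmero (fun x => v m x 0 i) x0.

Lemma prefix_minor_pmero k (f : 'I_k -> 'I_n) i j :
  pmero (fun x => colsub f (prefix_mx k (v^~ x)) i j) x0.
Proof.
by refine (@pmero_eq _ _ _ _ _ (v_pmero i (f j))); near=> x; rewrite !mxE.
Unshelve. all: by end_near. Qed.

(** Each minor vanishes identically or nowhere on a small punctured disc, and finitely many discs
    have a common one. *)
Lemma minor_dichotomy k : (exists f : {ffun 'I_k -> 'I_n},
    \forall x \near x0^', \det (colsub f (prefix_mx k (v^~ x))) != 0) \/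
  (\forall x \near x0^', ~ indep k (v^~ x)).
Proof.
have dich (f : {ffun 'I_k -> 'I_n}) :=
  pmero_dichotomy (pmero_det (@prefix_minor_pmero k f)).
have [ex|nex] := pselect (exists f : {ffun 'I_k -> 'I_n},
    \forall x \near x0^', \det (colsub f (prefix_mx k (v^~ x))) != 0); [by left|right].
have all0 : \forall x \near x0^', forall f : {ffun 'I_k -> 'I_n}, \det (colsub f (prefix_mx k (v^~ x))) = 0.
  by apply: filter_forall => f; case: (dich f) => // h; exfalso; apply: nex; exists f.
near=> x; move/indep_row_free/unit_minor => [f]; apply/negP; rewrite negbK; apply/eqP.
have H : forall f : {ffun 'I_k -> 'I_n}, \det (colsub f (prefix_mx k (v^~ x))) = 0 by near: x.
exact: H.
Unshelve. all: by end_near. Qed.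

(** The empty minor is 1 and n + 1 vectors in dimension n are dependent, so for some k <= n there is
    a k-minor that vanishes nowhere near but off the centre, while there is no such (k +
    1)-minor. *)
Lemma generic_rank : exists2 k, (k <= n)%N &
  (exists f : {ffun 'I_k -> 'I_n},
    \forall x \near x0^', \det (colsub f (prefix_mx k (v^~ x))) != 0) /\
  (\forall x \near x0^', ~ indep k.+1 (v^~ x)).
Proof.
pose P k := exists f : {ffun 'I_k -> 'I_n},
    \forall x \near x0^', \det (colsub f (prefix_mx k (v^~ x))) != 0.
have P0 : P 0.
  exists (ffun0 (card_ord 0)).
  by near=> x; rewrite det_mx00 oner_eq0.
have Pn : ~ P n.+1.
  move=> [f hf]; have [x hx] := @filter_ex _ _ _ _ hf.
  apply: (@indep_bound _ n (v^~ x)); apply/indep_row_free/unit_minor; by exists f.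
have [k kn [Pk nPk]] : exists2 k, (k <= n)%N & P k /\ ~ P k.+1.
  apply: contrapT => h.
  have {}h k : (k <= n)%N -> P k -> P k.+1.
    by move=> kn Pk; apply: contrapT => nPk; apply: h; exists k.
  (* The induction on m <= n proves P (m + 1); the bound n stays fixed. *)
  apply: Pn; have : (n <= n)%N by []; elim: {1 3}n => [_|m IH mn]; first exact: h.
  by apply: h => //; apply: IH; exact: ltnW.
exists k => //; split=> //.
by case: (minor_dichotomy k.+1).
Unshelve. all: by end_near. Qed.

Lemma cder_sum (I : Type) (r : seq I) (f : I -> C -> C) (l : I -> C) x :
  (forall i, is_derive x (1 : C) (f i) (l i)) ->
  is_derive x (1 : C) (fun y => \sum_(i <- r) f i y) (\sum_(i <- r) l i).
Proof.
move=> h; elim: r => [|i r IH].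
  rewrite big_nil; apply: cder_near (cder_cst 0 x); near=> y; by rewrite big_nil.
rewrite big_cons; apply: cder_near (cderD (h i) IH); near=> y; by rewrite big_cons.
Unshelve. all: by end_near. Qed.

Variable Z : C -> C.
Hypothesis Z_pmero : pmero Z x0.

Definition dz f : C -> C := fun x => derive1 f x / derive1 Z x.

Lemma pmero_dz f : pmero f x0 -> pmero (dz f) x0.
Proof. by move=> hf; apply: pmeroM; [exact: pmero_derive1|exact/pmeroV/pmero_derive1]. Qed.

Hypothesis v_dz : forall m x i, v m.+1 x 0 i = dz (fun y => v m y 0 i) x.

Section Span.
Variable k : nat.

Definition in_span (u : C -> 'rV[C]_n) := exists2 c : nat -> C -> C,
  (forall j, pmero (c j) x0) &
  \forall x \near x0^', u x = \sum_(j < k) c j x *: v j x.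

Lemma in_span_eq u u' : (\forall x \near x0^', u x = u' x) -> in_span u -> in_span u'.
Proof.
move=> uu [c hc uE]; exists c => //; near=> x.
have <- : u x = u' x by near: x.
by near: x.
Unshelve. all: by end_near. Qed.

Lemma in_spanD u u' : in_span u -> in_span u' -> in_span (fun x => u x + u' x).
Proof.
move=> [c hc uE] [c' hc' uE']; exists (fun j x => c j x + c' j x).
  by move=> j; apply: pmeroD; [exact: hc|exact: hc'].
near=> x.
have -> : u x = \sum_(j < k) c j x *: v j x by near: x.
have -> : u' x = \sum_(j < k) c' j x *: v j x by near: x.
by rewrite -big_split; apply: eq_bigr => j _; rewrite scalerDl.
Unshelve. all: by end_near. Qed.

Lemma in_spanZ f u : pmero f x0 -> in_span u -> in_span (fun x => f x *: u x).
Proof.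
move=> hf [c hc uE]; exists (fun j x => f x * c j x).
  by move=> j; apply: pmeroM; [exact: hf|exact: hc].
near=> x.
have -> : u x = \sum_(j < k) c j x *: v j x by near: x.
by rewrite scaler_sumr; apply: eq_bigr => j _; rewrite scalerA.
Unshelve. all: by end_near. Qed.

Lemma in_span_sum (I : Type) (r : seq I) (u : I -> C -> 'rV[C]_n) :
  (forall i, in_span (u i)) -> in_span (fun x => \sum_(i <- r) u i x).
Proof.
move=> h; elim: r => [|i r IH].
  exists (fun _ _ => 0); first by move=> j; exact: pmero_cst.
  near=> x; rewrite big_nil big1 // => j _; by rewrite scale0r.
by apply: in_span_eq (in_spanD (h i) IH); near=> x; rewrite big_cons.
Unshelve. all: by end_near. Qed.

Lemma in_span_v j : (j < k)%N -> in_span (v j).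
Proof.
move=> jk; exists (fun i _ => (i == j)%:R); first by move=> i; exact: pmero_cst.
near=> x; rewrite (bigD1 (Ordinal jk)) //= eqxx scale1r big1 ?addr0 // => i ij.
by rewrite -[(i : nat) == j]/(i == Ordinal jk) (negbTE ij) scale0r.
Unshelve. all: by end_near. Qed.

(** By Leibniz, D of a combination of v 0, ..., v (k - 1) involves these vectors and their
    successors, of which only v k is new; it lies in the span by hypothesis. *)
Lemma in_span_step m : in_span (v k) -> in_span (v m) -> in_span (v m.+1).
Proof.
move=> hk [c hc mE].
have v1 (j : 'I_k) : in_span (v j.+1).
  by have := ltn_ord j; rewrite leq_eqVlt => /predU1P[->//|]; exact: in_span_v.
apply: (@in_span_eq (fun x => \sum_(j < k) (c j x *: v j.+1 x + dz (c j) x *: v j x))); last first.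
  apply: in_span_sum => j; apply: in_spanD; apply: in_spanZ.
  - exact: hc.
  - exact: v1.
  - exact/pmero_dz.
  - exact: in_span_v.
have mE2 := dnbhs_interior mE.
have holc : \forall x \near x0^', forall j : 'I_k, holomorphic_at (c j) x.
  by apply: filter_forall => j; exact/pmero_hol_near.
have holv : \forall x \near x0^', forall (j : 'I_k) i, holomorphic_at (fun y => v j y 0 i) x.
  by apply: filter_forall => j; apply: filter_forall => i; exact/pmero_hol_near.
near=> x; apply/rowP => i; rewrite v_dz /dz.
have hcx : forall j : 'I_k, holomorphic_at (c j) x by near: x.
have hvx : forall (j : 'I_k) i, holomorphic_at (fun y => v j y 0 i) x by near: x.
have E : \forall y \near x, v m y = \sum_(j < k) c j y *: v j y by near: x.
have d (j : 'I_k) : is_derive x (1 : C) (fun y => c j y * v j y 0 i)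
    (c j x * derive1 (fun y => v j y 0 i) x + derive1 (c j) x * v j x 0 i).
  by apply: cderM; apply: hol_cder; [exact: hcx|exact: hvx].
have -> : derive1 (fun y => v m y 0 i) x = \sum_(j < k)
    (c j x * derive1 (fun y => v j y 0 i) x + derive1 (c j) x * v j x 0 i).
  rewrite -(cder1 (cder_sum _ d)); apply: derive1_near.
  by near=> y; rewrite (near E y) // summxE; apply: eq_bigr => j _; rewrite mxE.
rewrite summxE mulr_suml; apply: eq_bigr => j _.
by rewrite !mxE v_dz /dz mulrDl; congr (_ + _); [exact: mulrA|exact: mulrAC].
Unshelve. all: by end_near. Qed.

End Span.

Lemma coef_pmero : exists2 c : nat -> C -> C, (forall j, pmero (c j) x0) &
  \forall x \near x0^', coef (v^~ x) = c^~ x /\ coef_spec (v^~ x) (c^~ x).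
Proof.
have [k kn [[f hf] hk]] := generic_rank.
pose N x := colsub f (prefix_mx k (v^~ x)).
(* Cramer's rule with a minor that does not vanish off the centre, which makes the coefficients
   meromorphic; the value 0 for j >= k never enters a sum. *)
pose c0 j x : C := if insub j is Some j' then
  \sum_i v k x 0 (f i) * ((\det (N x))^-1 * \adj (N x) i j') else 0.
have c0_pmero j : pmero (c0 j) x0.
  rewrite /c0; case: insubP => [j' _ _|_]; last exact: pmero_cst.
  apply: pmero_sum => i _; apply: pmeroM; first exact: v_pmero.
  apply: pmeroM; first by apply/pmeroV/pmero_det => a b; exact: prefix_minor_pmero.
  by apply: pmero_adj => a b; exact: prefix_minor_pmero.
have ik : \forall x \near x0^', indep k (v^~ x).
  near=> x; apply/indep_row_free/unit_minor; exists f; near: x; exact: hf.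
have sk : in_span k (v k).
  exists c0 => //; near=> x.
  have ikx : indep k (v^~ x) by near: x.
  have nkx : ~ indep k.+1 (v^~ x) by near: x.
  have dx : \det (N x) != 0 by near: x.
  have [b hb] := indep_span ikx nkx.
  transitivity (\sum_(j < k) b j *: v j x); first exact: hb.
  apply: eq_bigr => j _; rewrite (cramer_minor hb dx j).
  by rewrite /c0 valK.
have sp d : in_span k (v (k + d)%N).
  by elim: d => [|d IH]; [rewrite addn0|rewrite addnS; exact: in_span_step].
have [c hc cE] := sp (n - k)%N; rewrite subnKC // in cE.
(* Coefficients from k on are cut to 0, as [coef_spec] requires. *)
exists (fun j x => if (j < k)%N then c j x else 0).
  by move=> j; case: (j < k)%N; [exact: hc|exact: pmero_cst].
near=> x.
suff h : coef_spec (v^~ x) (fun j => if (j < k)%N then c j x else 0) by split=> //; exact: coef_eq.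
exists k => //; split.
- by near: x.
- by near: x.
- by move=> j; rewrite ltnNge => ->.
- have -> : v n x = \sum_(j < k) c j x *: v j x by near: x.
  by apply: eq_bigr => j _; rewrite ltn_ord.
Unshelve. all: by end_near. Qed.

End RecurrenceGerms.

(** * Changes of variable and the symplectic action *)

Section Transport.
Variable R : realType.
Local Notation C := (Cx R).
Implicit Types (f g h Z : C -> C) (x y : C).

#[local] Opaque holomorphic_at.

Lemma dnbhs_imp2 x (P Q S : C -> Prop) : (forall y, P y -> Q y -> S y) ->
  (\forall y \near x^', P y) -> (\forall y \near x^', Q y) -> \forall y \near x^', S y.
Proof. by move=> h p q; near=> y; apply: h; near: y. Unshelve. all: by end_near. Qed.

Lemma dz_dnear Z f g x : (\forall y \near x^', f y = g y) ->
  \forall y \near x^', dz Z f y = dz Z g y.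
Proof.
move=> fg; have fg' := derive1_dnear fg; near=> y.
have E : derive1 f y = derive1 g y by near: y; exact: fg'.
by rewrite /dz E.
Unshelve. all: by end_near. Qed.

Lemma pmero_iter_dz Z f m x : pmero Z x -> pmero f x -> pmero (iter m (dz Z) f) x.
Proof. by move=> hZ hf; elim: m => [|m IH]; [exact: hf|exact: pmero_dz]. Qed.

(** Functions that agree on an open disc have derivatives that agree on the same disc. One disc thus
    serves for all m, which allows the quantifier on m inside [near]. *)
Lemma iter_dz_near Z Z' f f' x :
  (\forall y \near x, Z y = Z' y) -> (\forall y \near x, f y = f' y) ->
  \forall y \near x, forall m, iter m (dz Z) f y = iter m (dz Z') f' y.
Proof.
move=> hZ hf.
have : \forall y \near x, Z y = Z' y /\ f y = f' y by near=> y; split; near: y.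
move=> /nbhsCP[r r0 hr]; apply/nbhsCP; exists r; [exact: r0|move=> y yr m].
elim: m y yr => [|m IH] y yr; first by have [] := hr _ yr.
have nr : \forall u \near y, nm (u - x) < r.
  apply/nbhsCP; exists (r - nm (y - x)); first by rewrite subr_gt0.
  by move=> u hu; apply: le_lt_trans (nmBD _ _ y) _; rewrite -ltrBrDr.
have E1 : derive1 (iter m (dz Z) f) y = derive1 (iter m (dz Z') f') y.
  by apply: derive1_near; near=> u; apply: IH; near: u.
have E2 : derive1 Z y = derive1 Z' y.
  apply: derive1_near; near=> u; have ur : nm (u - x) < r by near: u.
  by have [] := hr _ ur.
exact: (congr2 (fun a b => a / b) E1 E2).
Unshelve. all: by end_near. Qed.

Lemma iter_dz_lincomb (I : finType) Z (c : I -> C) (f : I -> C -> C) m x : pmero Z x ->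
  (forall i, pmero (f i) x) ->
  \forall y \near x^', iter m (dz Z) (fun u => \sum_i c i * f i u) y =
    \sum_i c i * iter m (dz Z) (f i) y.
Proof.
move=> hZ hf; elim: m => [|m IH]; first by near=> y; reflexivity.
have hol : \forall y \near x^', forall i, holomorphic_at (iter m (dz Z) (f i)) y.
  by apply: filter_forall => i; exact: pmero_hol_near (pmero_iter_dz m hZ (hf i)).
have IH2 := dz_dnear Z IH.
refine (dnbhs_imp2 _ IH2 hol); move=> y e hy; apply: (etrans e).
have d i : is_derive y (1 : C) (fun u => c i * iter m (dz Z) (f i) u)
    (c i * derive1 (iter m (dz Z) (f i)) y + 0 * iter m (dz Z) (f i) y).
  exact: (cderM (cder_cst (c i) y) (hol_cder (hy i))).
rewrite {1}/dz (cder1 (cder_sum _ d)) mulr_suml; apply: eq_bigr => i _.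
by rewrite mul0r addr0 -mulrA.
Unshelve. all: by end_near. Qed.

Lemma divr_mul2r (a b c : C) : c != 0 -> (a * c) / (b * c) = a / b.
Proof. by move=> c0; rewrite -mulf_div divff // mulr1. Qed.

(** The properties of [h] by which derivation with respect to [Z1] of f o h becomes derivation of
    [f] with respect to [Z2], on punctured discs. Both the parametrization by z and the action of a
    group element have them. The third property says that punctured germs can be pulled back. *)
Record local_change h Z1 Z2 x0 : Prop := LocalChange {
  change_cder : \forall x \near x0, derivable h x (1 : C);
  change_neq0 : \forall x \near x0, derive1 h x != 0;
  change_dnbhs : forall P : C -> Prop, (\forall y \near (h x0)^', P y) -> \forall x \near x0^', P (h x);
  change_compat : \forall x \near x0, Z2 (h x) = Z1 x }.

Lemma dz_comp h Z1 Z2 x0 f : local_change h Z1 Z2 x0 -> pmero Z2 (h x0) -> pmero f (h x0) ->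
  \forall x \near x0^', dz Z1 (fun u => f (h u)) x = dz Z2 f (h x).
Proof.
move=> [hd h0 hP hZ] mZ mf.
have f1 := hP _ (pmero_hol_near mf); have f2 := hP _ (pmero_hol_near mZ).
have hd' := near_dnbhs hd; have h0' := near_dnbhs h0.
have hZ' := dnbhs_interior (near_dnbhs hZ).
near=> x.
have hx : derivable h x (1 : C) by near: x; exact: hd'.
have hx0 : derive1 h x != 0 by near: x; exact: h0'.
have [fx Zx] : holomorphic_at f (h x) /\ holomorphic_at Z2 (h x).
  by near: x; exact: filterI f1 f2.
have ZE : \forall u \near x, Z2 (h u) = Z1 u by near: x; exact: hZ'.
have hx' := cder_derive1 hx.
have e1 : derive1 (fun u => f (h u)) x = derive1 f (h x) * derive1 h x.
  exact: cder1 (cder_comp hx' (hol_cder fx)).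
have e2 : derive1 Z1 x = derive1 Z2 (h x) * derive1 h x.
  by rewrite -(derive1_near ZE); exact: cder1 (cder_comp hx' (hol_cder Zx)).
rewrite /dz e1 e2; exact: divr_mul2r.
Unshelve. all: by end_near. Qed.

Lemma iter_dz_comp h Z1 Z2 x0 f m : local_change h Z1 Z2 x0 -> pmero Z2 (h x0) -> pmero f (h x0) ->
  \forall x \near x0^', iter m (dz Z1) (fun u => f (h u)) x = iter m (dz Z2) f (h x).
Proof.
move=> hc mZ mf; elim: m => [|m IH]; first by near=> x; reflexivity.
have E := dz_comp hc mZ (pmero_iter_dz m mZ mf).
have IH2 := dz_dnear Z1 IH.
by refine (dnbhs_imp2 _ IH2 E); move=> x e1 e2; exact: (etrans e1 e2).
Unshelve. all: by end_near. Qed.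

Lemma dnbhs_comp h x0 (P : C -> Prop) : h @ x0 --> h x0 ->
  (\forall x \near x0^', h x != h x0) ->
  (\forall y \near (h x0)^', P y) -> \forall x \near x0^', P (h x).
Proof.
move=> hc hn hP; have hP' : \forall y \near h x0, y != h x0 -> P y by exact: hP.
have := near_dnbhs (hc _ hP'); move=> {}hP'.
by near=> x; have : h x != h x0 -> P (h x); [near: x|apply; near: x].
Unshelve. all: by end_near. Qed.

(** Transport in both directions is essential: the value 0 at a pole is preserved only if the
    absence of a limit on either side implies it on the other. *)
Lemma plim_comp (h k f g : C -> C) x0 : 
  (forall P : C -> Prop, (\forall y \near (h x0)^', P y) -> \forall x \near x0^', P (h x)) ->
  (forall P : C -> Prop, (\forall x \near x0^', P x) -> \forall y \near (h x0)^', P (k y)) ->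
  (\forall x \near x0^', f x = g (h x)) -> (\forall y \near (h x0)^', g y = f (k y)) ->
  plim f x0 = plim g (h x0).
Proof.
move=> hP kP fg gf; rewrite [RHS]/plim; case: asboolP => [/cvg_ex[l gl]|ncv].
  have fl : f @ x0^' --> l.
    move=> Q Ql; have gQ : \forall y \near (h x0)^', Q (g y) by exact: gl.
    have := hP _ gQ; move=> {}gQ; change (\forall x \near x0^', Q (f x)).
    by near=> x; rewrite (near fg x)//; near: x.
  by rewrite (plim_cvg fl); apply/esym; exact: cvg_lim gl.
rewrite /plim; case: asboolP => [/cvg_ex[l fl]|_]; last reflexivity.
exfalso; apply: ncv; apply/cvg_ex; exists l => Q Ql.
have fQ : \forall x \near x0^', Q (f x) by exact: fl.
have := kP _ fQ; move=> {}fQ; change (\forall y \near (h x0)^', Q (g y)).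
by near=> y; rewrite (near gf y)//; near: y.
Unshelve. all: by end_near. Qed.

Lemma hol_sum (I : Type) (r : seq I) (P : pred I) (F : I -> C -> C) a :
  (forall i, P i -> holomorphic_at (F i) a) ->
  holomorphic_at (fun x => \sum_(i <- r | P i) F i x) a.
Proof.
move=> h; elim: r => [|i r IH].
  by apply: hol_near_eq (hol_cst 0 a); near=> x; rewrite big_nil.
case Pi : (P i).
  by apply: hol_near_eq (holD (h i Pi) IH); near=> x; rewrite big_cons Pi.
by apply: hol_near_eq IH; near=> x; rewrite big_cons Pi.
Unshelve. all: by end_near. Qed.

(** Ordinary differentiation is the case of the identity, which lets the passage to the variable z
    be treated as a [local_change]. *)
Lemma derive1n_iter f m : derive1n m f = iter m (dz (fun x => x)) f.
Proof.
elim: m => [|m IH]; first reflexivity.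
rewrite derive1nS IH /=; apply/funext => x.
have e : derive1 (fun y : C => y) x = 1 := cder1 (cder_id x).
exact: (esym (etrans (congr1 (fun a => _ / a) e) (divr1 _))).
Qed.

Lemma hol_derive1n f m a : holomorphic_at f a -> holomorphic_at (derive1n m f) a.
Proof. by move=> hf; elim: m => [|m IH]; [exact: hf|rewrite derive1nS; exact: hol_derive1]. Qed.

Lemma meromorphic_near_eq f g a : (\forall x \near a, f x = g x) ->
  meromorphic_at f a -> meromorphic_at g a.
Proof.
move=> fg [hf|[m [k [hk ka fk]]]]; [left; exact: hol_near_eq hf|right].
exists m, k; split; [exact: hk|exact: ka|].
by near=> x; rewrite -(near fg x)//; near: x.
Unshelve. all: by end_near. Qed.

End Transport.

(** * The symplectic action in Plücker coordinates *)

Section SymplecticAction.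
Variable R : realType.
Local Notation C := (Cx R).
Implicit Types (g : 'M[R]_(2 + 2)) (T X Y : 'M[C]_2).

(** As J^2 = -1, the relation g^T J g = J exhibits - J g^T J as a left inverse of g. *)
Lemma Sp4_unit g : Sp4 g -> g \in unitmx.
Proof.
move=> hg; have J2 : @sympl_form R *m @sympl_form R = - 1%:M.
  rewrite /sympl_form mulmx_block !mulmx0 !mul0mx !mulmx1 !mul1mx !add0r !addr0.
  by rewrite [1%:M in RHS](scalar_mx_block 2 2) opp_block_mx !oppr0.
have : (- (@sympl_form R *m g^T *m @sympl_form R)) *m g = 1%:M.
  have hg' : g^T *m @sympl_form R *m g = @sympl_form R by [].
  by rewrite mulNmx -!mulmxA [g^T *m _]mulmxA hg' J2 opprK.
by move=> /mulmx1_unit[].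
Qed.

Lemma det2 (K : comNzRingType) (M : 'M[K]_2) : \det M = M 0 0 * M 1 1 - M 0 1 * M 1 0.
Proof.
rewrite (expand_det_row _ 0) !big_ord_recl big_ord0 /cofactor !det_mx11 !mxE /=.
rewrite addr0 expr0 expr1 !mul1r mulN1r mulrN.
by congr (_ * M _ _ - M _ _ * M _ _); apply/val_inj.
Qed.

Lemma affine2E X T Y i j : (X *m T + Y) i j = X i 0 * T 0 j + X i 1 * T 1 j + Y i j.
Proof.
rewrite !mxE !big_ord_recl big_ord0 addr0; congr (_ + X i _ * T _ j + _).
  by apply/val_inj.
by apply/val_inj.
Qed.

Definition numer g T : 'M[C]_2 := ulsubmx (complexify g) *m T + ursubmx (complexify g).

Lemma act_denom g T : denom g T \in unitmx -> act g T *m denom g T = numer g T.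
Proof. by move=> u; rewrite /act mulmxKV. Qed.

(** Cramer's rule for a d = n, together with the multiplicativity of the determinant. With det d
    itself, the right-hand sides are the six 2 x 2 minors of the matrix formed by n above d. *)
Lemma act_entries g T : denom g T \in unitmx ->
  let a := act g T in let n := numer g T in let d := denom g T in
  [/\ a 0 0 * \det d = n 0 0 * d 1 1 - n 0 1 * d 1 0,
      a 0 1 * \det d = d 0 0 * n 0 1 - d 0 1 * n 0 0,
      a 1 0 * \det d = n 1 0 * d 1 1 - n 1 1 * d 1 0,
      a 1 1 * \det d = d 0 0 * n 1 1 - d 0 1 * n 1 0 &
      (a 0 0 * a 1 1 - a 0 1 * a 1 0) * \det d = n 0 0 * n 1 1 - n 0 1 * n 1 0].
Proof.
move=> /act_denom E a n d; rewrite -/a -/n -/d in E.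
have F i j : n i j = a i 0 * d 0 j + a i 1 * d 1 j.
  have := affine2E a d 0 i j; rewrite addr0 E => ->.
  by rewrite [X in _ + X]mxE addr0.
by rewrite !F det2; split; ring.
Qed.

(** Up to sign and order these are the Plücker coordinates of the plane spanned by the columns of
    (T, 1)^t. For symmetric [T] two of the six coincide up to sign, which is why there are five
    functions. *)
Definition phi (i : nat) T : C :=
  [:: 1; T 0 0; T 0 1; T 1 1; T 0 0 * T 1 1 - T 0 1 ^+ 2]`_i.

(* By the symmetry of T, the terms of degree 2 add up to a multiple of det T. *)
Lemma minor_lincomb (x0 x1 y0 y1 x0' x1' y0' y1' : C) :
  exists c : 'I_5 -> C, forall T, T 1 0 = T 0 1 ->
  (x0 * T 0 0 + x1 * T 1 0 + y0) * (x0' * T 0 1 + x1' * T 1 1 + y1') -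
  (x0 * T 0 1 + x1 * T 1 1 + y1) * (x0' * T 0 0 + x1' * T 1 0 + y0') =
  \sum_(j < 5) c j * phi j T.
Proof.
exists (fun j : 'I_5 => [:: y0 * y1' - y1 * y0'; x0 * y1' - y1 * x0';
   x1 * y1' + y0 * x0' - x0 * y0' - y1 * x1'; y0 * x1' - x1 * y0';
   x0 * x1' - x1 * x0']`_j) => T TE.
by rewrite !big_ord_recl big_ord0 /phi /= TE; ring.
Qed.

(** Every left-hand side is a minor by [act_entries], hence linear in [phi] by [minor_lincomb]. The
    matrix depends on [g] alone, so it is constant along the curve. *)
Lemma act_lincomb g : exists M : 'M[C]_5, forall T, T 1 0 = T 0 1 ->
  denom g T \in unitmx -> act g T 1 0 = act g T 0 1 ->
  forall i : 'I_5, \det (denom g T) * phi i (act g T) = \sum_(j < 5) M i j * phi j T.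
Proof.
pose G := complexify g.
pose nl i j := ulsubmx G i j; pose nr i j := ursubmx G i j.
pose dl i j := dlsubmx G i j; pose dr i j := drsubmx G i j.
have nE T i j : numer g T i j = nl i 0 * T 0 j + nl i 1 * T 1 j + nr i j by rewrite /numer affine2E.
have dE T i j : denom g T i j = dl i 0 * T 0 j + dl i 1 * T 1 j + dr i j by rewrite /denom affine2E.
have H (i : 'I_5) : exists c : 'I_5 -> C, forall T, T 1 0 = T 0 1 ->
    denom g T \in unitmx -> act g T 1 0 = act g T 0 1 ->
    \det (denom g T) * phi i (act g T) = \sum_(j < 5) c j * phi j T.
  case: i => [[|[|[|[|[|//]]]]] i5].
  - have [c hc] := minor_lincomb (dl 0 0) (dl 0 1) (dr 0 0) (dr 0 1) (dl 1 0) (dl 1 1) (dr 1 0) (dr 1 1).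
    by exists c => T TE u aE; rewrite -hc // -!dE -det2 /phi /= mulr1.
  - have [c hc] := minor_lincomb (nl 0 0) (nl 0 1) (nr 0 0) (nr 0 1) (dl 1 0) (dl 1 1) (dr 1 0) (dr 1 1).
    by exists c => T TE u aE; have [e _ _ _ _] := act_entries u; rewrite -hc // -!dE -!nE /phi /= mulrC.
  - have [c hc] := minor_lincomb (dl 0 0) (dl 0 1) (dr 0 0) (dr 0 1) (nl 0 0) (nl 0 1) (nr 0 0) (nr 0 1).
    by exists c => T TE u aE; have [_ e _ _ _] := act_entries u; rewrite -hc // -!dE -!nE /phi /= mulrC.
  - have [c hc] := minor_lincomb (dl 0 0) (dl 0 1) (dr 0 0) (dr 0 1) (nl 1 0) (nl 1 1) (nr 1 0) (nr 1 1).
    by exists c => T TE u aE; have [_ _ _ e _] := act_entries u; rewrite -hc // -!dE -!nE /phi /= mulrC.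
  - have [c hc] := minor_lincomb (nl 0 0) (nl 0 1) (nr 0 0) (nr 0 1) (nl 1 0) (nl 1 1) (nr 1 0) (nr 1 1).
    exists c => T TE u aE; have [_ _ _ _ e] := act_entries u.
    by rewrite -hc // -!nE /phi /= mulrC expr2 -{2}aE.
have [c hc] := choice H.
by exists (\matrix_(i, j) c i j) => T TE u aE i; rewrite hc //; apply: eq_bigr => j _; rewrite mxE.
Qed.

Lemma act_hol g (B : C -> 'M[C]_2) x : (forall i j, holomorphic_at (fun y => B y i j) x) ->
  (\forall y \near x, denom g (B y) \in unitmx) ->
  forall i j, holomorphic_at (fun y => act g (B y) i j) x.
Proof.
move=> hB hu; have ux := nbhs_singleton hu.
have aff (X Y : 'M[C]_2) i j : holomorphic_at (fun y => (X *m B y + Y) i j) x.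
  apply: (@hol_near_eq _ (fun y => X i 0 * B y 0 j + X i 1 * B y 1 j + Y i j)).
    by near=> y; rewrite affine2E.
  apply: holD; last exact: hol_cst.
  by apply: holD; apply: holM; [exact: hol_cst|exact: hB|exact: hol_cst|exact: hB].
have hn i j : holomorphic_at (fun y => numer g (B y) i j) x by exact: aff.
have hd i j : holomorphic_at (fun y => denom g (B y) i j) x by exact: aff.
have hdet : holomorphic_at (fun y => \det (denom g (B y))) x.
  apply: (@hol_near_eq _ (fun y => denom g (B y) 0 0 * denom g (B y) 1 1 - denom g (B y) 0 1 * denom g (B y) 1 0)).
    by near=> y; rewrite det2.
  by apply: holB; apply: holM; exact: hd.
have dx : \det (denom g (B x)) != 0 by rewrite -unitfE -unitmxE.
have key (e : C -> C) i j : holomorphic_at e x ->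
    (forall y, denom g (B y) \in unitmx -> act g (B y) i j * \det (denom g (B y)) = e y) ->
    holomorphic_at (fun y => act g (B y) i j) x.
  move=> he E; apply: (@hol_near_eq _ (fun y => e y * (\det (denom g (B y)))^-1)).
    near=> y; have uy : denom g (B y) \in unitmx by near: y.
    by rewrite -E // mulfK // -unitfE -unitmxE.
  by apply: holM; [exact: he|exact: holV].
have hh (a b c d : C -> C) : holomorphic_at a x -> holomorphic_at b x -> holomorphic_at c x ->
   holomorphic_at d x -> holomorphic_at (fun y => a y * b y - c y * d y) x.
  by move=> ha hb hc hd'; apply: holB; apply: holM.
move=> i j; have [-> | ->] := ord2P i; have [-> | ->] := ord2P j.
- apply: key (hh _ _ _ _ (hn 0 0) (hd 1 1) (hn 0 1) (hd 1 0)) _.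
  by move=> y /act_entries[].
- apply: key (hh _ _ _ _ (hd 0 0) (hn 0 1) (hd 0 1) (hn 0 0)) _.
  by move=> y /act_entries[].
- apply: key (hh _ _ _ _ (hn 1 0) (hd 1 1) (hn 1 1) (hd 1 0)) _.
  by move=> y /act_entries[].
- apply: key (hh _ _ _ _ (hd 0 0) (hn 1 1) (hd 0 1) (hn 1 0)) _.
  by move=> y /act_entries[].
Unshelve. all: by end_near. Qed.

End SymplecticAction.

(** * The differential equation *)

Section ODE.
Variables (R : realType) (H : set (Cx R)) (t : Cx R -> Cx R)
  (c1 c2 : Cx R) (z w : 'M[Cx R]_2 -> Cx R).
Local Notation C := (Cx R).
Local Notation D := (regular_part H t).
Local Notation curve := (curve H t c1 c2).
Local Notation branch := (branch H t c1 c2).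
Hypotheses (oH : open H) (hc1 : D c1) (hc2 : D c2).
Hypotheses (hz : meromorphic_on_curve H t c1 c2 z) (hw : meromorphic_on_curve H t c1 c2 w).
Implicit Types (T : 'M[C]_2) (x y u : C) (U V : set C) (B : C -> 'M[C]_2).

#[local] Opaque holomorphic_at.

Definition sol (i : nat) T : C := phi i T * w T.

Lemma solE i T : sol i T = phi i T * w T. Proof. by []. Qed.

Definition jet B m x : 'rV[C]_5 :=
  \row_i iter m (dz (fun y => z (B y))) (fun y => sol i (B y)) x.

(** The sign moves the recurrence to the left-hand side of the monic equation. *)
Definition ode_coef B x (j : nat) : C := - coef (fun m => jet B m x) j.

(** An arbitrary choice of a branch through [T]; that it does not affect the coefficients is shown
    in [coef_on_branch]. *)
Definition germ_at T : C -> 'M[C]_2 :=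
  xget (fun=> 0) [set B | exists U, [/\ branch U B, U (T 0 0) & B (T 0 0) = T]].

Definition coef_on_curve (j : nat) T : C :=
  if `[< curve T >] then plim (fun y => ode_coef (germ_at T) y j) (T 0 0) else 0.

Lemma branch_pmero_z U B x : branch U B -> U x -> pmero (fun y => z (B y)) x.
Proof. by move=> hB Ux; exact: meromorphic_pmero (hz hB Ux). Qed.

Lemma branch_hol_phi U B x i : branch U B -> U x -> holomorphic_at (fun y => phi i (B y)) x.
Proof.
move=> hB Ux; have h := branch_hol hB Ux; rewrite /phi.
case: i => [|[|[|[|[|i]]]]] /=.
- exact: hol_cst.
- exact: h.
- exact: h.
- exact: h.
- by apply: holB; [apply: holM; exact: h|apply: holX; exact: h].
- by rewrite nth_nil; exact: hol_cst.
Qed.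

Lemma branch_pmero_sol U B x i : branch U B -> U x -> pmero (fun y => sol i (B y)) x.
Proof.
move=> hB Ux; apply: pmeroM; first exact: hol_pmero (branch_hol_phi i hB Ux).
exact: meromorphic_pmero (hw hB Ux).
Qed.

Lemma jetE B m x (i : 'I_5) :
  jet B m x 0 i = iter m (dz (fun y => z (B y))) (fun y => sol i (B y)) x.
Proof. by rewrite mxE. Qed.

Lemma jet_funE B m (i : 'I_5) : (fun x => jet B m x 0 i) =
  iter m (dz (fun y => z (B y))) (fun y => sol i (B y)).
Proof. by apply/funext => x; rewrite jetE. Qed.

Lemma jet_pmero U B x : branch U B -> U x -> forall m i, pmero (fun y => jet B m y 0 i) x.
Proof.
move=> hB Ux m i; rewrite jet_funE; apply: pmero_iter_dz.
  exact: branch_pmero_z hB Ux.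
exact: branch_pmero_sol hB Ux.
Qed.

Lemma jet_dz B m x i : jet B m.+1 x 0 i = dz (fun y => z (B y)) (fun y => jet B m y 0 i) x.
Proof. by rewrite jet_funE jetE. Qed.

Lemma branch_coef U B x : branch U B -> U x ->
  exists2 c : nat -> C -> C, (forall j, pmero (c j) x) &
  \forall y \near x^', coef (fun m => jet B m y) = c^~ y /\ coef_spec (fun m => jet B m y) (c^~ y).
Proof.
move=> hB Ux; exact: (coef_pmero (jet_pmero hB Ux) (branch_pmero_z hB Ux) (@jet_dz B)).
Qed.

Lemma ode_coef_pmero U B x j : branch U B -> U x -> pmero (fun y => ode_coef B y j) x.
Proof.
move=> hB Ux; have [c hc cE] := branch_coef hB Ux.
refine (@pmero_eq _ _ _ _ _ (pmeroN (hc j))); near=> y.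
have [E _] : coef (fun m => jet B m y) = c^~ y /\ coef_spec (fun m => jet B m y) (c^~ y) by near: y.
by rewrite /ode_coef E.
Unshelve. all: by end_near. Qed.

Lemma branch_ode U B x : branch U B -> U x -> \forall y \near x^', forall i : 'I_5,
  iter 5 (dz (fun y => z (B y))) (fun y => sol i (B y)) y +
  \sum_(j < 5) ode_coef B y j * iter j (dz (fun y => z (B y))) (fun y => sol i (B y)) y = 0.
Proof.
move=> hB Ux; have [c _ cE] := branch_coef hB Ux; near=> y => i.
have [E /coef_spec_sum S] : coef (fun m => jet B m y) = c^~ y /\ coef_spec (fun m => jet B m y) (c^~ y) by near: y.
have S5 : jet B 5 y = \sum_(j < 5) c j y *: jet B j y := S.
rewrite -(jetE B 5 y i) S5 summxE.
rewrite -big_split big1 // => j _.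
by rewrite /= mxE jetE /ode_coef E -mulrDl addrN mul0r.
Unshelve. all: by end_near. Qed.

Lemma germ_atP T : curve T -> exists U, [/\ branch U (germ_at T), U (T 0 0) & germ_at T (T 0 0) = T].
Proof.
move=> hT; have [U [B hB]] := curve_branch oH hT.
have := @xgetPex _ (fun=> 0) [set B | exists U, [/\ branch U B, U (T 0 0) & B (T 0 0) = T]].
by apply; exists B, U.
Qed.

(** By [branch_unique] the chosen branch agrees with [B] near [x]. All jets then agree on one disc,
    and so do the coefficients. *)
Lemma coef_on_branch U B x j : branch U B -> U x ->
  coef_on_curve j (B x) = plim (fun y => ode_coef B y j) x.
Proof.
move=> hB Ux; have hT := branch_curve hB Ux; rewrite /coef_on_curve (asboolT hT).
have [U' [hB' Ux' Bx']] := germ_atP hT; rewrite (branch00 hB Ux) in Ux' Bx' *.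
have BB := branch_unique oH hc1 hc2 hB' hB Ux' Ux Bx'.
apply: plim_eq.
have E (i : 'I_5) : \forall y \near x^', forall m,
    iter m (dz (fun y => z (germ_at (B x) y))) (fun y => sol i (germ_at (B x) y)) y =
    iter m (dz (fun y => z (B y))) (fun y => sol i (B y)) y.
  have e1 : \forall y \near x, z (germ_at (B x) y) = z (B y) by near=> y; rewrite (near BB y).
  have e2 : \forall y \near x, sol i (germ_at (B x) y) = sol i (B y).
    by near=> y; rewrite (near BB y).
  exact: near_dnbhs (iter_dz_near e1 e2).
have E' : \forall y \near x^', forall (i : 'I_5) m,
    iter m (dz (fun y => z (germ_at (B x) y))) (fun y => sol i (germ_at (B x) y)) y =
    iter m (dz (fun y => z (B y))) (fun y => sol i (B y)) y.
  by apply: filter_forall => i; exact: (E i).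
near=> y; have Ey : forall (i : 'I_5) m,
    iter m (dz (fun y => z (germ_at (B x) y))) (fun y => sol i (germ_at (B x) y)) y =
    iter m (dz (fun y => z (B y))) (fun y => sol i (B y)) y by near: y.
have J : (fun m => jet (germ_at (B x)) m y) = (fun m => jet B m y).
  by apply/funext => m; apply/rowP => i; exact: (etrans (jetE _ m y i) (etrans (Ey i m) (esym (jetE B m y i)))).
exact: (congr1 (fun v => - coef v j) J).
Unshelve. all: by end_near. Qed.

Lemma coef_on_curve_meromorphic j : meromorphic_on_curve H t c1 c2 (coef_on_curve j).
Proof.
move=> U B hB x Ux; have Un := branch_nbhs hB Ux.
apply: (meromorphic_near_eq _ (meromorphic_plim (ode_coef_pmero j hB Ux))).
by near=> y; apply/esym; apply: coef_on_branch hB _; near: y.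
Unshelve. all: by end_near. Qed.

(** * The equation in the variable z *)

Section Parametrization.
Variables (V : set C) (p : C -> 'M[C]_2) (U : set C) (B : C -> 'M[C]_2) (s : C -> C).
Hypotheses (oV : open V) (hB : branch U B) (hs : holomorphic_on V s)
  (sU : forall u, V u -> U (s u)) (pE : forall u, V u -> p u = B (s u))
  (zp : forall u, V u -> z (p u) = u).

Local Notation Z := (fun y => z (B y)).

Lemma param_nbhs u : V u -> \forall v \near u, V v.
Proof. by move=> Vu; exact: (open_nbhs_nbhs (conj oV Vu)). Qed.

Lemma param_Z u : V u -> Z (s u) = u.
Proof. by move=> Vu /=; rewrite -pE // zp. Qed.

Lemma param_inj u v : V u -> V v -> s u = s v -> u = v.
Proof. by move=> Vu Vv E; rewrite -(param_Z Vu) E param_Z. Qed.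

(** Since z inverts the parametrization, [s] is injective and a punctured disc avoids the value
    [s u]. *)
Lemma param_dneq u : V u -> \forall v \near u^', s v != s u.
Proof.
move=> Vu; have Vn := near_dnbhs (param_nbhs Vu); near=> v.
have vu : v != u by near: v; exact: dnbhs_neq.
have Vv : V v by near: v.
by apply: contraNneq vu => /(param_inj Vv Vu) ->.
Unshelve. all: by end_near. Qed.

Lemma param_dnbhs u (P : C -> Prop) : V u ->
  (\forall y \near (s u)^', P y) -> \forall v \near u^', P (s v).
Proof. by move=> Vu; apply: dnbhs_comp (param_dneq Vu); exact: hol_cont (hs Vu). Qed.

(* At a pole of Z the identity Z (s u) = u would force the nonvanishing
   numerator to vanish. *)
Lemma param_hol u : V u -> holomorphic_at Z (s u).
Proof.
move=> Vu; case: (hz hB (sU Vu)) => // [[m [g [hg g0 gE]]]]; exfalso.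
move/negP: g0; apply; apply/eqP.
have sc : s @ u --> s u by exact: hol_cont (hs Vu).
have Vn := near_dnbhs (param_nbhs Vu); have dn := param_dneq Vu.
have gE' := param_dnbhs Vu (near_dnbhs gE).
have h1 : (fun v => (s v - s u) ^+ m.+1 * v) @ u^' --> (s u - s u) ^+ m.+1 * u.
  apply: cvg_dnbhs; apply: hol_cont; apply: holM; last exact: hol_id.
  by apply: holX; apply: holB; [exact: hs|exact: hol_cst].
have h2 : (fun v => (s v - s u) ^+ m.+1 * v) @ u^' --> g (s u).
  apply: (@dnear_cvg _ (fun v => g (s v))); last first.
    exact: cvg_dnbhs (cvg_comp _ _ sc (hol_cont hg)).
  near=> v; have Vv : V v by near: v.
  have sv : s v != s u by near: v; exact: dn.
  have E : z (B (s v)) = g (s v) / (s v - s u) ^+ m.+1 by near: v; exact: gE'.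
  have Ev : v = g (s v) / (s v - s u) ^+ m.+1 by rewrite -E; exact/esym/param_Z.
  by rewrite [X in _ = _ * X]Ev mulrCA mulfV ?mulr1 // subr_exp_neq0.
by rewrite -(plim_cvg h2) (plim_cvg h1) subrr expr0n mul0r.
Unshelve. all: by end_near. Qed.

Lemma param_derive u : V u -> derive1 Z (s u) * derive1 s u = 1.
Proof.
move=> Vu; have d := cder_comp (hol_cder (hs Vu)) (hol_cder (param_hol Vu)).
have d' : is_derive u (1 : C) (fun v => z (B (s v))) 1.
  apply: cder_near (cder_id u); have Vn := param_nbhs Vu; near=> v.
  by apply/esym/param_Z; near: v.
exact: cder_unique d d'.
Unshelve. all: by end_near. Qed.

Lemma param_change u : V u -> local_change s (fun v => v) Z u.
Proof.
move=> Vu; have Vn := param_nbhs Vu; split.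
- by near=> v; apply: hol_derivable; apply: hs; near: v.
- near=> v; have Vv : V v by near: v.
  by have /eqP := param_derive Vv; apply: contraTneq => ->; rewrite mulr0 eq_sym oner_eq0.
- by move=> P; exact: param_dnbhs.
- by near=> v; apply: param_Z; near: v.
Unshelve. all: by end_near. Qed.

(** The left-hand side is holomorphic at [u], so it suffices that it vanishes on a punctured disc.
    The points where the recurrence fails, which may include [u], are thereby avoided. *)
Lemma param_ode (i : 'I_5) :
  (forall j : 'I_5, holomorphic_on V (fun u => coef_on_curve j (p u))) ->
  holomorphic_on V (fun u => sol i (p u)) -> forall u, V u ->
  derive1n 5 (fun v => sol i (p v)) u +
  \sum_(j < 5) coef_on_curve j (p u) * derive1n j (fun v => sol i (p v)) u = 0.
Proof.
move=> ha hf u Vu; have Vn := param_nbhs Vu; have Us := sU Vu.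
pose E v := derive1n 5 (fun v => sol i (p v)) v +
  \sum_(j < 5) coef_on_curve j (p v) * derive1n j (fun v => sol i (p v)) v.
have hE : holomorphic_at E u.
  apply: holD; first by apply: hol_derive1n; exact: hf.
  by apply: hol_sum => j _; apply: holM; [exact: ha|apply: hol_derive1n; exact: hf].
rewrite -/(E u) -(plim_hol hE) -[RHS](plim_hol (hol_cst 0 u)); apply: plim_eq.
have e1 := param_dnbhs Vu (branch_ode hB Us).
(* Off the centre [plim] returns the function itself, so the coefficients on the curve are those of
   the recurrence. *)
have e2 : \forall v \near u^', forall j : 'I_5,
    coef_on_curve j (p v) = ode_coef B (s v) j.
  apply: filter_forall => j.
  have h := param_dnbhs Vu (pmero_plim (ode_coef_pmero j hB Us)).
  have Vn' := near_dnbhs Vn; near=> v; have Vv : V v by near: v.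
  by rewrite pE // (coef_on_branch j hB (sU Vv)); near: v; exact: h.
(* The six orders of derivation 0, ..., 5 form a finite type, over which the filter commutes with
   the quantifier. *)
have e3 : \forall v \near u^', forall j : 'I_6,
    derive1n j (fun v => sol i (p v)) v = iter j (dz Z) (fun y => sol i (B y)) (s v).
  apply: filter_forall => j.
  have h := iter_dz_comp j (param_change Vu) (branch_pmero_z hB Us) (branch_pmero_sol i hB Us).
  have h' : \forall v \near u^', forall m, iter m (dz (fun x => x)) (fun v => sol i (p v)) v =
      iter m (dz (fun x => x)) (fun v => sol i (B (s v))) v.
    have e : \forall v \near u, sol i (p v) = sol i (B (s v)).
      by near=> v; rewrite pE //; near: v.
    have e' : \forall v \near u, v = v by near=> v.
    exact: near_dnbhs (iter_dz_near e' e).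
  refine (dnbhs_imp2 _ h' h); move=> v a b; rewrite derive1n_iter; exact: etrans (a j) b.
refine (dnbhs_imp2 _ e1 (filterI e2 e3)); move=> v a [b c].
rewrite -[RHS](a i) /E (c ord_max); congr (_ + _); apply: eq_bigr => j _.
by rewrite b (c (widen_ord (leqnSn 5) j)).
Unshelve. all: by end_near. Qed.

End Parametrization.

End ODE.

(** * Invariance of the coefficients *)

Section Invariance.
Variables (R : realType) (G : set 'M[R]_(2 + 2)) (H : set (Cx R)) (t : Cx R -> Cx R)
  (c1 c2 : Cx R) (z w : 'M[Cx R]_2 -> Cx R) (chi : 'M[R]_(2 + 2) -> Cx R).
Local Notation C := (Cx R).
Local Notation D := (regular_part H t).
Local Notation curve := (curve H t c1 c2).
Local Notation branch := (branch H t c1 c2).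
Hypotheses (oH : open H) (hc1 : D c1) (hc2 : D c2).
Hypotheses (hz : meromorphic_on_curve H t c1 c2 z) (hw : meromorphic_on_curve H t c1 c2 w).
Hypotheses (hG : discrete_subgroup_Sp4 G) (hact : acts_on G curve).
Hypotheses (hz_inv : forall g T, G g -> curve T -> z (act g T) = z T)
  (hw_inv : forall g T, G g -> curve T -> w (act g T) = chi g * \det (denom g T) * w T).
Implicit Types (T : 'M[C]_2) (x y u : C) (U V : set C) (B : C -> 'M[C]_2) (g : 'M[R]_(2 + 2)).

#[local] Opaque holomorphic_at.

Local Notation sol := (sol w).
Local Notation jet := (jet z w).
Local Notation ode_coef := (ode_coef z w).
Local Notation coef_on_curve := (coef_on_curve H t c1 c2 z w).

Lemma subgroup_invK g : G g -> G (invmx g) /\ invmx g *m g = 1%:M.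
Proof.
case: hG => hS _ _ hV _ Gg; split; first exact: hV.
by rewrite mulVmx //; apply: Sp4_unit; exact: hS.
Qed.

Lemma act_invK g T : G g -> curve T -> act (invmx g) (act g T) = T.
Proof.
move=> Gg hT; have [Gi E] := subgroup_invK Gg; case: hact => _ _ h1 hM.
by rewrite -hM // E h1.
Qed.

Lemma curve_sym T : curve T -> T 1 0 = T 0 1.
Proof. by move=> /curveP[_ ->]; rewrite !sym2E. Qed.

(** The factor det (C T + D) in the transformation of [w] is exactly the one that clears the
    denominators of [phi] at the image; chi g is a scalar and enters the constant matrix. *)
Lemma sol_lincomb g : G g -> exists P : 'M[C]_5, forall T, curve T ->
  forall i : 'I_5, sol i (act g T) = \sum_(j < 5) P j i * sol j T.
Proof.
move=> Gg; have [M hM] := act_lincomb g; exists (\matrix_(j, i) (chi g * M i j)) => T hT i.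
case: hact => hu hc _ _.
have := hM T (curve_sym hT) (hu _ _ Gg hT) (curve_sym (hc _ _ Gg hT)) i => E.
rewrite solE hw_inv // mulrA [chi g * _]mulrC mulrA [phi _ _ * _]mulrC E mulr_suml mulr_suml.
by apply: eq_bigr => j _; rewrite mxE solE; ring.
Qed.

Lemma branch_act_hol g U B x : G g -> branch U B -> U x ->
  forall i j, holomorphic_at (fun y => act g (B y) i j) x.
Proof.
move=> Gg hB Ux; case: hact => hu _ _ _; have Un := branch_nbhs hB Ux.
apply: (act_hol (branch_hol hB Ux)).
by near=> y; apply: (hu _ _ Gg); apply: (branch_curve hB); near: y.
Unshelve. all: by end_near. Qed.

(** * A group element between two branches *)

Section Pair.
Variables (g : 'M[R]_(2 + 2)) (U U' : set C) (B B' : C -> 'M[C]_2) (x x' : C).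
Hypotheses (Gg : G g) (hB : branch U B) (hB' : branch U' B') (Ux : U x) (Ux' : U' x')
  (gB : act g (B x) = B' x').

(** The action of [g] read in the coordinate tau of the branches [B] and [B']; [xi] will be its
    local inverse. *)
Definition eta y : C := act g (B y) 0 0.
Definition xi y : C := act (invmx g) (B' y) 0 0.

Lemma eta_base : eta x = x'.
Proof. by rewrite /eta gB (branch00 hB'). Qed.

Lemma eta_hol y : U y -> holomorphic_at eta y.
Proof. by move=> Uy; exact: branch_act_hol Gg hB Uy 0 0. Qed.

Lemma xi_hol y : U' y -> holomorphic_at xi y.
Proof. by move=> Uy; exact: branch_act_hol (subgroup_invK Gg).1 hB' Uy 0 0. Qed.

Lemma eta_branch : \forall y \near x, U' (eta y) /\ act g (B y) = B' (eta y).
Proof.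
have Un := branch_nbhs hB Ux; case: hact => _ hc _ _.
apply: (branch_lift oH hc1 hc2 hB' Ux' _ _ gB).
  by near=> y; apply: (hc _ _ Gg); apply: (branch_curve hB); near: y.
near=> y => i j; have Uy : U y by near: y.
exact: (hol_cont (branch_act_hol Gg hB Uy i j)).
Unshelve. all: by end_near. Qed.

Lemma xi_eta : \forall y \near x, xi (eta y) = y.
Proof.
have Un := branch_nbhs hB Ux; have eb := eta_branch.
near=> y; have Uy : U y by near: y.
have [_ E] : U' (eta y) /\ act g (B y) = B' (eta y) by near: y.
by rewrite /xi -E (act_invK Gg (branch_curve hB Uy)) (branch00 hB Uy).
Unshelve. all: by end_near. Qed.

Lemma eta_change : local_change eta (fun y => z (B y)) (fun y => z (B' y)) x.
Proof.
have Un := branch_nbhs hB Ux; have eb := eta_branch.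
have xe := nbhs_interior xi_eta.
split.
- by near=> y; apply/hol_derivable/eta_hol; near: y.
(* Differentiating [xi (eta y) = y] shows that the derivative of [eta] cannot vanish. *)
- near=> y; have Uy : U y by near: y.
  have [Ue _] : U' (eta y) /\ act g (B y) = B' (eta y) by near: y.
  have d := cder_comp (hol_cder (eta_hol Uy)) (hol_cder (xi_hol Ue)).
  have d' : is_derive y (1 : C) (fun v => xi (eta v)) 1.
    apply: cder_near (cder_id y).
    have xey : \forall v \near y, xi (eta v) = v by near: y; exact: xe.
    by near=> v; apply/esym; near: v.
  have /eqP := cder_unique d d'.
  by apply: contraTneq => ->; rewrite mulr0 eq_sym oner_eq0.
- move=> P; apply: dnbhs_comp; first exact: hol_cont (eta_hol Ux).
  have xe' := near_dnbhs xi_eta; near=> y.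
  have E : xi (eta y) = y by near: y.
  have yx : y != x by near: y; exact: dnbhs_neq.
  apply: contraNneq yx => ee; rewrite -E ee; apply/eqP; exact: nbhs_singleton xi_eta.
- near=> y; have [_ E] : U' (eta y) /\ act g (B y) = B' (eta y) by near: y.
  by rewrite -E hz_inv //; apply: (branch_curve hB); near: y.
Unshelve. all: by end_near. Qed.

(** The invariance of z makes D commute with the substitution [eta], so the constant matrix for the
    functions themselves works for all their derivatives. *)
Lemma jet_transport : exists P : 'M[C]_5,
  \forall y \near x^', forall m : 'I_6, jet B' m (eta y) = jet B m y *m P.
Proof.
have [P hP] := sol_lincomb Gg; exists P; apply: filter_forall => m.
have Un := branch_nbhs hB Ux; have eb := eta_branch.
have Ue : U' (eta x) by rewrite eta_base.
pose Z1 y := z (B y); pose Z2 y := z (B' y).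
have key (i : 'I_5) : \forall y \near x^', iter m (dz Z2) (fun y => sol i (B' y)) (eta y) =
    \sum_(j < 5) P j i * iter m (dz Z1) (fun y => sol j (B y)) y.
  have h1 := iter_dz_comp m eta_change (branch_pmero_z hz hB' Ue) (branch_pmero_sol hw i hB' Ue).
  have h2 := iter_dz_lincomb (fun j : 'I_5 => P j i) m (branch_pmero_z hz hB Ux)
    (fun j : 'I_5 => branch_pmero_sol hw j hB Ux).
  have e : \forall y \near x, sol i (B' (eta y)) = \sum_(j < 5) P j i * sol j (B y).
    near=> y; have [_ E] : U' (eta y) /\ act g (B y) = B' (eta y) by near: y.
    by rewrite -E hP //; apply: (branch_curve hB); near: y.
  have e' : \forall y \near x, Z1 y = Z1 y by near=> y.
  have h3 := near_dnbhs (iter_dz_near e' e).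
  refine (dnbhs_imp2 _ h3 (filterI h1 h2)); move=> y a [b c].
  exact: etrans (esym b) (etrans (a m) c).
have key' : \forall y \near x^', forall i : 'I_5, iter m (dz Z2) (fun y => sol i (B' y)) (eta y) =
    \sum_(j < 5) P j i * iter m (dz Z1) (fun y => sol j (B y)) y.
  by apply: filter_forall => i; exact: (key i).
apply: filterS key' => y hy; apply/rowP => i.
rewrite jetE mxE; apply: (etrans (hy i)); apply: eq_bigr => j _.
by rewrite jetE mulrC.
Unshelve. all: by end_near. Qed.

End Pair.

(** The matrices required by [coef_mulmx] come from [g] and from its inverse; the second one is
    pulled back along [eta]. *)
Lemma ode_coef_transport g U U' B B' x x' : G g -> branch U B -> branch U' B' -> U x -> U' x' ->
  act g (B x) = B' x' ->
  \forall y \near x^', forall j, ode_coef B y j = ode_coef B' (eta g B y) j.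
Proof.
move=> Gg hB hB' Ux Ux' gB; have [Gi _] := subgroup_invK Gg.
have gB' : act (invmx g) (B' x') = B x by rewrite -gB (act_invK Gg (branch_curve hB Ux)).
have [P hP] := jet_transport Gg hB hB' Ux Ux' gB.
have [Q hQ] := jet_transport Gi hB' hB Ux' Ux gB'.
have ch := eta_change Gg hB hB' Ux Ux' gB.
have hQ' : \forall y \near x^', forall m : 'I_6,
    jet B m (eta (invmx g) B' (eta g B y)) = jet B' m (eta g B y) *m Q.
  by rewrite -(eta_base hB' Ux' gB) in hQ; exact: (change_dnbhs ch hQ).
have xe := near_dnbhs (xi_eta Gg hB hB' Ux Ux' gB).
refine (dnbhs_imp2 _ hP (filterI hQ' xe)); move=> y a [b c] j.
have c' : eta (invmx g) B' (eta g B y) = y by exact: c.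
have E : coef (fun m => jet B m y) = coef (fun m => jet B' m (eta g B y)).
  apply: (@coef_mulmx _ _ _ _ P Q) => m; rewrite -ltnS => m6; first exact: (a (Ordinal m6)).
  by have := b (Ordinal m6); rewrite c'.
exact: (congr1 (fun f : nat -> C => - f j) E).
Unshelve. all: by end_near. Qed.

(** The coefficients correspond on punctured discs around [T] and its image; the maps [eta] of [g]
    and of its inverse carry this to the centres by [plim_comp]. *)
Lemma coef_on_curve_inv j g T : G g -> curve T ->
  coef_on_curve j (act g T) = coef_on_curve j T.
Proof.
move=> Gg hT; have hT' : curve (act g T) by case: hact => _ h _ _; exact: h.
have [U [B [hB Ux Bx]]] := curve_branch oH hT.
have [U' [B' [hB' Ux' Bx']]] := curve_branch oH hT'.
set x := T 0 0 in Ux Bx; set x' := act g T 0 0 in Ux' Bx'.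
have [Gi _] := subgroup_invK Gg.
have gB : act g (B x) = B' x' by rewrite Bx Bx'.
have gB' : act (invmx g) (B' x') = B x by rewrite -gB (act_invK Gg (branch_curve hB Ux)).
rewrite -[in LHS]Bx' -[in RHS]Bx.
rewrite (coef_on_branch z w oH hc1 hc2 j hB' Ux') (coef_on_branch z w oH hc1 hc2 j hB Ux).
have e1 := ode_coef_transport Gg hB hB' Ux Ux' gB.
have e2 := ode_coef_transport Gi hB' hB Ux' Ux gB'.
have b1 := eta_base hB' Ux' gB; have b2 := eta_base hB Ux gB'.
apply/esym; rewrite -b1; apply: (@plim_comp _ (eta g B) (eta (invmx g) B')).
- exact: (change_dnbhs (eta_change Gg hB hB' Ux Ux' gB)).
- move=> P hP; rewrite b1; apply: (change_dnbhs (eta_change Gi hB' hB Ux' Ux gB')).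
  by rewrite b2.
- exact: (filterS (fun y h => h j) e1).
- by rewrite b1; exact: (filterS (fun y h => h j) e2).
Qed.

End Invariance.

Theorem theorem3 (R : realType)
    (G : set 'M[R]_(2 + 2)) (H : set (Cx R)) (t : Cx R -> Cx R)
    (c1 c2 : Cx R)
    (z w : 'M[Cx R]_2 -> Cx R) (chi : 'M[R]_(2 + 2) -> Cx R)
    (hG : discrete_subgroup_Sp4 G)
    (hH : domain_in_upper_half_plane H)
    (ht : meromorphic_on H t)
    (hc1 : regular_part H t c1) (hc2 : regular_part H t c2)
    (hres : contains_residue_translations H t G)
    (hact : acts_on G (curve H t c1 c2))
    (hchi : is_character G chi)
    (hz : meromorphic_on_curve H t c1 c2 z)
    (hw : meromorphic_on_curve H t c1 c2 w)
    (hz_nc : nonconstant_on_curve H t c1 c2 z)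
    (hw_nc : nonconstant_on_curve H t c1 c2 w)
    (hz_inv : forall g T, G g -> curve H t c1 c2 T -> z (act g T) = z T)
    (hw_inv : forall g T, G g -> curve H t c1 c2 T ->
       w (act g T) = chi g * \det (denom g T) * w T) :
  exists a : 'I_5 -> 'M[Cx R]_2 -> Cx R,
    [/\ forall j, meromorphic_on_curve H t c1 c2 (a j),
        forall j g T, G g -> curve H t c1 c2 T -> a j (act g T) = a j T &
        let solution := solves_ode_in H t c1 c2 z a in
        [/\ solution w,
            solution (fun T => T 0 0 * w T),
            solution (fun T => T 0 1 * w T),
            solution (fun T => T 1 1 * w T) &
            solution (fun T => (T 0 0 * T 1 1 - T 0 1 ^+ 2) * w T)]].
Proof.
have oH : open H by case: hH.
exists (fun j => coef_on_curve H t c1 c2 z w j); split.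
- by move=> j; exact: coef_on_curve_meromorphic.
- move=> j g T Gg hT.
  exact: (coef_on_curve_inv oH hc1 hc2 hz hw hG hact hz_inv hw_inv j Gg hT).
have sol_ode (i : 'I_5) f : (forall T, f T = sol w i T) ->
    solves_ode_in H t c1 c2 z (fun j : 'I_5 => coef_on_curve H t c1 c2 z w j) f.
  move=> /funext -> V p [oV [U [B [s [hB hs sU pE zp]]]]] ha hf u Vu.
  exact: (param_ode oH hc1 hc2 hz hw oV hB hs sU pE zp ha hf Vu).
split.
- by apply: (sol_ode (inord 0)) => T; rewrite solE /phi inordK //= mul1r.
- by apply: (sol_ode (inord 1)) => T; rewrite solE /phi inordK.
- by apply: (sol_ode (inord 2)) => T; rewrite solE /phi inordK.
- by apply: (sol_ode (inord 3)) => T; rewrite solE /phi inordK.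
- by apply: (sol_ode (inord 4)) => T; rewrite solE /phi inordK.
Qed.
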